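(* Let $C$ and $D$ be generators of the $lC_0$-semigroups $\exp(sC)$ and $\exp(sD)$ in a complete (Hausdorff) locally convex space $\mathbf{X}$ and let $t>0$ be fixed. Denote by $C^\circ=(\exp(sC)^* )'_{s=0}$ and $D^\circ=(\exp(sD)^* )'_{s=0}$ the strong derivatives at $0$ of the functions $s\mapsto(\exp(sC))^*$ and $s\mapsto(\exp(sD))^*$ from $[0,\infty)$ to $\mathcal{L}(\mathbf{X}^* )$. Assume that there exists a set $\mathbf{B}\subset\mathcal{D}(C^\circ)\cap\mathcal{D}(D^\circ)$ such that the following conditions are satisfied: (i) $\mathcal{D}(C)\cap\mathcal{D}(D)$ is dense in $\mathbf{X}$; (ii) $\mathbf{B}$ is *-dense in $\mathbf{X}^*$; (iii) the function $[0,\infty)\ni s\mapsto\exp(sC)\exp(sD)$ belongs to $\mathcal{E}_{\mathbf{X}}$; (iv) the function $g(s,x)=(\exp(sD))^*x$, $s\ge0$, $x\in\mathbf{X}^*$, is continuous in $s$ at the point $s=0$ for each $x\in C^\circ(\mathbf{B})$. Then the sum of $C$ and $D$ possesses a closure and its closure is the generator of an $lC_0$-semigroup if and only if there exists a dense linear subspace $\mathbf{A}\subseteq\mathcal{D}(C)\cap\mathcal{D}(D)$ of $\mathbf{X}$ such that for any $f\in\mathbf{A}$ and $s\ge0$ there exists a sequence $\{f_n^s\}_{n=1}^\infty$, $f_n^s\in\mathcal{D}(\overline{C+D})$, satisfying the following conditions: (a) $w\text{-}\lim_{n\to\infty}\left((\exp(\tfrac tnC)\exp(\tfrac tnD))^{[ns]}f-f_n^s\right)=0$;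 (b) every subsequence of $\{f_n^s\}_{n=1}^\infty$ has a weakly convergent subsequence; (c) every subsequence of $\{(\overline{C+D})f_n^s\}_{n=1}^\infty$ has a weakly convergent subsequence. Furthermore, if conditions (a)–(c) are satisfied (for such a subspace $\mathbf{A}$), then for each $f\in\mathbf{X}$ $$\exp(s(\overline{C+D}))f=\lim_{n\to\infty}\left(\exp(\tfrac snC)\exp(\tfrac snD)\right)^nf,\quad s\ge0.$$
   Context: $\mathbf{X}$ is over $\mathbb{T}\in\{\mathbb{R},\mathbb{C}\}$ with topology generated by semi-norms $\|\cdot\|_\alpha$, $\alpha\in\Omega$. $\mathcal{L}(\mathbf{X})$ is the space of bounded linear operators in $\mathbf{X}$ with the topology of pointwise convergence; $I$ is the identity; $\mathcal{D}(\cdot)$ denotes domain; $[\cdot]$ is the integer part; $w\text{-}\lim$ is the limit in the weak topology $\sigma(\mathbf{X},\mathbf{X}^* )$. A family $G_\beta\in\mathcal{L}(\mathbf{X})$, $\beta\in\Gamma$, is equicontinuous if for any $\alpha\in\Omega$ there are finitely many $\alpha_1,\dots,\alpha_n\in\Omega$ and $b_1,\dots,b_n>0$ with $\sup_\beta\|G_\beta x\|_\alpha\le\sum_i b_i\|x\|_{\alpha_i}$ for all $x\in\mathbf{X}$. For $F:[0,\infty)\to\mathcal{L}(\mathbf{X})$ and $s\ge0$ put $\mathbf{B}^F_s=\{F(\tfrac dn)^m : md/n\le s,\ n,m\in\mathbb{N},\ d\ge0\}$. $\mathcal{E}_{\mathbf{X}}$ is the set of $F:[0,\infty)\to\mathcal{L}(\mathbf{X})$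 with $F(0)=I$ and $\mathbf{B}^F_s$ equicontinuous for every $s\ge0$. $\mathbf{X}^*$ is the space of continuous linear functionals with the strong topology (semi-norms $f\mapsto\sup_{x\in A}|f(x)|$, $A\subset\mathbf{X}$ bounded). The strong derivative at $0$ of $S:[0,\infty)\to\mathcal{L}(\mathbf{E})$ is $S'(0)\psi=\lim_{h\to0}h^{-1}(S(h)\psi-S(0)\psi)$ with domain $\mathcal{D}(S'(0))$ the set of $\psi\in\mathbf{E}$ for which the limit exists. A set $A\subset\mathbf{X}^*$ is *-dense in $\mathbf{X}^*$ if for each $\phi\in\mathbf{X}^*$ there is a sequence $\phi_k\in A$ with $\lim_k\phi_k(x)=\phi(x)$ for each $x$ in the completion of $\mathbf{X}$. An $lC_0$-semigroup is a continuous function $T:[0,\infty)\to\mathcal{L}(\mathbf{X})$ with $T(0)=I$, $T(l+m)=T(l)T(m)$ for $l,m\ge0$, and $T\in\mathcal{E}_{\mathbf{X}}$. Its generator is its strong derivative $T'(0)$; if $Z$ is the generator of $T$, one writes $T(t)=\exp(tZ)$. $C+D$ has domain $\mathcal{D}(C)\cap\mathcal{D}(D)$. A linear operator is closable (possesses a closure) if the closure of its graph in $\mathbf{X}\times\mathbf{X}$ is the graph of a linear operator, its closure, denoted by an overline; under hypotheses (i) and (iii) $C+D$ is closable. *)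

(* Defs.v *)
From HB Require Import structures.
From mathcomp Require Import all_boot all_order all_algebra.
From mathcomp Require Import complex.
From mathcomp Require Import all_classical all_reals all_analysis.

Set Implicit Arguments.
Unset Strict Implicit.
Unset Printing Implicit Defensive.

Import Order.TTheory GRing.Theory Num.Theory.
Import numFieldNormedType.Exports.

Local Open Scope classical_set_scope.
Local Open Scope ring_scope.

Variant scalar_kind := RealScalars | ComplexScalars.

Definition scalar_field (R : realType) (k : scalar_kind) : numFieldType :=
  match k with
  | RealScalars => R
  | ComplexScalars => R[i]
  end.

Definition of_real (R : realType) (k : scalar_kind) : R -> scalar_field R k :=
  match k with
  | RealScalars => id
  | ComplexScalars => real_complex R
  end.

Section continuous_linear_maps.
Context {K : numFieldType}.

Definition is_continuous_linear (X Y : tvsType K) : {pred X -> Y} :=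
  fun f => `[< linear f /\ continuous f >].

(* An element of B^F_s is continuous as soon as B^F_s is equicontinuous, so
   taking L(X) to consist of the continuous linear operators does not change
   the class E_X, even where bounded operators need not be continuous. *)
Record clmap (X Y : tvsType K) := CLMap {
  clmap_fun :> X -> Y;
  clmap_prop : clmap_fun \in @is_continuous_linear X Y }.

HB.instance Definition _ (X Y : tvsType K) := [isSub for @clmap_fun X Y].
HB.instance Definition _ (X Y : tvsType K) := [Choice of clmap X Y by <:].

Lemma clmapP (X Y : tvsType K) (f : clmap X Y) : linear f /\ continuous f.
Proof. by have /asboolP := clmap_prop f. Qed.

Lemma comp_continuous_linear (X Y Z : tvsType K) (g : clmap Y Z)
  (f : clmap X Y) : g \o f \in @is_continuous_linear X Z.
Proof.
have [lf cf] := clmapP f; have [lg cg] := clmapP g.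
apply/asboolP; split; first by move=> a x y /=; rewrite lf lg.
by move=> x; apply: continuous_comp; [exact: cf|exact: cg].
Qed.

Definition clmap_comp (X Y Z : tvsType K) (g : clmap Y Z) (f : clmap X Y) :
  clmap X Z := CLMap (comp_continuous_linear g f).

Lemma continuous_linear_submod_closed (X Y : tvsType K) :
  submod_closed (@is_continuous_linear X Y).
Proof.
split=> [|a f g /asboolP[lf cf] /asboolP[lg cg]]; apply/asboolP; split.
- by move=> a x y; rewrite /= scaler0 addr0.
- by move=> x; exact: cvg_cst.
- move=> b x y.
  rewrite -[LHS]/(a *: f (b *: x + y) + g (b *: x + y)).
  rewrite -[RHS]/(b *: (a *: f x + g x) + (a *: f y + g y)) lf lg.
  by rewrite !scalerDr !scalerA mulrC addrACA.
- move=> x; apply: (@continuous_comp _ (Y * Y)%type _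
    (fun x => (a *: f x, g x)) (fun z => z.1 + z.2)); last exact: add_continuous.
  apply: cvg_pair => /=; last exact: cg.
  apply: (@continuous_comp _ (K^o * Y)%type _ (fun x => (a, f x))
    (fun z => z.1 *: z.2)); last exact: scale_continuous.
  by apply: (@cvg_pair _ _ _ _ (nbhs (a : K^o))) => /=;
    [exact: cvg_cst|exact: cf].
Qed.

HB.instance Definition _ (X Y : tvsType K) :=
  GRing.isSubmodClosed.Build K (X -> Y) (@is_continuous_linear X Y)
    (continuous_linear_submod_closed X Y).
HB.instance Definition _ (X Y : tvsType K) :=
  [SubChoice_isSubLmodule of clmap X Y by <:].

Definition tvs_bounded (X : tvsType K) (A : set X) :=
  forall U, nbhs (0 : X) U -> exists2 r0 : K, 0 < r0 &
    forall r : K, r0 <= `|r| -> A `<=` [set r *: x | x in U].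

Definition dual (X : tvsType K) := clmap X K^o.

HB.instance Definition _ (X : tvsType K) := GRing.Lmodule.on (dual X).

Definition dual_fun (X : tvsType K) (f : dual X) :
  {family (@tvs_bounded X), X -> K} := f : X -> K.

(* The strong topology: uniform convergence on bounded sets. *)
HB.instance Definition _ (X : tvsType K) :=
  Topological.copy (dual X) (initial_topology (@dual_fun X)).

Definition adjoint (X : tvsType K) (A : clmap X X) (f : dual X) : dual X :=
  clmap_comp f A.

(* This is sigma(X, X^* ). *)
Definition weak_space (X : tvsType K) : topologicalType :=
  initial_topology
    (fun x : X => (fun f : dual X => (f : X -> K) x) : {ptws dual X -> K}).

Definition weak_cvg (X : tvsType K) (u : nat -> X) (l : X) :=
  (u : nat -> weak_space X) @ \oo --> (l : weak_space X).

Definition weakly_seq_precompact (X : tvsType K) (u : nat -> X) :=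
  forall i : nat -> nat, {homo i : m n / (m < n)%N} ->
  exists j : nat -> nat, {homo j : m n / (m < n)%N} /\
    exists l : X, weak_cvg (u \o i \o j) l.

(* The uniform structure bundled in tvsType is only required to be compatible
   with the topology, not to be translation invariant, so library completeness
   (cauchy, completeType) is not the completeness of a topological vector
   space; Cauchy filters are taken here for the vector space uniformity. *)
Definition tvs_cauchy (X : tvsType K) (F : set_system X) :=
  forall U, nbhs (0 : X) U ->
    exists2 A, F A & forall x y, A x -> A y -> U (x - y).

Definition tvs_complete (X : tvsType K) :=
  forall F : set_system X, ProperFilter F -> tvs_cauchy F ->
    exists l : X, F --> l.

(* X is meant to be complete, so it is its own completion. *)
Definition star_dense (X : tvsType K) (A : set (dual X)) :=
  forall f : dual X, exists2 u : nat -> dual X, (forall n, A (u n)) &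
    forall x : X, (u n : X -> K) x @[n --> \oo] --> (f : X -> K) x.

Definition linear_subspace (X : lmodType K) (A : set X) :=
  A 0 /\ forall (a : K) x y, A x -> A y -> A (a *: x + y).

(* An operator with domain in E is represented by its graph G : set (E * E). *)
Definition is_operator_graph (E : lmodType K) (G : set (E * E)) :=
  linear_subspace G /\ forall x y z, G (x, y) -> G (x, z) -> y = z.

Definition op_dom (E : Type) (G : set (E * E)) : set E :=
  [set x | exists y, G (x, y)].

Definition op_image (E : Type) (G : set (E * E)) (B : set E) : set E :=
  [set y | exists2 x, B x & G (x, y)].

Definition op_add (E : zmodType) (G H : set (E * E)) : set (E * E) :=
  [set xy | exists y z, [/\ G (xy.1, y), H (xy.1, z) & xy.2 = y + z]].

Definition closable (X : tvsType K) (G : set (X * X)) :=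
  is_operator_graph (closure G).

End continuous_linear_maps.

Section semigroups.
Context {R : realType} {k : scalar_kind}.
Notation K := (scalar_field R k).

Definition strong_derivative0 (E : preTopologicalLmodType K)
    (S : R -> E -> E) : set (E * E) :=
  [set xy | (of_real k h)^-1 *: (S h xy.1 - S 0 xy.1) @[h --> 0^'+] --> xy.2].

Definition seminorm (X : lmodType K) (q : X -> R) :=
  [/\ forall x, 0 <= q x, forall x y, q (x + y) <= q x + q y &
      forall (a : K) x, of_real k (q (a *: x)) = `|a| * of_real k (q x)].

Definition generating_seminorms (X : tvsType K) (Omega : Type)
    (p : Omega -> X -> R) :=
  (forall a, seminorm (p a)) /\
  forall U : set X, nbhs (0 : X) U <->
    exists (n : nat) (a : 'I_n -> Omega) (e : R),
      0 < e /\ [set x | forall i, p (a i) x < e] `<=` U.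

Definition equicontinuous_set (X : tvsType K) (Omega : Type)
    (p : Omega -> X -> R) (B : set (X -> X)) :=
  forall a, exists (n : nat) (c : 'I_n -> Omega) (b : 'I_n -> R),
    (forall i, 0 < b i) /\
    forall G, B G -> forall x, p a (G x) <= \sum_(i < n) b i * p (c i) x.

Definition power_set (X : tvsType K) (F : R -> clmap X X) (s : R) :
  set (X -> X) :=
  [set G | exists (n m : nat) (d : R),
    [/\ (0 < n)%N, (0 < m)%N, 0 <= d, m%:R * d / n%:R <= s &
        G = iter m (F (d / n%:R))]].

(* Functions on [0, oo[ are represented by functions on R whose values at
   negative arguments are irrelevant. *)
Definition class_E (X : tvsType K) (Omega : Type) (p : Omega -> X -> R)
    (F : R -> clmap X X) :=
  (forall x, F 0 x = x) /\
  forall s, 0 <= s -> equicontinuous_set p (power_set F s).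

Record lC0_semigroup (X : tvsType K) (Omega : Type) (p : Omega -> X -> R)
    (T : R -> clmap X X) : Prop := {
  lC0_continuous : {within `[0, +oo[, continuous
    (fun s : R => (T s : X -> X) : {ptws X -> X})};
  lC0_0 : forall x, T 0 x = x;
  lC0_add : forall l m, 0 <= l -> 0 <= m -> forall x, T (l + m) x = T l (T m x);
  lC0_class_E : class_E p T }.

Definition generator (X : tvsType K) (T : R -> clmap X X) : set (X * X) :=
  @strong_derivative0 X T.

Definition dual_derivative (X : tvsType K) (T : R -> clmap X X) :
  set (dual X * dual X) :=
  strong_derivative0 (fun s => @adjoint K X (T s)).

(* Sequences are indexed from 1 in the text, hence the shifts. *)
Definition trotter_condition (X : tvsType K) (expC expD : R -> clmap X X)
    (t : R) (Z : set (X * X)) (f : X) (s : R) :=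
  exists u v : nat -> X,
  [/\ forall n, Z (u n, v n),
      weak_cvg (fun n => iter (Num.truncn (n.+1%:R * s))
        (clmap_comp (expC (t / n.+1%:R)) (expD (t / n.+1%:R))) f - u n) 0,
      weakly_seq_precompact u &
      weakly_seq_precompact v].

Definition trotter_subspace (X : tvsType K) (expC expD : R -> clmap X X)
    (t : R) (C D : set (X * X)) (A : set X) :=
  [/\ linear_subspace A, dense A, A `<=` op_dom C `&` op_dom D &
      forall f s, A f -> 0 <= s ->
        trotter_condition expC expD t (closure (op_add C D)) f s].

End semigroups.

(* Main.v *)
Require Import Defs.
From HB Require Import structures.
From mathcomp Require Import all_boot all_order all_algebra.
From mathcomp Require Import complex ring lra.
From mathcomp Require Import all_classical all_reals all_analysis.
From mathcomp Require Import measurable_realfun.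

Set Implicit Arguments.
Unset Strict Implicit.
Unset Printing Implicit Defensive.

Import Order.TTheory GRing.Theory Num.Theory.
Import numFieldNormedType.Exports.

Local Open Scope classical_set_scope.
Local Open Scope ring_scope.

(** Put F(h) = exp(hC) exp(hD).  For phi in B the quotients (F(h)^* phi - phi)/h
    tend to (C° + D°) phi uniformly on bounded sets, whence C + D is closable.
    By (a)-(c) and a diagonal argument a subsequence of F(t/n)^[ns] f converges
    weakly, for all s at once, to u(ts) for a locally Lipschitz path u with
    (phi o u)' = ((C° + D°) phi) o u for phi in B.  Uniform boundedness, bounded
    convergence and Hahn-Banach turn these scalar equations into the integrated
    one: (\int_0^s u, u(s) - f) lies in the closure of C + D.

    No resolvent of C + D is available at this stage, so strong convergence is
    obtained from that integrated equation alone: F(h) is approximately a time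
    shift along graph elements, and splitting [0, S] into short blocks gives
    h \sum_(j < m) F(h)^j f -> \int_0^(mh) u uniformly for mh <= S.  As the orbits
    of F are uniformly Lipschitz on the domain, differencing over short blocks
    yields F(h)^m f -> u(mh) for h -> 0.  The limits on A extend to X by
    equicontinuity and form a semigroup generated by the closure of C + D.
    Conversely, Chernoff's theorem for a semigroup gives f_n^s = exp(ts(C+D)) f
    for all n. *)

(** The obstacle is that *-density provides functionals lam_n, with adjoint derivatives kap_n, that
    converge to a given l only pointwise and without any control on kap_n. Along the limit path a
    bound exists nevertheless: kap_n(u(r)) is the derivative of lam_n(u(.)) at r, hence a limit of
    values of lam_n on difference quotients of u, and these form a bounded set because u is
    Lipschitz. Uniform boundedness in a complete space then dominates kap_n(u(r)), while (c)
    supplies z with (u(r), z) in the closed graph, so that kap_n(u(r)) = lam_n(z) tends to l(z).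
    This z has no known regularity in r, so an equation u' = z cannot be exploited directly. The
    integral w of u is better behaved: the pair (w, u - f) is locally Lipschitz in both components,
    and w' = (u - f) + f. The constant f acts as a source term, which is why the Chernoff estimate
    is inhomogeneous. *)

Section real_scalars.
Context {R : realType} {k : scalar_kind}.
Notation K := (scalar_field R k).
Local Notation ofr := (@of_real R k).

Lemma of_real_is_zmod_morphism : zmod_morphism ofr.
Proof. by rewrite /of_real; case: k => // x y; rewrite /= rmorphB. Qed.

Lemma of_real_is_monoid_morphism : monoid_morphism ofr.
Proof. by rewrite /of_real; case: k => //; split=> [|x y]; rewrite /= ?rmorph1 ?rmorphM. Qed.

HB.instance Definition _ := GRing.isZmodMorphism.Build R K ofr
  of_real_is_zmod_morphism.
HB.instance Definition _ := GRing.isMonoidMorphism.Build R K ofr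
  of_real_is_monoid_morphism.

Lemma ler_of_real (a b : R) : (ofr a <= ofr b) = (a <= b).
Proof. by rewrite /of_real; case: k => //=; rewrite lecR. Qed.

Lemma ltr_of_real (a b : R) : (ofr a < ofr b) = (a < b).
Proof. by rewrite /of_real; case: k => //=; rewrite ltcR. Qed.

Lemma normr_of_real (a : R) : `|ofr a| = ofr `|a|.
Proof.
by rewrite /of_real; case: k => //=; rewrite normc_def /= expr0n addr0 sqrtr_sqr.
Qed.

Lemma of_real_eq0 (a : R) : (ofr a == 0) = (a == 0).
Proof. exact: fmorph_eq0. Qed.

(** Over C a functional is determined by its real part, and the estimates below compare real
    numbers. Working with real parts treats both scalar fields at once. *)
Definition re_part : K -> R :=
  match k return scalar_field R k -> R with
  | RealScalars => id
  | ComplexScalars => @complex.Re R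
  end.

Lemma re_partD (a b : K) : re_part (a + b) = re_part a + re_part b.
Proof. by move: a b; rewrite /re_part; case: k => //= -[? ?] [? ?]. Qed.

Lemma re_partZ (a : R) (b : K) : re_part (ofr a * b) = a * re_part b.
Proof.
move: b; rewrite /re_part /of_real.
by case: k => //= -[b c]; rewrite /= mul0r subr0.
Qed.

Lemma re_part_norm (b : K) : ofr `|re_part b| <= `|b|.
Proof.
move: b; rewrite /re_part /of_real; case: k => //= -[b c].
rewrite normc_def lecR /= -sqrtr_sqr ler_wsqrtr//.
by rewrite lerDl sqr_ge0.
Qed.

(** The order of [R[i]] compares only numbers with equal imaginary parts, so a positive radius is
    real. *)
Lemma of_real_ex (z : K) : 0 < z -> exists2 a : R, 0 < a & z = ofr a.
Proof.
move: z; rewrite /of_real; case: k => [z z0|[b c]]; first by exists z.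
rewrite ltcE /= => /andP[/eqP -> b0]; by exists b.
Qed.

End real_scalars.

(** * Continuous seminorms *)

Section continuous_seminorms.
Context {R : realType} {k : scalar_kind}.
Notation K := (scalar_field R k).
Local Notation ofr := (@of_real R k).

(** Homogeneity is asked for real scalars only, so that the absolute value of the real part of a
    functional qualifies. Being closed under sums and multiples, this class lets a single seminorm
    replace the finite families of the definitions. *)
Record csn (X : tvsType K) := Csn {
  csn_fun :> X -> R;
  csn_ge0 : forall x, 0 <= csn_fun x;
  csnD : forall x y, csn_fun (x + y) <= csn_fun x + csn_fun y;
  csnZ : forall (a : R) x, csn_fun (ofr a *: x) = `|a| * csn_fun x;
  csn_nbhs1 : nbhs (0 : X) [set x | csn_fun x < 1] }.

Variable X : tvsType K.
Implicit Types (q : csn X) (x y z : X).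

Lemma csn0 q : q 0 = 0.
Proof. by rewrite -(scale0r 0) -(rmorph0 ofr) csnZ normr0 mul0r. Qed.

Lemma csnN q x : q (- x) = q x.
Proof. by rewrite -scaleN1r -(rmorphN1 ofr) csnZ normrN1 mul1r. Qed.

Lemma csnB q x y : q (x - y) <= q x + q y.
Proof. by rewrite -(csnN q y) csnD. Qed.

Lemma csn_distC q x y : q (x - y) = q (y - x).
Proof. by rewrite -csnN opprB. Qed.

Lemma csn_tri q y x z : q (x - z) <= q (x - y) + q (y - z).
Proof. by rewrite -{1}(subrK y x) -addrA csnD. Qed.

Lemma csn_sub q x y : q x <= q (x - y) + q y.
Proof. by rewrite -{1}(subrK y x) csnD. Qed.

Lemma csn_sum q (I : Type) (r : seq I) (P : pred I) (f : I -> X) :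
  q (\sum_(i <- r | P i) f i) <= \sum_(i <- r | P i) q (f i).
Proof.
elim/big_ind2 : _ => //; first by rewrite csn0.
by move=> x a y b xa yb; rewrite (le_trans (csnD _ _ _))// lerD.
Qed.

Lemma csnZ_ge0 q (a : R) x : 0 <= a -> q (ofr a *: x) = a * q x.
Proof. by move=> a0; rewrite csnZ ger0_norm. Qed.

Lemma nbhs0_csn q (e : R) : 0 < e -> nbhs (0 : X) [set x | q x < e].
Proof.
move=> e0; have := nbhs0Z (r := ofr e) _ (csn_nbhs1 q).
rewrite of_real_eq0 gt_eqF// => /(_ isT); apply: filterS => x [y /= qy <-].
by rewrite csnZ gtr0_norm// gtr_pMr.
Qed.

Lemma nbhs_csn q x (e : R) : 0 < e -> nbhs x [set y | q (y - x) < e].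
Proof.
move=> e0; apply: filterS (nbhsT x (nbhs0_csn q e0)) => _ [y /= qy <-].
by rewrite addrAC subrr add0r.
Qed.

Program Definition csn_zero : csn X := @Csn X (fun=> 0) _ _ _ _.
Next Obligation. by []. Qed.
Next Obligation. by move=> *; rewrite addr0. Qed.
Next Obligation. by move=> *; rewrite mulr0. Qed.
Next Obligation. by apply: filterS filterT => x _ /=; rewrite ltr01. Qed.

Program Definition csn_add q1 q2 : csn X :=
  @Csn X (fun x => q1 x + q2 x) _ _ _ _.
Next Obligation. by move=> *; rewrite addr_ge0// csn_ge0. Qed.
Next Obligation. by move=> *; rewrite addrACA lerD// csnD. Qed.
Next Obligation. by move=> * /=; rewrite !csnZ mulrDr. Qed.
Next Obligation.
move=> q1 q2; have h : 0 < 2^-1 :> R by rewrite invr_gt0.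
apply: filterS (filterI (nbhs0_csn q1 h) (nbhs0_csn q2 h)) => x [/= a b].
by rewrite [ltRHS](splitr 1) ltrD// mul1r.
Qed.

Program Definition csn_scale (c : R) q : csn X :=
  @Csn X (fun x => `|c| * q x) _ _ _ _.
Next Obligation. by move=> *; rewrite mulr_ge0// csn_ge0. Qed.
Next Obligation. by move=> *; rewrite -mulrDr ler_wpM2l// csnD. Qed.
Next Obligation. by move=> * /=; rewrite !csnZ mulrCA. Qed.
Next Obligation.
move=> c q; have h : 0 < (`|c| + 1)^-1 by rewrite invr_gt0 ltr_wpDl.
apply: filterS (nbhs0_csn q h) => x /=.
rewrite -[ltRHS]mul1r ltr_pdivlMr ?ltr_wpDl//; apply: le_lt_trans.
by rewrite mulrC ler_wpM2l ?csn_ge0// lerDl.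
Qed.

Program Definition csn_comp q (G : X -> X) (lG : linear G) (cG : continuous G) :
  csn X := @Csn X (q \o G) _ _ _ _.
Next Obligation. by move=> *; exact: csn_ge0. Qed.
Next Obligation.
by move=> q G lG _ x y /=; rewrite -[x in G (x + _)]scale1r lG scale1r csnD.
Qed.
Next Obligation.
move=> q G lG _ a x /=; have G0 : G 0 = 0.
  by have := lG (-1) 0 0; rewrite scaler0 addr0 scaleN1r addNr.
by rewrite -[X in G X]addr0 lG G0 addr0 csnZ.
Qed.
Next Obligation.
move=> q G lG cG; have G0 : G 0 = 0.
  by have := lG (-1) 0 0; rewrite scaler0 addr0 scaleN1r addNr.
have /= := cG 0 [set x | q x < 1]; rewrite G0 => /(_ (csn_nbhs1 q)); exact.
Qed.

Lemma csn_sumP n (q : 'I_n -> csn X) :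
  exists q' : csn X, forall x, q' x = \sum_i q i x.
Proof.
elim: n q => [|n IH] q; first by exists csn_zero => x; rewrite big_ord0.
have [q' q'E] := IH (fun i => q (widen_ord (leqnSn n) i)).
by exists (csn_add q' (q ord_max)) => x; rewrite big_ord_recr /= q'E.
Qed.

Section generating.
Variables (Omega : Type) (p : Omega -> X -> R).
Hypothesis Xp : generating_seminorms p.

Program Definition csn_gen a : csn X := @Csn X (p a) _ _ _ _.
Next Obligation. by move=> a; have [/(_ a)[]] := Xp. Qed.
Next Obligation. by move=> a; have [/(_ a)[]] := Xp. Qed.
Next Obligation.
move=> a b x; have [/(_ a)[_ _ /(_ (ofr b) x)]] := Xp.
by rewrite normr_of_real -rmorphM => /fmorph_inj.
Qed.
Next Obligation.
move=> a; have [_ ->] := Xp.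
by exists 1%N, (fun=> a), 1; split=> // x /= /(_ ord0).
Qed.

(** A finite family of generating seminorms with radius [e] is replaced by its sum divided by [e],
    with radius 1. *)
Lemma nbhs_csnP x (U : set X) :
  nbhs x U <-> exists q, [set y | q (y - x) < 1] `<=` U.
Proof.
split=> [xU|[q /filterS]]; last by apply; exact: nbhs_csn.
have xU0 : nbhs (0 : X) [set y | U (y + x)].
  have := nbhsB (- x) xU; rewrite addNr; apply: filterS => _ [z Uz <-] /=.
  by rewrite addrC addrA subrr add0r.
have [_ /(_ _)/iffLR/(_ xU0)[n [a [e [e0 aeU]]]]] := Xp.
have [q qE] := csn_sumP (fun i => csn_gen (a i)).
exists (csn_scale e^-1 q) => y /=; rewrite qE => ye.
rewrite -(subrK x y); apply: aeU => i.
move: ye; rewrite gtr0_norm ?invr_gt0// mulrC ltr_pdivrMr// mul1r.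
apply: le_lt_trans; rewrite (bigD1 i)//= lerDl sumr_ge0// => j _.
exact: (csn_ge0 (csn_gen (a j))).
Qed.

Lemma cvg_csnP (T : Type) (F : set_system T) {FF : Filter F} (f : T -> X) x :
  f @ F --> x <-> forall q (e : R), 0 < e -> \forall t \near F, q (f t - x) < e.
Proof.
split=> [fx q e e0|H U /nbhs_csnP[q qU]]; first exact: fx (nbhs_csn q x e0).
by apply: filterS (H q 1 ltr01) => t qt; exact: qU.
Qed.

Lemma csn_eq0 x : hausdorff_space X -> (forall q, q x = 0) -> x = 0.
Proof.
move=> hX q0; apply: hX => A B /nbhs_csnP[q qA] B0; exists 0; split.
  by apply: qA; rewrite /= sub0r csnN q0.
exact: nbhs_singleton.
Qed.

Lemma csn_le_gen q : exists (n : nat) (a : 'I_n -> Omega) (b : R), 0 < b /\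
  forall x, q x <= b * \sum_i p (a i) x.
Proof.
have [_ /(_ _)/iffLR/(_ (csn_nbhs1 q))[n [a [e [e0 aeq]]]]] := Xp.
exists n, a, e^-1; split; first by rewrite invr_gt0.
move=> x; apply/ler_addgt0Pr => d d0; set s := \sum_i _.
have s0 : 0 <= s by apply: sumr_ge0 => i _; exact: (csn_ge0 (csn_gen (a i))).
(* The slack [d] keeps the scaling factor positive even if every [p (a i) x] vanishes. *)
pose l := e^-1 * s + d.
have l0 : 0 < l by rewrite ltr_wpDl// mulr_ge0// invr_ge0 ltW.
have /= : q (ofr l^-1 *: x) < 1.
  apply: aeq => i /=.
  rewrite -[p _ _]/(csn_gen (a i) _) csnZ gtr0_norm ?invr_gt0// mulrC ltr_pdivrMr//.
  rewrite /l mulrDr mulrA divff ?gt_eqF// mul1r.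
  rewrite (@le_lt_trans _ _ s) ?ltrDl ?mulr_gt0//.
  rewrite /s (bigD1 i)//= lerDl sumr_ge0// => j _.
  exact: (csn_ge0 (csn_gen (a j))).
by rewrite csnZ gtr0_norm ?invr_gt0// mulrC ltr_pdivrMr// mul1r => /ltW.
Qed.

Lemma equicontinuous_csn (B : set (X -> X)) : equicontinuous_set p B ->
  forall q, exists q', forall G, B G -> forall x, q (G x) <= q' x.
Proof.
move=> eB q; have [n [a [b [b0 qb]]]] := csn_le_gen q.
have /choice[q' q'P] : forall i, exists q' : csn X,
    forall G, B G -> forall x, p (a i) (G x) <= q' x.
  move=> i; have [m [c [d [d0 H]]]] := eB (a i).
  have [q' q'E] := csn_sumP (fun i => csn_scale (d i) (csn_gen (c i))).
  exists q' => G BG x; rewrite q'E (le_trans (H _ BG x))//.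
  by apply: ler_sum => j _ /=; rewrite gtr0_norm.
have [r rE] := csn_sumP q'.
exists (csn_scale b r) => G BG x /=; rewrite gtr0_norm// rE.
by rewrite (le_trans (qb _))// ler_pM2l// ler_sum// => i _; exact: q'P.
Qed.

Lemma csn_equicontinuous (B : set (X -> X)) :
  (forall q, exists q', forall G, B G -> forall x, q (G x) <= q' x) ->
  equicontinuous_set p B.
Proof.
move=> H a; have [q' q'P] := H (csn_gen a).
have [n [c [b [b0 qb]]]] := csn_le_gen q'.
exists n, c, (fun=> b); split=> // G BG x.
by rewrite -mulr_sumr (le_trans _ (qb _))//; exact: q'P.
Qed.

Lemma csn_cauchy_cvg (u : nat -> X) : tvs_complete X ->
  (forall q (e : R), 0 < e -> exists N, forall m n, (N <= m)%N -> (N <= n)%N ->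
     q (u m - u n) < e) ->
  exists l : X, u @ \oo --> l.
Proof.
move=> cX H; apply: (cX (u @ \oo)) => U /nbhs_csnP[q qU].
have [N HN] := H q 1 ltr01; exists (u @` [set n | (N <= n)%N]).
  by exists N => // n /= Nn; exists n.
by move=> _ _ [m Nm <-] [n Nn <-]; apply: qU; rewrite /= subr0; exact: HN.
Qed.

End generating.

End continuous_seminorms.
Arguments csn {R k} X.

(** * Hahn-Banach separation *)

Section hahn_banach.
Context {R : realType} {k : scalar_kind}.
Local Notation ofr := (@of_real R k).
Variable V : lmodType (scalar_field R k).
Implicit Types (f g l : V -> R) (x y : V).

(** An inequality suffices under scaling: applied with the inverse factor it yields equality, and it
    is easily inherited by infima. *)
Definition sublinear f := (forall x y, f (x + y) <= f x + f y) /\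
  forall (a : R) x, 0 <= a -> f (ofr a *: x) <= a * f x.

Definition real_linear l := (forall x y, l (x + y) = l x + l y) /\
  forall (a : R) x, l (ofr a *: x) = a * l x.

Lemma sublinear0 f : sublinear f -> f 0 = 0.
Proof.
move=> [fD fZ]; apply/eqP; rewrite eq_le; apply/andP; split.
  by have := fZ 0 0 (lexx _); rewrite rmorph0 scale0r mul0r.
by have := fD 0 0; rewrite addr0 lerDl.
Qed.

Lemma sublinear_opp f x : sublinear f -> - f (- x) <= f x.
Proof.
move=> sf; have [fD _] := sf.
by rewrite -subr_ge0 opprK -(sublinear0 sf) -(subrr x) fD.
Qed.

Lemma sublinearZ f (a : R) x : sublinear f -> 0 <= a ->
  f (ofr a *: x) = a * f x.
Proof.
move=> sf; have [_ fZ] := sf; rewrite le_eqVlt => /predU1P[<-|a0].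
  by rewrite rmorph0 scale0r mul0r sublinear0.
apply/eqP; rewrite eq_le fZ ?(ltW a0)//=.
have := fZ a^-1 (ofr a *: x); rewrite invr_ge0 ltW// => /(_ isT).
rewrite scalerA -rmorphM mulVf ?gt_eqF// rmorph1 scale1r.
by rewrite ler_pdivlMl.
Qed.

(** Subadditivity and scaling need only hold up to a change of index, which the infimum absorbs.
    This covers shifts along a ray, lower bounds of chains and the distance from a subspace. *)
Lemma sublinear_inf (I : Type) (A : set I) (g : I -> V -> R) (f0 : V -> R) :
  A !=set0 -> (forall i x, A i -> f0 x <= g i x) ->
  (forall i j x y, A i -> A j -> exists2 l, A l & g l (x + y) <= g i x + g j y) ->
  (forall i (a : R) x, A i -> 0 <= a ->
     exists2 l, A l & g l (ofr a *: x) <= a * g i x) ->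
  exists2 m, sublinear m &
    (forall i x, A i -> m x <= g i x) /\
    (forall x b, (forall i, A i -> b <= g i x) -> b <= m x).
Proof.
move=> [i0 Ai0] lb gD gZ.
pose m x := inf [set g i x | i in A].
have mle i x : A i -> m x <= g i x.
  move=> Ai; apply: ge_inf; last by exists i.
  by exists (f0 x) => _ [j Aj <-]; exact: lb.
have mlb x b : (forall i, A i -> b <= g i x) -> b <= m x.
  move=> H; apply: lb_le_inf; first by exists (g i0 x), i0.
  by move=> _ [i Ai <-]; exact: H.
exists m => //; split.
  move=> x y; rewrite -lerBlDr; apply: (mlb x) => i Ai.
  rewrite lerBlDr -lerBlDl; apply: (mlb y) => j Aj.
  rewrite lerBlDl; have [l Al gl] := gD i j x y Ai Aj.
  exact: le_trans (mle _ _ Al) gl.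
move=> a x; rewrite le_eqVlt => /predU1P[<-|a0].
  have [l Al gl] := gZ i0 0 x Ai0 (lexx _).
  by move: gl; rewrite !mul0r; apply: le_trans; exact: mle.
rewrite -ler_pdivrMl//; apply: (mlb _) => i Ai; rewrite ler_pdivrMl//.
have [l Al gl] := gZ i a x Ai (ltW a0).
exact: le_trans (mle _ _ Al) gl.
Qed.

(** Take g(x) as the infimum over t >= 0 of f(x + t y) - t f(y): t = 0 gives g <= f, and t = 1 at
    the point -y gives the last inequality. *)
Lemma sublinear_shift f y : sublinear f ->
  exists2 g, sublinear g & (forall x, g x <= f x) /\ g (- y) <= - f y.
Proof.
move=> sf; have [fD fZ] := sf.
have [||||g sg [gle _]] := @sublinear_inf R [set t | 0 <= t]
  (fun t x => f (x + ofr t *: y) - t * f y) (fun x => - f (- x)).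
- by exists 0 => /=.
- move=> t x /= t0; rewrite lerNl opprB lerBlDr -sublinearZ//.
  by rewrite addrC; apply: le_trans (fD _ _); rewrite addrAC subrr add0r.
- move=> s t x x' /= s0 t0; exists (s + t); first by rewrite /= addr_ge0.
  rewrite rmorphD scalerDl addrACA mulrDl opprD [leRHS]addrACA lerD2r.
  exact: fD.
- move=> t a x /= t0 a0; exists (a * t); first by rewrite /= mulr_ge0.
  by rewrite rmorphM -scalerA -scalerDr mulrBr mulrA lerD2r fZ.
exists g => //; split.
  move=> x; have := gle 0 x (lexx _).
  by rewrite rmorph0 scale0r addr0 mul0r subr0.
have := gle 1 (- y) ler01.
by rewrite rmorph1 scale1r addNr (sublinear0 sf) mul1r sub0r.
Qed.

(** A minimal sublinear functional below [f] is linear: it coincides with its own shift at every y,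
    so l(-y) <= -l(y), and subadditivity becomes additivity. The relation [r] is reversed, so a
    maximal element in Zorn's lemma is a minimal functional. *)
Lemma sublinear_linear f : sublinear f ->
  exists2 l, real_linear l & forall x, l x <= f x.
Proof.
move=> sf.
pose T := {g : V -> R | sublinear g /\ forall x, g x <= f x}.
pose r (s t : T) := `[< forall x, sval t x <= sval s x >].
have [||||[l [sl lf]] lmin] := @Zorn T r.
- by move=> t; apply/asboolP => x.
- move=> s t u /asboolP st /asboolP tu; apply/asboolP => x.
  exact: le_trans (tu x) (st x).
- move=> [s ps] [t pt] /asboolP/= st /asboolP/= ts; apply: eq_exist; apply/funext => x.
  by apply/eqP; rewrite eq_le st ts.
- move=> A Atot; have [A0|/set0P A0] := eqVneq A set0.
    by exists (exist _ f (conj sf (fun x => lexx _))) => s; rewrite A0.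
  have [|||m sm [mle mlb]] := @sublinear_inf T A (fun s => sval s) (fun x => - f (- x)) A0.
  + move=> [g [sg gf]] x _ /=; apply: le_trans (sublinear_opp _ sg).
    by rewrite lerN2.
  + move=> s t x y As At; have [/asboolP st|/asboolP ts] := Atot s t As At.
      exists t => //; case: t At st => g [[gD _] _] _ /= st.
      by apply: le_trans (gD _ _) _; rewrite lerD2r.
    exists s => //; case: s As ts => g [[gD _] _] _ /= ts.
    by apply: le_trans (gD _ _) _; rewrite lerD2l.
  + by move=> s a x As a0; exists s => //; case: s As => g [[_ gZ] _] _ /=; exact: gZ.
  have mf x : m x <= f x.
    case: A0 => s As; apply: le_trans (mle s x As) _.
    by case: s {As} => g [_ gf] /=.
  exists (exist _ m (conj sm mf)) => s As; apply/asboolP => x /=; exact: mle.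
have lN y : l (- y) = - l y.
  have [g sg [gl gy]] := sublinear_shift y sl.
  have gf x : g x <= f x by apply: le_trans (gl x) (lf x).
  have /(congr1 sval)/= gE := lmin (exist _ g (conj sg gf)) (asboolT gl).
  move: gy; rewrite gE => ly; apply/eqP; rewrite eq_le ly /=.
  by rewrite lerNl; exact: sublinear_opp.
have [lD lZ] := sl.
exists l => //; split=> [x y|a x].
  apply/eqP; rewrite eq_le lD /= -lerBrDr -(lN y).
  by rewrite -{1}(addrK y x) lD.
have [a0|/ltW a0] := leP 0 a; first exact: sublinearZ.
rewrite -[a]opprK rmorphN scaleNr lN sublinearZ ?oppr_ge0//.
by rewrite -mulNr.
Qed.

(** A linear minorant of the shift of [f] at [x] satisfies l(-x) <= -f(x), hence touches [f] at
    [x]. *)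
Theorem hahn_banach f x : sublinear f ->
  exists l, [/\ real_linear l, forall y, l y <= f y & l x = f x].
Proof.
move=> sf; have [g sg [gf gx]] := sublinear_shift x sf.
have [l ll lg] := sublinear_linear sg; exists l; split=> //.
  by move=> y; apply: le_trans (lg y) (gf y).
apply/eqP; rewrite eq_le (le_trans (lg x) (gf x)) /=.
have [_ lZ] := ll.
have lN : l (- x) = - l x by rewrite -scaleN1r -(rmorphN1 ofr) lZ mulN1r.
by rewrite -lerN2 -lN (le_trans (lg _)).
Qed.

End hahn_banach.

(** * Real-linear functionals and separation from a graph *)

Section real_functionals.
Context {R : realType} {k : scalar_kind}.
Notation K := (scalar_field R k).
Local Notation ofr := (@of_real R k).

(* Over C these are the real parts of the elements of the dual. *)
Record rfun (X : tvsType K) := Rfun {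
  rf :> X -> R;
  rf_linear : real_linear rf;
  rf_dom : exists q : csn X, forall x, `|rf x| <= q x }.

Variable X : tvsType K.
Implicit Types (q : csn X) (x y z : X) (l : rfun X).

Lemma rfD l x y : l (x + y) = l x + l y. Proof. by have [] := rf_linear l. Qed.
Lemma rfZ l (a : R) x : l (ofr a *: x) = a * l x.
Proof. by have [_] := rf_linear l; apply. Qed.
Lemma rf0 l : l 0 = 0.
Proof. by have := rfZ l 0 0; rewrite mul0r scaler0. Qed.
Lemma rfN l x : l (- x) = - l x.
Proof. by rewrite -scaleN1r -(rmorphN1 ofr) rfZ mulN1r. Qed.
Lemma rfB l x y : l (x - y) = l x - l y.
Proof. by rewrite rfD rfN. Qed.

Lemma csn_sublinear q : sublinear q.
Proof. by split=> [|a x a0]; [exact: csnD|rewrite csnZ_ge0]. Qed.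

Lemma le_abs_csn (l : X -> R) q : real_linear l -> (forall x, l x <= q x) ->
  forall x, `|l x| <= q x.
Proof.
move=> [_ lZ] lq x; rewrite ler_norml lq andbT lerNl -(csnN q x).
by rewrite -(mulN1r (l x)) -lZ rmorphN1 scaleN1r lq.
Qed.

Lemma rfun_norming q x : exists l, (forall y, `|l y| <= q y) /\ l x = q x.
Proof.
have [l [ll lq lx]] := hahn_banach x (csn_sublinear q).
have lq' := le_abs_csn ll lq.
by exists (@Rfun X l ll (ex_intro _ q lq')).
Qed.

Section generating.
Variables (Omega : Type) (p : Omega -> X -> R).
Hypothesis Xp : generating_seminorms p.

Lemma closure_csnP (G : set (X * X)) x y : closure G (x, y) <->
  forall q (e : R), 0 < e ->
    exists c d, [/\ G (c, d), q (c - x) < e & q (d - y) < e].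
Proof.
split=> [Gxy q e e0|H].
  have [] := Gxy ([set c | q (c - x) < e] `*` [set d | q (d - y) < e]).
    by exists ([set c | q (c - x) < e], [set d | q (d - y) < e]) => //; split;
      exact: nbhs_csn.
  by move=> [c d] [Gcd [/= qc qd]]; exists c, d.
move=> U [[U1 U2] [/= /(nbhs_csnP Xp)[q1 q1U] /(nbhs_csnP Xp)[q2 q2U]] UU].
have [c [d [Gcd qc qd]]] := H (csn_add q1 q2) 1 ltr01.
exists (c, d); split=> //; apply: UU; split => /=.
  by apply: q1U; apply: le_lt_trans qc => /=; rewrite lerDl csn_ge0.
by apply: q2U; apply: le_lt_trans qd => /=; rewrite lerDr csn_ge0.
Qed.

(** If (x, y) has positive distance from [G] for some [q], a functional dominated by that distance
    and touching it at (x, y) vanishes on [G] but not at (x, y). Its restrictions to the two factors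
    are [l1] and [l2]. Thus the closure of a subspace is weakly closed, which is how weak limits
    enter the graph. *)
Lemma closure_separation (G : set (X * X)) x y : linear_subspace G ->
  (forall l1 l2, (forall c d, G (c, d) -> l1 c + l2 d = 0) ->
    l1 x + l2 y = 0) ->
  closure G (x, y).
Proof.
move=> [G0 GD] H; apply/closure_csnP => q e e0; apply: contrapT => nG.
have dist c d : G (c, d) -> e <= q (x - c) + q (y - d).
  move=> Gcd; rewrite leNgt; apply/negP => lte; apply: nG; exists c, d.
  split=> //; rewrite csn_distC; apply: le_lt_trans lte.
    by rewrite lerDl csn_ge0.
  by rewrite lerDr csn_ge0.
have GDD u v : G u -> G v -> G (u + v).
  by move=> Gu Gv; have := GD 1 _ _ Gu Gv; rewrite scale1r.
have GZ a u : G u -> G (a *: u).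
  by move=> Gu; have := GD a _ _ Gu G0; rewrite addr0.
have [||||Q sQ [Qle Qlb]] := @sublinear_inf R k (X * X)%type (X * X)%type G
  (fun c v => q (v.1 - c.1) + q (v.2 - c.2)) (fun=> 0).
- by exists 0.
- by move=> c v _; rewrite addr_ge0// csn_ge0.
- move=> u v a b Gu Gv; exists (u + v); first exact: GDD.
  by rewrite /= [leRHS]addrACA; apply: lerD; rewrite opprD addrACA csnD.
- move=> u a v Gu a0; exists (ofr a *: u); first exact: GZ.
  by rewrite /= -!scalerBr !csnZ_ge0// -mulrDr.
have [L [lL LQ Lxy]] := hahn_banach (x, y) sQ.
have [LD LZ] := lL.
have LG u : G u -> L u = 0.
  have LG0 v : G v -> L v <= 0.
    move=> Gv; apply: le_trans (LQ v) _; apply: le_trans (Qle v v Gv) _.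
    by rewrite !subrr !csn0 addr0.
  move=> Gu; apply/eqP; rewrite eq_le LG0//= -oppr_le0 -mulN1r -LZ.
  by apply: LG0; apply: GZ.
have l1l : real_linear (fun c => L (c, 0)).
  split=> [a b|a b]; first by rewrite -LD; congr L; congr pair; rewrite addr0.
  by rewrite -LZ; congr L; congr pair; rewrite scaler0.
have l2l : real_linear (fun c => L (0, c)).
  split=> [a b|a b]; first by rewrite -LD; congr L; congr pair; rewrite addr0.
  by rewrite -LZ; congr L; congr pair; rewrite scaler0.
have l1q c : L (c, 0) <= q c.
  apply: le_trans (LQ _) _; apply: le_trans (Qle 0 _ G0) _.
  by rewrite /= !subr0 csn0 addr0.
have l2q c : L (0, c) <= q c.
  apply: le_trans (LQ _) _; apply: le_trans (Qle 0 _ G0) _.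
  by rewrite /= !subr0 csn0 add0r.
pose l1 := @Rfun X _ l1l (ex_intro _ q (le_abs_csn l1l l1q)).
pose l2 := @Rfun X _ l2l (ex_intro _ q (le_abs_csn l2l l2q)).
have Lsplit c d : L (c, d) = l1 c + l2 d.
  by rewrite -LD; congr L; congr pair; rewrite ?addr0 ?add0r.
have /eqP := H l1 l2 (fun c d Gcd => etrans (esym (Lsplit c d)) (LG _ Gcd)).
rewrite -Lsplit Lxy gt_eqF//; apply: lt_le_trans e0 _.
by apply: Qlb => -[c d] /= /dist.
Qed.

End generating.
End real_functionals.
Arguments rfun {R k} X.

(** * Duality and uniform boundedness *)

Section duality.
Context {R : realType} {k : scalar_kind}.
Notation K := (scalar_field R k).
Local Notation ofr := (@of_real R k).

Lemma initial_cvgP (S : choiceType) (T : topologicalType) (f : S -> T)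
    (F : set_system S) (s : S) : Filter F ->
  F --> (s : initial_topology f) <-> f @ F --> f s.
Proof.
move=> FF; split=> [Fs|Ffs A [_ [[B Bop <-] Bfs BA]]].
  by move=> A /(@initial_continuous S T f) /Fs.
by apply: filterS BA _; apply: Ffs; exact: open_nbhs_nbhs.
Qed.

Variable X : tvsType K.
Implicit Types (q : csn X) (x y z : X) (l : rfun X) (phi : dual X).

Lemma weak_cvgP (u : nat -> X) (x : X) : weak_cvg u x <->
  forall phi, (phi : X -> K) (u n) @[n --> \oo] --> (phi : X -> K) x.
Proof.
rewrite /weak_cvg initial_cvgP pointwise_cvgP; split=> H phi; exact: H phi.
Qed.

Lemma dual_cvg_bounded (T : Type) (F : set_system T) (FF : Filter F)
    (g : T -> dual X) phi : g @ F --> phi ->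
  forall A, tvs_bounded A -> forall e : R, 0 < e ->
    \forall t \near F, forall x, A x -> `|phi x - g t x| < ofr e.
Proof.
rewrite initial_cvgP => /fam_cvgP H A bA e e0.
have e0' : 0 < ofr e by rewrite -(rmorph0 ofr) ltr_of_real.
have /(_ [set h | forall y, A y -> ball (phi y : K) (ofr e) (h y)]) := H A bA.
apply; apply/uniform_nbhs.
exists [set xy | ball xy.1 (ofr e) xy.2]; split => //.
exact: (entourage_ball _ (PosNum e0')).
Qed.

Lemma dual_linear phi : linear (phi : X -> K^o).
Proof. by have [] := clmapP phi. Qed.

Lemma re_dual_linear phi : real_linear (fun x => re_part (phi x)).
Proof.
have lphi := dual_linear phi; split=> [x y|a x].
  by rewrite -[in LHS](scale1r x) lphi scale1r re_partD.
have phi0 : phi 0 = 0 by have := lphi (-1) 0 0; rewrite scaler0 addr0 scaleN1r addNr.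
by rewrite -[X in phi X]addr0 lphi phi0 addr0 re_partZ.
Qed.

Program Definition csn_dual phi : csn X :=
  @Csn R k X (fun x => `|re_part (phi x)|) _ _ _ _.
Next Obligation. by []. Qed.
Next Obligation. by move=> phi x y /=; have [-> _] := re_dual_linear phi; exact: ler_normD. Qed.
Next Obligation. by move=> phi a x /=; have [_ ->] := re_dual_linear phi; rewrite normrM. Qed.
Next Obligation.
move=> phi; have [lphi cphi] := clmapP phi.
have phi0 : phi 0 = 0 by have := lphi (-1) 0 0; rewrite scaler0 addr0 scaleN1r addNr.
have := cphi 0 [set z : K^o | `|z| < 1]; rewrite phi0 => H.
have U1 : nbhs (0 : K^o) [set z : K^o | `|z| < 1].
  by apply/nbhs_normP; exists 1 => //= z /=; rewrite sub0r normrN.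
have {H U1} : nbhs (0 : X) [set x | `|phi x : K| < 1] := H U1.
apply: filterS => x /= x1.
rewrite -(ltr_of_real (k := k)) rmorph1; apply: le_lt_trans x1; exact: re_part_norm.
Qed.

Lemma re_dual_dom phi : exists q, forall x, `|re_part (phi x)| <= q x.
Proof. by exists (csn_dual phi). Qed.

Definition rfun_dual phi : rfun X :=
  Rfun (re_dual_linear phi) (re_dual_dom phi).

Definition csn_rfun_subproof l : nbhs (0 : X) [set x | `|l x| < 1].
Proof.
have [q lq] := rf_dom l; apply: filterS (csn_nbhs1 q) => x /=.
exact: le_lt_trans.
Qed.

Program Definition csn_rfun l : csn X :=
  @Csn R k X (fun x => `|l x|) _ _ _ (csn_rfun_subproof l).
Next Obligation. by []. Qed.
Next Obligation. by move=> l x y /=; rewrite rfD ler_normD. Qed.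
Next Obligation. by move=> l a x /=; rewrite rfZ normrM. Qed.

Lemma dual_of_dominated (f : X -> K^o) q : linear f ->
  (forall x, `|f x| <= ofr (q x)) -> exists phi, (phi : X -> K) = f.
Proof.
move=> lf fq; suff cf : continuous f.
  by exists (CLMap (asboolT (conj lf cf) : f \in @is_continuous_linear _ X K^o)).
move=> x; apply/cvgrPdist_lt => e e0.
have [e' e'0 ->] := of_real_ex e0.
apply: filterS (nbhs_csn q x e'0) => y /= qy.
move: qy; rewrite -(ltr_of_real (k := k)) => qy; rewrite distrC.
rewrite -[f y - f x]addrC -scaleN1r -lf scaleN1r addrC.
exact: le_lt_trans (fq _) _.
Qed.

End duality.

(** Over C take phi(x) = l(x) - i l(i x), the imaginary part being forced by complex linearity; q(x)
    + q(i x) dominates it. *)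
Lemma rfun_complexify (R : realType) (k : scalar_kind)
    (X : tvsType (scalar_field R k)) (l : rfun X) :
  exists phi : dual X, forall x, re_part (phi x) = l x.
Proof.
have [q lq] := rf_dom l.
case: k X l q lq => X l q lq.
  have [||phi phiE] := @dual_of_dominated R RealScalars X l q.
  - by move=> a x y; rewrite rfD (rfZ l a).
  - exact: lq.
  by exists phi => x; rewrite phiE.
pose I0 : R[i] := Complex 0 1.
pose f : X -> R[i] := fun x => Complex (l x) (- l (I0 *: x)).
have li : linear (fun x : X => I0 *: x).
  by move=> a x y; rewrite scalerDr !scalerA mulrC.
have ci : continuous (fun x : X => I0 *: x).
  move=> x; apply: (@continuous_comp X (R[i]^o * X)%type X (fun x => (I0, x))
    (fun x => x.1 *: x.2)); last exact: scale_continuous.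
  by apply: (@cvg_pair _ _ _ _ (nbhs (I0 : R[i]^o))); [exact: cvg_cst|exact: cvg_id].
have ofrE (a : R) : of_real ComplexScalars a = a%:C%C by [].
have lcomp (a b : R) x : l ((a +i* b)%C *: x) = a * l x + b * l (I0 *: x).
  have -> : (a +i* b)%C = of_real ComplexScalars a + of_real ComplexScalars b * I0.
    by rewrite !ofrE; apply/eqP; rewrite eq_complex /=; apply/andP; split; apply/eqP; ring.
  by rewrite scalerDl -scalerA rfD !(rfZ l).
have [||phi phiE] := @dual_of_dominated R ComplexScalars X f (csn_add q (csn_comp q li ci)).
- move=> [a b] x y; rewrite /f rfD (lcomp a b) scalerDr rfD.
  rewrite scalerA.
  have -> : I0 * (a +i* b)%C = (- b +i* a)%C :> R[i].
    by apply/eqP; rewrite eq_complex /=; apply/andP; split; apply/eqP; ring.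
  rewrite (lcomp (- b) a); apply/eqP; rewrite eq_complex /=; apply/andP; split; apply/eqP; ring.
- move=> x /=.
  have -> : f x = (l x)%:C%C - I0 * (l (I0 *: x))%:C%C.
    by apply/eqP; rewrite eq_complex /f /=; apply/andP; split; apply/eqP; ring.
  apply: le_trans (ler_normB _ _) _.
  rewrite normrM rmorphD lerD//= !normc_def /= ?expr0n ?addr0 ?sqrtr_sqr ?lecR//.
  by rewrite add0r expr1n sqrtr1 mul1r lecR.
by exists phi => x; rewrite phiE.
Qed.

(** * Weak convergence and bounded sets *)

Section weak.
Context {R : realType} {k : scalar_kind}.
Notation K := (scalar_field R k).
Local Notation ofr := (@of_real R k).
Variable X : tvsType K.
Implicit Types (q : csn X) (x y z : X) (l : rfun X) (phi : dual X).

Lemma cvg_re_part (u : nat -> K) (a : K) : u n @[n --> \oo] --> a ->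
  re_part (u n) @[n --> \oo] --> re_part a.
Proof.
move=> ua; apply/cvgrPdist_lt => e e0.
have e0' : 0 < ofr e by rewrite -(rmorph0 ofr) ltr_of_real.
have /cvgrPdist_lt/(_ _ e0') := ua; apply: filterS => n ane.
rewrite -(ltr_of_real (k := k)); apply: le_lt_trans ane.
have -> : re_part a - re_part (u n) = re_part (a - u n).
  have := re_partZ (-1) (u n); rewrite rmorphN1 !mulN1r => <-.
  by rewrite re_partD.
exact: re_part_norm.
Qed.

Lemma weak_cvg_rfun (u : nat -> X) x : weak_cvg u x ->
  forall l, l (u n) @[n --> \oo] --> l x.
Proof.
move=> /weak_cvgP ux l; have [phi phiE] := rfun_complexify l.
rewrite -phiE -(eq_cvg _ _ (fun n => phiE (u n))); exact/cvg_re_part/ux.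
Qed.

Lemma star_dense_rfun (B : set (dual X)) : star_dense B ->
  forall l, exists2 phi : nat -> dual X, (forall n, B (phi n)) &
    forall x, rfun_dual (phi n) x @[n --> \oo] --> l x.
Proof.
move=> dB l; have [psi psiE] := rfun_complexify l.
have [phi Bphi phil] := dB psi; exists phi => // x.
by rewrite -psiE; exact/cvg_re_part/phil.
Qed.

Definition csn_bounded (A : set X) :=
  forall q, exists C : R, forall x, A x -> q x <= C.

Section generating.
Variables (Omega : Type) (p : Omega -> X -> R).
Hypothesis Xp : generating_seminorms p.

Lemma cvg_weak_cvg (u : nat -> X) x : u @ \oo --> x -> weak_cvg u x.
Proof.
move=> ux; apply/weak_cvgP => phi; have [_ /(_ x)] := clmapP phi.
exact: (cvg_comp _ _ ux).
Qed.

(** Absorption is required for every [r] in [K], whereas [csnZ] covers real scalars only; hence the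
    passage to the generating seminorms, which are homogeneous over [K]. *)
Lemma csn_bounded_tvs (A : set X) : csn_bounded A -> tvs_bounded A.
Proof.
move=> bA U /(nbhs_csnP Xp)[q qU].
have [n [a [b [b0 qab]]]] := csn_le_gen Xp q.
have [s sE] := csn_sumP (fun i => csn_gen Xp (a i)).
have [C CP] := bA (csn_scale b s).
have C0 : 0 < `|C| + 1 by rewrite ltr_wpDl.
exists (ofr (`|C| + 1)); first by rewrite -(rmorph0 ofr) ltr_of_real.
move=> r rC x Ax; have r0 : r != 0.
  apply: contraTneq rC => ->; rewrite normr0 -(rmorph0 ofr) ler_of_real.
  by rewrite -ltNge.
exists (r^-1 *: x); last by rewrite scalerA divff// scale1r.
apply: qU; rewrite /= subr0; apply: le_lt_trans (qab _) _.
have sr : ofr (\sum_i p (a i) (r^-1 *: x)) = `|r|^-1 * ofr (\sum_i p (a i) x).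
  rewrite !rmorph_sum mulr_sumr; apply: eq_bigr => i _.
  have [/(_ (a i))[_ _ pZ] _] := Xp.
  by rewrite -[LHS]/(ofr (p (a i) (r^-1 *: x))) pZ normfV.
rewrite -(ltr_of_real (k := k)) rmorphM /= sr mulrCA -rmorphM rmorph1.
rewrite mulrC ltr_pdivrMr ?normr_gt0// mul1r; apply: lt_le_trans rC.
rewrite ltr_of_real; have := CP x Ax; rewrite /= sE gtr0_norm// => bC.
by apply: le_lt_trans bC _; rewrite ltr_pwDr// ler_norm.
Qed.

End generating.

Section banach_steinhaus.
Variables (Omega : Type) (p : Omega -> X -> R).
Hypothesis Xp : generating_seminorms p.
Hypothesis X_complete : tvs_complete X.

Lemma expr3_small (C e : R) : 0 < e -> exists N, forall n, (N <= n)%N ->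
  C * (3^-1) ^+ n < e.
Proof.
move=> e0; have [N] : exists N : nat, `|C| / e < N%:R.
  by exists (Num.bound (`|C| / e)); rewrite archi_boundP// divr_ge0// ltW.
rewrite ltr_pdivrMr// => CN; exists N => n Nn.
rewrite exprVn ltr_pdivrMr ?exprn_gt0//.
apply: le_lt_trans (ler_norm _) _; apply: lt_le_trans CN _.
rewrite mulrC ler_pM2l// -natrX ler_nat (leq_trans Nn)//.
by rewrite ltnW// ltn_expl.
Qed.

(* Gliding hump along a + 3^-j x_j or a - 3^-j x_j: one of the two signs does
   not decrease the j-th functional below 3^-j |l_j x_j|, and the later terms
   together move it by at most three quarters of that. *)
Lemma banach_steinhaus (l : nat -> rfun X) (A : set X) : csn_bounded A ->
  (forall x, exists M : R, forall n, `|l n x| <= M) ->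
  exists M : R, forall n x, A x -> `|l n x| <= M.
Proof.
move=> bA ptb; apply: contrapT => nM.
(* For a single functional the supremum over [A] is finite; a point reaching two thirds of it gives
   the factor 3 / 2. *)
have hump (M : R) : 0 <= M -> exists nx : nat * X, [/\ A nx.2,
    M < `|l nx.1 nx.2| & forall y, A y -> `|l nx.1 y| <= 3 / 2 * `|l nx.1 nx.2|].
  move=> M0; have [n [x [Ax Mx]]] : exists n x, A x /\ 3 / 2 * M < `|l n x|.
    apply: contrapT => H; apply: nM; exists (3 / 2 * M) => n x Ax.
    by rewrite leNgt; apply/negP => Mx; apply: H; exists n, x.
  pose E := [set `|l n y| | y in A].
  have hE : has_sup E.
    split; first by exists `|l n x|, x.
    have [C CP] := bA (csn_rfun (l n)).
    by exists C => _ [y Ay <-]; exact: CP.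
  have xE : `|l n x| <= sup E by apply: ub_le_sup; [case: hE|exists x].
  have E0 : 0 < sup E / 3 by rewrite divr_gt0//; lra.
  have [_ [y Ay <-] yE] := sup_adherent E0 hE.
  exists (n, y); split=> //=; first by lra.
  move=> z Az; have zE : `|l n z| <= sup E by apply: ub_le_sup; [case: hE|exists z].
  lra.
(* After division by 3^j and the loss of three quarters, a hump larger than 4 j 3^j still leaves
   more than j. *)
have h0 j : 0 <= 4 * j%:R * 3 ^+ j :> R by rewrite !mulr_ge0// exprn_ge0.
have /choice[nx nxP] := fun j : nat => hump _ (h0 j).
pose L j := l (nx j).1; pose xj j := (nx j).2.
pose d j := ofr ((3^-1) ^+ j) *: xj j.
pose a := fix a j := if j is j'.+1 then
  (if `|L j' (d j')| <= `|L j' (a j' + d j')| then a j' + d j' else a j' - d j')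
  else 0.
have aE j : `|L j (d j)| <= `|L j (a j.+1)|.
  rewrite /=; case: ifPn => //; rewrite -ltNge => lt1.
  move: lt1; rewrite rfB rfD ltr_norml ler_normr.
  by case: (ger0P (L j (d j))) => ? /andP[? ?]; apply/orP; [right|left]; lra.
have ad q j : q (a j.+1 - a j) = (3^-1) ^+ j * q (xj j).
  have e0 : 0 <= (3^-1 : R) ^+ j by rewrite exprn_ge0.
  rewrite /=; case: ifPn => _.
    by rewrite addrAC subrr add0r csnZ_ge0.
  by rewrite addrAC subrr add0r csnN csnZ_ge0.
have adm q (C : R) m n : 0 <= C -> (forall j, q (xj j) <= C) ->
    q (a (n + m)%N - a n) <= C * (3 / 2) * ((3^-1) ^+ n - (3^-1) ^+ (n + m)).
  move=> C0 qC; elim: m => [|m IH].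
    by rewrite addn0 subrr csn0 subrr mulr0.
  rewrite addnS; apply: le_trans (csn_tri _ (a (n + m)%N) _ _) _.
  apply: le_trans (lerD (lexx _) IH) _; rewrite ad.
  have e0 : 0 <= (3^-1 : R) ^+ (n + m) by rewrite exprn_ge0.
  have := ler_wpM2l e0 (qC (n + m)%N); rewrite exprS.
  move: ((3^-1 : R) ^+ (n + m)) ((3^-1 : R) ^+ n) => s t; lra.
have [b ab] : exists b : X, (a : nat -> X) @ \oo --> b.
  apply: (@csn_cauchy_cvg _ _ _ _ _ Xp a X_complete) => q e e0.
  have [C CP] := bA q.
  have qC j : q (xj j) <= `|C|.
    by rewrite (le_trans (CP _ _)) ?ler_norm//; have [] := nxP j.
  have [N NP] := expr3_small (`|C| * (3 / 2)) e0.
  have key m n : (N <= n)%N -> (n <= m)%N -> q (a m - a n) < e.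
    move=> Nn nm; rewrite -(subnKC nm).
    apply: le_lt_trans (adm q `|C| _ _ _ qC) _ => //.
    apply: le_lt_trans (NP _ Nn); rewrite ler_wpM2l ?mulr_ge0//.
    by rewrite lerBlDr lerDl exprn_ge0.
  exists N => m n Nm Nn; case/orP: (leq_total n m) => nm; first exact: key.
  by rewrite csn_distC key.
have [M MP] := ptb b.
pose j := (Num.bound `|M|).+1.
have jM : M < j%:R.
  have := archi_boundP (normr_ge0 M); have := ler_norm M.
  by rewrite /j -natr1; lra.
have [_ big sup] := nxP j.
pose q := csn_rfun (L j); pose V := `|L j (xj j)|.
have V0 : 0 <= V by exact: normr_ge0.
(* Geometric tail: (3/2 V) (3/2) 3^-(j+1) = (3/4) V 3^-j. *)
have qab : q (b - a j.+1) <= V * (3 / 4) * (3^-1) ^+ j.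
  apply/ler_addgt0Pr => e e0.
  have /(cvg_csnP Xp)/(_ q e e0)[N _ NP] := ab.
  have := NP (j.+1 + N)%N (leq_addl _ _); rewrite /= -[X in X < _]/(q _) => qN.
  have := @adm q (3 / 2 * V) N j.+1 _ _; rewrite mulr_ge0// => /(_ isT).
  have qC i : q (xj i) <= 3 / 2 * V by apply: sup; have [] := nxP i.
  move=> /(_ qC) adN; rewrite [leRHS]addrC.
  apply: le_trans (csn_tri q (a (j.+1 + N)%N) b (a j.+1)) _.
  rewrite csn_distC; apply: lerD; first exact: ltW.
  apply: le_trans adN _.
  have e1 : 0 <= (3^-1 : R) ^+ (j.+1 + N) by rewrite exprn_ge0.
  have := mulr_ge0 V0 e1; rewrite mulrBr exprS.
  move: ((3^-1 : R) ^+ j) ((3^-1 : R) ^+ (_ + N)) => s t; lra.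
have := aE j; rewrite rfZ normrM ger0_norm ?exprn_ge0// -/V => Va.
have Lab : `|L j (a j.+1)| <= `|L j b| + q (b - a j.+1).
  rewrite /q /= rfB.
  by rewrite -{1}(subKr (L j b) (L j (a j.+1))); exact: ler_normB.
have := MP (nx j).1; rewrite -/(L j) => Mb.
have : 4 * j%:R < V * (3^-1) ^+ j.
  by rewrite exprVn ltr_pdivlMr ?exprn_gt0.
by move: Mb Lab Va qab; move: ((3^-1 : R) ^+ j) => s; lra.
Qed.

End banach_steinhaus.
End weak.

Tactic Notation "near_at" constr(H) ident(x) ident(Hx) :=
  unshelve epose proof (near H x _) as Hx; first by [].

(** * Inhomogeneous Chernoff estimate *)

Section chernoff.
Context {R : realType} {k : scalar_kind}.
Notation K := (scalar_field R k).
Local Notation ofr := (@of_real R k).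
Variable X : tvsType K.
Implicit Types (q : csn X) (x y z : X) (G : clmap X X).

Lemma csn_subDr q y x x' : q (x + y - (x' + y)) = q (x - x').
Proof. by rewrite opprD addrACA subrr addr0. Qed.

Lemma csn_subDl q y x x' : q (y + x - (y + x')) = q (x - x').
Proof. by rewrite opprD addrACA subrr add0r. Qed.

Lemma csn_sum_le q l (f : nat -> X) (C : R) :
  (forall j, (j < l)%N -> q (f j) <= C) -> q (\sum_(j < l) f j) <= l%:R * C.
Proof.
move=> fC; apply: le_trans (csn_sum _ _ _ _) _.
apply: le_trans (_ : \sum_(j < l) C <= _); first by apply: ler_sum => j _; exact: fC.
by rewrite big_const_ord iter_addr_0 mulr_natl.
Qed.

Lemma clmap_linear G : linear G. Proof. by have [] := clmapP G. Qed.

Lemma iter_linear G m : linear (iter m G).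
Proof. by elim: m => // m IH a x y; rewrite !iterS IH clmap_linear. Qed.

Lemma iterD_clmap G m x y : iter m G (x + y) = iter m G x + iter m G y.
Proof. by rewrite -[x in LHS]scale1r iter_linear scale1r. Qed.

Lemma iter0_clmap G m : iter m G 0 = 0.
Proof. by have := iter_linear G m (-1) 0 0; rewrite scaler0 addr0 scaleN1r addNr. Qed.

Lemma iterZ_clmap G m (a : K) x : iter m G (a *: x) = a *: iter m G x.
Proof. by have := iter_linear G m a x 0; rewrite addr0 iter0_clmap addr0. Qed.

Lemma iterB_clmap G m x y : iter m G (x - y) = iter m G x - iter m G y.
Proof. by rewrite iterD_clmap -scaleN1r iterZ_clmap scaleN1r. Qed.

Lemma iter_sum_clmap G m (I : Type) (r : seq I) (P : pred I) (f : I -> X) :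
  iter m G (\sum_(i <- r | P i) f i) = \sum_(i <- r | P i) iter m G (f i).
Proof.
by apply: (big_morph (iter m G)) => [x y|]; [exact: iterD_clmap|exact: iter0_clmap].
Qed.

Lemma iter_telescope G m n x :
  iter (m + n) G x - iter m G x = \sum_(j < n) iter (m + j) G (G x - x).
Proof.
elim: n => [|n IH]; first by rewrite addn0 subrr big_ord0.
rewrite big_ord_recr /= -IH iterB_clmap -iterSr addnS.
by rewrite [RHS]addrC addrA subrK.
Qed.

Lemma finite_pos_lb n (c : 'I_n -> R) : (forall i, 0 < c i) ->
  exists2 d, 0 < d & forall i, d <= c i.
Proof.
elim: n c => [|n IH] c c0; first by exists 1 => // -[].
have [d d0 dc] := IH (fun i => c (lift ord0 i)) (fun i => c0 _).
exists (Num.min d (c ord0)); first by rewrite lt_min d0 c0.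
move=> i; case: (unliftP ord0 i) => [j ->|->]; rewrite ge_min ?dc//.
by rewrite lexx orbT.
Qed.

Lemma truncn_bounds (x : R) : 0 <= x ->
  (Num.truncn x)%:R <= x /\ x < (Num.truncn x)%:R + 1.
Proof. by move=> /truncn_itv/andP[a b]; split=> //; rewrite natr1. Qed.

Variables (Omega : Type) (p : Omega -> X -> R).
Hypothesis Xp : generating_seminorms p.
Variable F : R -> clmap X X.

Definition locally_equicontinuous := forall (S : R) q, exists q' : csn X,
  forall h m x, 0 <= h -> m%:R * h <= S -> q (iter m (F h) x) <= q' x.

Definition derivative_extends (Z : set (X * X)) := forall x y, Z (x, y) ->
  forall q (e : R), 0 < e ->
    \forall h \near 0^'+, q (ofr h^-1 *: (F h x - x) - y) < e.

Hypothesis Feq : locally_equicontinuous.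
Variable Z0 : set (X * X).
Hypothesis FZ0 : derivative_extends Z0.

(** Telescoping: each of the [n] increments is an iterate applied to F(h) x - x, which is h times a
    vector close to [y], and equicontinuity bounds the iterates by [q1]. *)
Lemma iter_lipschitz x y : Z0 (x, y) -> forall (S : R) q,
  exists2 L : R, 0 <= L & \forall h \near 0^'+, forall m n,
    (m + n)%:R * h <= S ->
    q (iter (m + n) (F h) x - iter m (F h) x) <= L * (n%:R * h).
Proof.
move=> Zxy S q; have [q1 q1P] := Feq S q.
exists (1 + q1 y); first by rewrite addr_ge0// csn_ge0.
near=> h => m n mnS.
have h0 : 0 < h by near: h; exact: nbhs_right_gt.
rewrite iter_telescope mulrCA; 
apply: (csn_sum_le (f := fun j => iter (m + j) (F h) (F h x - x))) => j jn.
apply: le_trans (q1P _ _ _ (ltW h0) _) _.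
  apply: le_trans mnS; rewrite ler_pM2r// ler_nat leq_add2l; exact: ltnW.
have -> : F h x - x = ofr h *: (ofr h^-1 *: (F h x - x)).
  by rewrite scalerA -rmorphM divff ?gt_eqF// rmorph1 scale1r.
rewrite csnZ_ge0 ?(ltW h0)// mulrC ler_pM2r//.
apply: le_trans (csn_sub _ _ y) _; rewrite lerD2r ltW//.
by near: h; exact: FZ0.
Unshelve. all: by end_near. Qed.

Hypothesis Z0_dense : forall x q (e : R), 0 < e ->
  exists x' y', Z0 (x', y') /\ q (x' - x) < e.

(** Orbits of domain elements are Lipschitz, and density with equicontinuity does the rest. One
    [eta] serves all small steps: this is strong continuity at 0, uniform in the step size. *)
Lemma iter_small_time x q (e : R) : 0 < e -> exists2 eta : R, 0 < eta &
  \forall h \near 0^'+, forall j, j%:R * h <= eta ->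
    q (iter j (F h) x - x) <= e.
Proof.
move=> e0; have [q1 q1P] := Feq 1 q.
have e3 : 0 < e / 3 by rewrite divr_gt0.
have [x' [y' [Zxy xx']]] := Z0_dense x (csn_add q q1) e3.
have [L L0 HL] := iter_lipschitz Zxy 1 q.
have L1 : 0 < L + 1 by rewrite ltr_wpDl.
exists (Num.min 1 (e / 3 / (L + 1))).
  by rewrite lt_min ltr01/= divr_gt0.
near=> h => j; rewrite le_min => /andP[jh1 jhe].
have h0 : 0 < h by near: h; exact: nbhs_right_gt.
apply: le_trans (csn_tri _ (iter j (F h) x') _ _) _.
have H1 : q (iter j (F h) x - iter j (F h) x') <= q1 (x' - x).
  by rewrite -iterB_clmap csn_distC; apply: q1P => //; exact: ltW.
have H2 : q (iter j (F h) x' - x) <= q (iter j (F h) x' - x') + q (x' - x).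
  exact: csn_tri.
have H3 : q (iter j (F h) x' - x') <= L * (j%:R * h).
  by near_at HL h HLh; exact: (HLh 0%N).
have H4 : L * (j%:R * h) <= e / 3.
  move: jhe; rewrite ler_pdivlMr// => jhe; apply: le_trans jhe.
  rewrite mulrC ler_wpM2l ?lerDl// mulr_ge0//; exact: ltW.
move: xx' => /=; lra.
Unshelve. all: by end_near. Qed.

(** * Iterates compared with a path w' = z + g along the closed graph *)

Section path.
Variables (S : R) (w z : R -> X) (g : X).
Hypothesis S_ge0 : 0 <= S.
(** The third clause of [wz_path] is w' = z + g in uniform form. Two instances occur later: w the
    integral of u, z = u - f, g = f, and w = T(.) f, z = T(.) f', g = 0 for a semigroup T. *)
Hypothesis wz_graph : forall r, 0 <= r -> r <= S -> closure Z0 (w r, z r).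
Hypothesis wz_path : forall q (e : R), 0 < e -> exists2 eta : R, 0 < eta &
  forall a b, 0 <= a -> a <= b -> b <= S -> b - a <= eta ->
  [/\ q (w b - w a) <= e, q (z b - z a) <= e &
      q (w b - (w a + ofr (b - a) *: (z a + g))) <= e * (b - a)].

(** Convergence of the difference quotients of [F] is known at each element of [Z0] separately.
    Uniform continuity of (w, z) on [0, S] reduces the path to finitely many elements of [Z0], for
    which one range of small steps serves. *)
Lemma path_net q (d : R) : 0 < d -> exists n (c : 'I_n -> X * X),
  (forall i, Z0 (c i)) /\ forall r, 0 <= r -> r <= S ->
    exists i, q ((c i).1 - w r) <= d /\ q ((c i).2 - z r) <= d.
Proof.
move=> d0; have d2 : 0 < d / 2 by rewrite divr_gt0.
have [eta eta0 etaP] := wz_path q d2.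
pose N := (Num.truncn (S / eta)).+1.
have /choice[c cP] : forall i : 'I_N, exists c : X * X, [/\ Z0 c,
    q (c.1 - w (i%:R * eta)) < d / 2 & q (c.2 - z (i%:R * eta)) < d / 2].
  move=> i; have i0 : 0 <= i%:R * eta by rewrite mulr_ge0// ltW.
  have iS : i%:R * eta <= S.
    rewrite -ler_pdivlMr//; have [+ _] := @truncn_bounds (S / eta) (divr_ge0 S_ge0 (ltW eta0)).
    by apply: le_trans; rewrite ler_nat -ltnS.
  have /(closure_csnP Xp)/(_ q _ d2)[x [y [Zxy qx qy]]] := wz_graph i0 iS.
  by exists (x, y).
exists N, c; split=> [i|r r0 rS]; first by have [] := cP i.
have re0 : 0 <= r / eta by rewrite divr_ge0// ltW.
have [re1 re2] := truncn_bounds re0.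
have iN : (Num.truncn (r / eta) < N)%N.
  by rewrite ltnS le_truncn// ler_pM2r ?invr_gt0.
exists (Ordinal iN); have [_ q1 q2] := cP (Ordinal iN).
have [||||a1 a2 _] := etaP ((Num.truncn (r / eta))%:R * eta) r.
- by rewrite mulr_ge0// ltW.
- by rewrite -ler_pdivlMr.
- by [].
- by rewrite lerBlDr -[X in X + _]mul1r -mulrDl -ler_pdivrMr// addrC ltW.
split.
  apply: le_trans (csn_tri _ (w ((Num.truncn (r / eta))%:R * eta)) _ _) _.
  rewrite [leRHS]splitr lerD//; first exact: ltW.
  by rewrite csn_distC.
apply: le_trans (csn_tri _ (z ((Num.truncn (r / eta))%:R * eta)) _ _) _.
rewrite [leRHS]splitr lerD//; first exact: ltW.
by rewrite csn_distC.
Qed.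

Lemma path_small_time q (e : R) : 0 < e -> exists2 eta : R, 0 < eta &
  \forall h \near 0^'+, forall j r, 0 <= r -> r <= S -> j%:R * h <= eta ->
    q (iter j (F h) (z r) - z r) <= e.
Proof.
move=> e0; have [q1 q1P] := Feq 1 q.
have e3 : 0 < e / 3 by rewrite divr_gt0.
have [n [c [Zc cP]]] := path_net (csn_add q q1) e3.
have /choice[eta etaP] : forall i : 'I_n, exists eta : R, 0 < eta /\
    \forall h \near 0^'+, forall j, j%:R * h <= eta ->
    q (iter j (F h) (c i).2 - (c i).2) <= e / 3.
  by move=> i; have [eta eta0 ?] := iter_small_time (c i).2 q e3; exists eta.
have [d d0 dP] := finite_pos_lb (fun i => (etaP i).1).
exists (Num.min 1 d); first by rewrite lt_min ltr01.
have H : \forall h \near 0^'+, forall i j, j%:R * h <= eta i ->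
    q (iter j (F h) (c i).2 - (c i).2) <= e / 3.
  by apply: filter_forall => i; have [] := etaP i.
near=> h => j r r0 rS; rewrite le_min => /andP[jh1 jhd].
have h0 : 0 < h by near: h; exact: nbhs_right_gt.
have [i [_ /= qi]] := cP r r0 rS.
have H1 : q (iter j (F h) (z r) - iter j (F h) (c i).2) <= q1 ((c i).2 - z r).
  by rewrite -iterB_clmap csn_distC; apply: q1P => //; exact: ltW.
have H2 : q (iter j (F h) (c i).2 - (c i).2) <= e / 3.
  by near_at H h Hh; apply: Hh; exact: le_trans (dP i).
have := csn_tri q (iter j (F h) (c i).2) (iter j (F h) (z r)) (z r).
have := csn_tri q (c i).2 (iter j (F h) (c i).2) (z r).
lra.
Unshelve. all: by end_near. Qed.

(** Within a block the pair (w, z) is frozen at a net element (c1, c2), for which F(h)^l c1 is c1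
    plus the sum of h F(h)^j c2 up to a small error. The bound is proportional to the duration
    [eta], so that about S / eta blocks add up to O(e). *)
Lemma path_block q (e : R) : 0 < e -> exists2 eta0 : R, 0 < eta0 &
  forall eta, 0 < eta -> eta <= eta0 -> \forall h \near 0^'+, forall l a,
    0 <= a -> a + l%:R * h <= S -> l%:R * h <= eta ->
    q (iter l (F h) (w a) + ofr h *: (\sum_(j < l) iter j (F h) g)
       - w (a + l%:R * h)) <= e * eta.
Proof.
move=> e0; have [q1 q1P] := Feq 1 q.
(* Six comparisons [s1] to [s6] follow, the third of double size. *)
have e7 : 0 < e / 7 by rewrite divr_gt0.
have [ea ea0 eaP] := path_small_time q e7.
have [eb eb0 ebP] := iter_small_time g q e7.
have [ec ec0 ecP] := wz_path q e7.
exists (Num.min (Num.min 1 ea) (Num.min eb ec)); first by rewrite !lt_min ltr01 ea0 eb0.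
move=> eta eta0; rewrite !le_min => /andP[/andP[eta1 etaa] /andP[etab etac]].
(* The error in w is not multiplied by the duration, so the net itself must be fine relative to
   [eta]. *)
have ee : 0 < e / 7 * eta by rewrite mulr_gt0.
have [n [c [Zc cP]]] := path_net (csn_add q q1) ee.
have Hc : \forall h \near 0^'+, forall i,
    q1 (ofr h^-1 *: (F h (c i).1 - (c i).1) - (c i).2) < e / 7.
  apply: filter_forall => i; apply: FZ0 => //; by rewrite -surjective_pairing.
near=> h => l a a0 alS lh.
have h0 : 0 < h by near: h; exact: nbhs_right_gt.
have lh0 : 0 <= l%:R * h by rewrite mulr_ge0// ltW.
have aS : a <= S by apply: le_trans alS; rewrite lerDl.
have jh j : (j < l)%N -> j%:R * h <= l%:R * h.
  by move=> jl; rewrite ler_pM2r// ler_nat ltnW.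
have [i [/= qi1 qi2]] := cP a a0 aS.
set c1 := (c i).1 in qi1 *; set c2 := (c i).2 in qi2 *.
set Sg := ofr h *: (\sum_(j < l) iter j (F h) g).
set Sc := ofr h *: (\sum_(j < l) iter j (F h) c2).
have sumE x : ofr (l%:R * h) *: x = ofr h *: (\sum_(j < l) x).
  by rewrite mulrC rmorphM -scalerA big_const_ord iter_addr_0 rmorph_nat scaler_nat.
have sumle (f f' : nat -> X) (C : R) : 0 <= C -> (forall j, (j < l)%N -> q (f j - f' j) <= C) ->
    q (ofr h *: (\sum_(j < l) f j) - ofr h *: (\sum_(j < l) f' j)) <= C * eta.
  move=> C0 ff'; rewrite -scalerBr -sumrB csnZ_ge0 ?(ltW h0)//.
  apply: le_trans (ler_wpM2l (ltW h0) (csn_sum_le ff')) _.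
  by rewrite mulrCA mulrA [leLHS]mulrC ler_wpM2l.
have s1 : q (iter l (F h) (w a) + Sg - (iter l (F h) c1 + Sg)) <= e / 7 * eta.
  rewrite csn_subDr -iterB_clmap.
  apply: le_trans (q1P _ _ _ (ltW h0) (le_trans lh eta1)) _.
  rewrite csn_distC; apply: le_trans qi1; by rewrite lerDr csn_ge0.
have s2 : q (iter l (F h) c1 + Sg - (c1 + Sc + Sg)) <= e / 7 * eta.
  rewrite csn_subDr opprD addrA.
  have := iter_telescope (F h) 0 l c1; rewrite /= add0n => ->.
  have -> : \sum_(j < l) iter (0 + j) (F h) (F h c1 - c1) =
      ofr h *: \sum_(j < l) iter j (F h) (ofr h^-1 *: (F h c1 - c1)).
    rewrite scaler_sumr; apply: eq_bigr => j _.
    by rewrite iterZ_clmap scalerA -rmorphM divff ?gt_eqF// rmorph1 scale1r.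
  apply: (sumle (fun j => iter j (F h) (ofr h^-1 *: (F h c1 - c1)))
    (fun j => iter j (F h) c2)); first exact: ltW.
  move=> j jl; rewrite -iterB_clmap.
  apply: le_trans (q1P _ _ _ (ltW h0) _) _.
    exact: le_trans (jh _ jl) (le_trans lh eta1).
  by rewrite ltW//; near_at Hc h Hch; exact: Hch.
have s3 : q (c1 + Sc + Sg - (c1 + ofr (l%:R * h) *: z a + Sg)) <= 2 * (e / 7 * eta).
  rewrite csn_subDr csn_subDl sumE mulrA.
  apply: (sumle (fun j => iter j (F h) c2) (fun=> z a)); first by rewrite mulr_ge0// ltW.
  move=> j jl; apply: le_trans (csn_tri _ (iter j (F h) (z a)) _ _) _.
  rewrite mulr_natl mulr2n; apply: lerD; last first.
    near_at eaP h eah; apply: eah => //.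
    exact: le_trans (jh _ jl) (le_trans lh etaa).
  rewrite -iterB_clmap; apply: le_trans (q1P _ _ _ (ltW h0) _) _.
    exact: le_trans (jh _ jl) (le_trans lh eta1).
  apply: le_trans (_ : e / 7 * eta <= _); last by rewrite ler_piMr// ltW.
  by apply: le_trans qi2; rewrite lerDr csn_ge0.
have s4 : q (c1 + ofr (l%:R * h) *: z a + Sg -
    (c1 + ofr (l%:R * h) *: z a + ofr (l%:R * h) *: g)) <= e / 7 * eta.
  rewrite csn_subDl sumE.
  apply: (sumle (fun j => iter j (F h) g) (fun=> g)); first exact: ltW.
  move=> j jl; near_at ebP h ebh; apply: ebh.
  exact: le_trans (jh _ jl) (le_trans lh etab).
have s5 : q (c1 + ofr (l%:R * h) *: z a + ofr (l%:R * h) *: g -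
    (w a + ofr (l%:R * h) *: (z a + g))) <= e / 7 * eta.
  rewrite scalerDr addrA !csn_subDr; apply: le_trans qi1.
  by rewrite lerDl csn_ge0.
have s6 : q (w a + ofr (l%:R * h) *: (z a + g) - w (a + l%:R * h)) <= e / 7 * eta.
  have [||||_ _] := ecP a (a + l%:R * h) => //.
  - by rewrite lerDl.
  - by rewrite addrAC subrr add0r; exact: le_trans lh etac.
  rewrite (addrAC a) subrr add0r csn_distC => /le_trans; apply.
  by rewrite ler_pM2l.
apply: le_trans (csn_tri _ (iter l (F h) c1 + Sg) _ _) _.
have := csn_tri q (c1 + Sc + Sg) (iter l (F h) c1 + Sg) (w (a + l%:R * h)).
have := csn_tri q (c1 + ofr (l%:R * h) *: z a + Sg) (c1 + Sc + Sg) (w (a + l%:R * h)).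
have := csn_tri q (c1 + ofr (l%:R * h) *: z a + ofr (l%:R * h) *: g)
  (c1 + ofr (l%:R * h) *: z a + Sg) (w (a + l%:R * h)).
have := csn_tri q (w a + ofr (l%:R * h) *: (z a + g))
  (c1 + ofr (l%:R * h) *: z a + ofr (l%:R * h) *: g) (w (a + l%:R * h)).
move: s1 s2 s3 s4 s5 s6.
have -> : e * eta = 7 * (e / 7 * eta) by rewrite mulrA mulrCA divff// mulr1.
move: (e / 7 * eta) => ? *; lra.
Unshelve. all: by end_near. Qed.

(** The error after n + n' steps is F(h)^n' applied to the error after n steps, plus a block error.
    Equicontinuity is not contractivity, and estimating one block after another would replace the
    seminorm each time. The induction in [claim] therefore bounds all further iterates of the error,
    so that every block error meets [q1] only once. *)
Theorem inhomogeneous_chernoff q (e : R) : 0 < e ->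
  \forall h \near 0^'+, forall m, m%:R * h <= S ->
    q (iter m (F h) (w 0) + ofr h *: (\sum_(j < m) iter j (F h) g)
       - w (m%:R * h)) <= e.
Proof.
move=> e0; have [q1 q1P] := Feq S q.
have S21 : 0 < 2 * S + 1 by rewrite ltr_wpDl// mulr_ge0.
(* A full block lasts at least eta / 2, so there are at most 2 S / eta of them; with the incomplete
   one the errors e1 eta add up to at most e1 (2 S + 1). *)
pose e1 := e / (2 * S + 1).
have e10 : 0 < e1 by rewrite divr_gt0.
have [eta0 eta00 etaP] := path_block (csn_add q q1) e10.
pose eta := Num.min 1 eta0.
have eta_gt0 : 0 < eta by rewrite lt_min ltr01.
have eta1 : eta <= 1 by rewrite ge_min lexx.
have etale : eta <= eta0 by rewrite ge_min lexx orbT.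
have {}etaP := etaP eta eta_gt0 etale.
near=> h => m mS.
have h0 : 0 < h by near: h; exact: nbhs_right_gt.
(* Ensures that the integer part of eta / h many steps last at least eta / 2. *)
have heta : h <= eta / 2.
  by near: h; apply: nbhs_right_le; rewrite divr_gt0.
have block l a : 0 <= a -> a + l%:R * h <= S -> l%:R * h <= eta ->
    csn_add q q1 (iter l (F h) (w a) + ofr h *: (\sum_(j < l) iter j (F h) g)
       - w (a + l%:R * h)) <= e1 * eta.
  by near_at etaP h etah; exact: etah.
pose l := Num.truncn (eta / h).
have [l1 l2] := @truncn_bounds (eta / h) (divr_ge0 (ltW eta_gt0) (ltW h0)).
rewrite -/l in l1 l2.
have lh1 : l%:R * h <= eta by rewrite -ler_pdivlMr.
have lh2 : eta / 2 <= l%:R * h.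
  by move: l2; rewrite ltr_pdivrMr// mulrDl mul1r; lra.
have l0 : (0 < l)%N by rewrite lt0n; apply: contraTneq lh2 => ->; rewrite mul0r -ltNge divr_gt0.
pose rho a n := iter n (F h) (w a) + ofr h *: (\sum_(j < n) iter j (F h) g)
       - w (a + n%:R * h).
pose Err n := iter n (F h) (w 0) + ofr h *: (\sum_(j < n) iter j (F h) g)
       - w (n%:R * h).
have ErrD n n' : Err (n + n')%N = iter n' (F h) (Err n) + rho (n%:R * h) n'.
  rewrite /Err /rho iterB_clmap iterD_clmap iterZ_clmap iter_sum_clmap.
  rewrite natrD mulrDl addrA; congr (_ - _).
  rewrite -iterD addnC [RHS]addrA subrK -[in RHS]addrA; congr (_ + _).
  rewrite -scalerDr addrC [(n' + n)%N]addnC; congr (_ *: _).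
  rewrite addrC [(n + n')%N]addnC big_split_ord /= addrC; congr (_ + _).
  by apply: eq_bigr => j _; rewrite iterD.
have claim b n : (b * l + n)%:R * h <= S ->
    q (iter n (F h) (Err (b * l)%N)) <= b%:R * (e1 * eta).
  elim: b n => [|b IH] n bS.
    by rewrite /Err /= !mul0r big_ord0 scaler0 addr0 subrr iter0_clmap csn0.
  rewrite mulSn addnC ErrD iterD_clmap -iterD.
  apply: le_trans (csnD _ _ _) _; rewrite -natr1 mulrDl mul1r; apply: lerD.
    by apply: IH; move: bS; rewrite mulSn (addnC l) addnAC -addnA.
  have bS' : (b * l + l)%:R * h <= S.
    by apply: le_trans bS; rewrite ler_pM2r// ler_nat mulSn [(l + _)%N]addnC leq_addr.
  apply: le_trans (q1P _ _ _ (ltW h0) _) _.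
    by apply: le_trans bS; rewrite ler_pM2r// ler_nat leq_addl.
  apply: le_trans (block l ((b * l)%:R * h) _ _ lh1).
  - by rewrite /= lerDr csn_ge0.
  - by rewrite mulr_ge0// ltW.
  - by rewrite -mulrDl -natrD.
pose b := (m %/ l)%N; pose r := (m %% l)%N.
have mE : m = (b * l + r)%N by rewrite /b /r -divn_eq.
have bS : (b * l + r)%:R * h <= S by rewrite -mE.
have bl : b%:R * eta <= 2 * S.
  have : b%:R * (l%:R * h) <= S.
    by apply: le_trans bS; rewrite mulrA -natrM ler_pM2r// ler_nat leq_addr.
  have := ler_wpM2l (ler0n R b) lh2; lra.
rewrite -/(Err m) mE ErrD; apply: le_trans (csnD _ _ _) _.
apply: le_trans (lerD (claim b r bS) (_ : _ <= e1 * eta)) _.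
  apply: le_trans (block r ((b * l)%:R * h) _ _ _).
  - by rewrite /= lerDl csn_ge0.
  - by rewrite mulr_ge0// ltW.
  - by rewrite -mulrDl -natrD.
  - apply: le_trans lh1; rewrite ler_pM2r// ler_nat ltnW// ltn_mod//.
rewrite mulrCA -mulrDr /e1 -mulrA -[leRHS]mulr1 ler_pM2l//.
rewrite mulrC ler_pdivrMr// mul1r; apply: lerD => //.
Unshelve. all: by end_near. Qed.

End path.
End chernoff.

(** * Integration of locally Lipschitz paths *)

Section bounded_convergence.
Context {R : realType}.
Implicit Types (f g G : R -> R).

Lemma lipschitz_continuous f (C : R) : (forall x y, `|f y - f x| <= C * `|y - x|) ->
  continuous f.
Proof.
move=> fC x; apply/cvgrPdist_lt => e e0.
have C1 : 0 < `|C| + 1 by rewrite ltr_wpDl.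
have d0 : 0 < e / (`|C| + 1) by rewrite divr_gt0.
near=> y; apply: le_lt_trans (fC _ _) _.
have xy : `|x - y| < e / (`|C| + 1) by near: y; apply: cvgr_dist_lt d0.
move: xy; rewrite ltr_pdivlMr// => xy; apply: le_lt_trans xy.
rewrite mulrC ler_wpM2l//.
by have := ler_norm C; lra.
Unshelve. all: by end_near. Qed.

(** Paths are controlled on [0, S] only. Composition with this retraction yields functions
    continuous on all of R, to which measurability and the fundamental theorem apply. *)
Definition clamp (S x : R) := Num.min (Num.max x 0) S.

Lemma clamp_itv (S x : R) : 0 <= S -> 0 <= clamp S x /\ clamp S x <= S.
Proof.
by move=> S0; rewrite /clamp le_min S0 andbT le_max lexx orbT ge_min lexx orbT.
Qed.

Lemma clamp_id (S x : R) : 0 <= x -> x <= S -> clamp S x = x.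
Proof. by move=> x0 xS; rewrite /clamp max_l// min_l. Qed.

Lemma clamp_lipschitz (S x y : R) : 0 <= S -> x <= y ->
  clamp S x <= clamp S y /\ clamp S y - clamp S x <= y - x.
Proof.
move=> S0 xy; rewrite /clamp.
case: (leP x 0) => ?; case: (leP y 0) => ?; rewrite /Num.min;
  case: ltP => ?; case: ltP => ?; split; lra.
Qed.

Lemma lipschitz_clamp (S L : R) g : 0 <= S -> 0 <= L ->
  (forall a b, 0 <= a -> a <= b -> b <= S -> `|g b - g a| <= L * (b - a)) ->
  continuous (g \o clamp S).
Proof.
move=> S0 L0 gL; apply: (@lipschitz_continuous _ L).
have H x y : x <= y -> `|g (clamp S y) - g (clamp S x)| <= L * (y - x).
  move=> xy; have [h1 h2] := clamp_lipschitz S0 xy.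
  apply: le_trans (gL _ _ _ h1 _) _; [exact: (clamp_itv x S0).1|exact: (clamp_itv y S0).2|].
  exact: ler_wpM2l.
move=> x y /=; case: (leP x y) => xy; first by rewrite [`|y - x|]ger0_norm ?subr_ge0// H.
by rewrite distrC [`|y - x|]distrC [`|x - y|]ger0_norm ?subr_ge0 ?(ltW xy)// H// ltW.
Qed.

(** This is G' = g with g Lipschitz, as a first-order expansion with quadratic remainder. In this
    form it passes through functionals and limits. *)
Definition quadratic_primitive (S : R) G g := exists2 L, 0 <= L &
  forall a b, 0 <= a -> a <= b -> b <= S ->
  `|G b - (G a + (b - a) * g a)| <= L * (b - a) ^+ 2 /\ `|g b - g a| <= L * (b - a).

Lemma quadratic_primitive_FTC (S : R) G g : 0 < S -> quadratic_primitive S G g ->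
  (\int[lebesgue_measure]_(x in `[0%R, S]) ((g \o clamp S) x)%:E = (G S - G 0)%:E)%E.
Proof.
move=> S0 [L L0 GL].
have gL a b : 0 <= a -> a <= b -> b <= S -> `|g b - g a| <= L * (b - a).
  by move=> a0 ab bS; have [] := GL a b a0 ab bS.
have cg := lipschitz_clamp (ltW S0) L0 gL.
pose C := `|g 0| + L * S + L * S.
have GC a b : 0 <= a -> a <= b -> b <= S -> `|G b - G a| <= C * (b - a).
  move=> a0 ab bS; have [h1 _] := GL a b a0 ab bS.
  have aS : a <= S by lra.
  have h2 := gL 0 a (lexx _) a0 aS; rewrite subr0 in h2.
  have h3 : `|g a| <= `|g 0| + L * S.
    have := ler_normD (g a - g 0) (g 0); rewrite subrK => /le_trans; apply.
    rewrite addrC lerD2l; apply: le_trans h2 _; exact: ler_wpM2l.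
  have ba : 0 <= b - a by rewrite subr_ge0.
  have -> : G b - G a = (G b - (G a + (b - a) * g a)) + (b - a) * g a by ring.
  apply: le_trans (ler_normD _ _) _; rewrite normrM (ger0_norm ba).
  rewrite /C addrC [leRHS]mulrDl; apply: lerD; first by rewrite mulrC ler_wpM2r.
  apply: le_trans h1 _; rewrite expr2 mulrA ler_wpM2r// ler_wpM2l//; lra.
have C0 : 0 <= C by rewrite /C !addr_ge0// mulr_ge0// ltW.
have cG := lipschitz_clamp (ltW S0) C0 GC.
have dG x : x \in `]0, S[ -> h^-1 *: (G (h *: 1 + x) - G x) @[h --> 0^'] --> g x.
  rewrite in_itv /= => /andP[x0 xS]; apply/cvgrPdist_le => e e0.
  have L1 : 0 < 2 * L + 1 by lra.
  near=> h.
  have h0 : h != 0 by near: h; exact: nbhs_dnbhs_neq.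
  have hd : `|h| <= Num.min (Num.min x (S - x)) (e / (2 * L + 1)).
    near: h; apply: dnbhs0_le; rewrite !lt_min x0 subr_gt0 xS/= divr_gt0//.
  move: hd; rewrite !le_min => /andP[/andP[hx hSx] he].
  move: he; rewrite ler_pdivlMr// => he.
  rewrite /GRing.scale /= mulr1.
  have -> : g x - h^-1 * (G (h + x) - G x) = - (h^-1 * (G (h + x) - (G x + h * g x))).
    by field.
  rewrite normrN normrM normfV mulrC ler_pdivrMr ?normr_gt0//.
  case: (leP 0 h) => hs.
    have hN : `|h| = h by rewrite ger0_norm.
    rewrite hN in hx hSx he *.
    have [|||+ _] := GL x (h + x); try lra.
    rewrite addrK => /le_trans; apply; rewrite expr2 mulrA ler_wpM2r//; lra.
  (* For h < 0 the expansion starts at the left endpoint h + x; the Lipschitz bound moves g from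
     there to x and contributes a second L in 2 L + 1. *)
  have hN : `|h| = - h by rewrite ltr0_norm.
  rewrite hN in hx hSx he *.
  have [|||h1 h2] := GL (h + x) x; try lra.
  have hh : 0 <= - h by lra.
  have e1 : x - (h + x) = - h by ring.
  rewrite e1 in h1 h2.
  have h3 := ler_wpM2l hh h2.
  have h4 := ler_wpM2l hh he.
  have -> : G (h + x) - (G x + h * g x) =
      (- h) * (g x - g (h + x)) - (G x - (G (h + x) + - h * g (h + x))) by ring.
  apply: le_trans (ler_normB _ _) _; rewrite normrM (ger0_norm hh).
  apply: le_trans (lerD h3 h1) _; nra.
rewrite (@continuous_FTC2 _ (g \o clamp S) G 0 S)//.
- exact: continuous_subspaceT.
- split.
  + by move=> x /dG dGx; apply/cvg_ex; exists (g x).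
  + have := cG 0; rewrite /continuous_at/= (clamp_id (lexx _) (ltW S0)).
    move=> /cvg_at_right_filter; apply: cvg_trans; apply: near_eq_cvg.
    near=> x; have x0 : 0 <= x by near: x; exact: nbhs_right_ge.
    by rewrite /= clamp_id//; near: x; exact: nbhs_right_le.
  + have := cG S; rewrite /continuous_at/= (clamp_id (ltW S0) (lexx _)).
    move=> /cvg_at_left_filter; apply: cvg_trans; apply: near_eq_cvg.
    near=> x; have xS : x <= S by near: x; exact: nbhs_left_le.
    by rewrite /= clamp_id//; near: x; exact: nbhs_left_ge.
- move=> x xS; rewrite derive1E /=; move: (xS); rewrite in_itv/= => /andP[x0 x1].
  by rewrite clamp_id ?(ltW x0) ?(ltW x1)//; apply/cvg_lim => //; exact: dG.
Unshelve. all: by end_near. Qed.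

(** The derivatives will converge pointwise under a common bound, with no uniformity, so increments
    are written as Lebesgue integrals and dominated convergence is applied. *)
Lemma bounded_convergence_primitive (S M : R) (G g : nat -> R -> R) : 0 < S ->
  (forall n, quadratic_primitive S (G n) (g n)) ->
  (forall n r, 0 <= r -> r <= S -> `|g n r| <= M) ->
  (forall r, 0 <= r -> r <= S -> g n r @[n --> \oo] --> 0) ->
  (G n S - G n 0) @[n --> \oo] --> 0.
Proof.
move=> S0 Gg gM g0.
have cg n : continuous (g n \o clamp S).
  have [L L0 GL] := Gg n.
  by apply: (lipschitz_clamp (ltW S0) L0) => a b a0 ab bS; have [] := GL a b a0 ab bS.
have mI : measurable (`[0%R, S] : set R) by exact: measurable_itv.
have [//|||||_ _] := @dominated_convergence _ _ R (@lebesgue_measure R) `[0%R, S] mI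
  (fun n x => ((g n \o clamp S) x)%:E) (fun=> 0%E) (fun=> M%:E).
- move=> n; apply/measurable_EFinP; apply: measurable_funTS.
  exact: continuous_measurable_fun.
- exact: measurable_cst.
- apply: aeW => x _; apply: cvg_EFin; first by apply: nearW.
  by have [h1 h2] := clamp_itv x (ltW S0); exact: g0.
- apply: (@continuous_compact_integrable R (fun=> M)); first exact: segment_compact.
  by apply: continuous_subspaceT => x; exact: cvg_cst.
- apply: aeW => x n _; rewrite /= lee_fin.
  by have [h1 h2] := clamp_itv x (ltW S0); exact: gM.
rewrite integral0 => H; suff : (G n S - G n 0)%:E @[n --> \oo] --> 0%:E by move=> /fine_cvg.
apply: cvg_trans H; apply: near_eq_cvg; apply: nearW => n /=.
by rewrite (quadratic_primitive_FTC S0 (Gg n)).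
Qed.

End bounded_convergence.

(** * Riemann integral of a locally Lipschitz path *)

Section lipschitz_integral.
Context {R : realType} {k : scalar_kind}.
Notation K := (scalar_field R k).
Local Notation ofr := (@of_real R k).
Variable X : tvsType K.
Implicit Types (q : csn X) (u w : R -> X).

Definition locally_lipschitz u := forall (S : R) q, exists2 L : R, 0 <= L &
  forall a b : R, 0 <= a -> a <= b -> b <= S -> q (u b - u a) <= L * (b - a).

Definition riemann_sum u (n : nat) (s : R) : X :=
  ofr n.+1%:R^-1 *: (\sum_(j < Num.truncn (n.+1%:R * s)) u (j%:R / n.+1%:R)).

(** The quadratic term is the variation of [u] over [a, b] enlarged by one mesh; the last term comes
    from the number of grid points, which differs from the length b - a, in units of the mesh, by at
    most one. *)
Lemma riemann_sum_increment u q (S L : R) n (a b : R) : 0 <= L ->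
  (forall a b : R, 0 <= a -> a <= b -> b <= S -> q (u b - u a) <= L * (b - a)) ->
  0 <= a -> a <= b -> b <= S ->
  q (riemann_sum u n b - (riemann_sum u n a + ofr (b - a) *: u a)) <=
    L * (b - a + n.+1%:R^-1) ^+ 2 + n.+1%:R^-1 * q (u a).
Proof.
move=> L0 uL a0 ab bS; rewrite /riemann_sum.
set N : R := n.+1%:R; have N0 : 0 < N by rewrite ltr0n.
set h := N^-1; have h0 : 0 < h by rewrite invr_gt0.
have hN : h * N = 1 by rewrite mulVf// gt_eqF.
have b0 : 0 <= b := le_trans a0 ab.
set na := Num.truncn (N * a); set nb := Num.truncn (N * b).
have [na1 na2] := truncn_bounds (mulr_ge0 (ltW N0) a0 : 0 <= N * a).
have [nb1 nb2] := truncn_bounds (mulr_ge0 (ltW N0) b0 : 0 <= N * b).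
rewrite -/na -/nb in na1 na2 nb1 nb2.
have nanb : (na <= nb)%N by rewrite le_truncn// ler_pM2l.
pose d := (nb - na)%N.
have nbE : nb = (na + d)%N by rewrite subnKC.
have ha1 : na%:R * h <= a.
  by have := ler_wpM2l (ltW h0) na1; rewrite mulrA hN mul1r mulrC.
have ha2 : a <= na%:R * h + h.
  have := ler_wpM2l (ltW h0) (ltW na2); rewrite mulrA hN mul1r.
  by rewrite mulrDr mulr1 (mulrC h).
have hb1 : nb%:R * h <= b.
  by have := ler_wpM2l (ltW h0) nb1; rewrite mulrA hN mul1r mulrC.
have hb2 : b <= nb%:R * h + h.
  have := ler_wpM2l (ltW h0) (ltW nb2); rewrite mulrA hN mul1r.
  by rewrite mulrDr mulr1 (mulrC h).
have dE : nb%:R = na%:R + d%:R :> R by rewrite nbE natrD.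
rewrite nbE big_split_ord /= scalerDr csn_subDl.
have uj j : (j < d)%N -> q (u ((na + j)%:R * h) - u a) <= L * (b - a + h).
  move=> jd; have jb : (na + j)%:R * h <= b.
    by apply: le_trans hb1; rewrite ler_pM2r// ler_nat nbE leq_add2l ltnW.
  have ja : na%:R * h <= (na + j)%:R * h by rewrite ler_pM2r// ler_nat leq_addr.
  have j0 : 0 <= (na + j)%:R * h by rewrite mulr_ge0// ltW.
  case: (leP a ((na + j)%:R * h)) => aj.
    apply: le_trans (uL _ _ a0 aj (le_trans jb bS)) _; rewrite ler_wpM2l//; lra.
  rewrite csn_distC; apply: le_trans (uL _ _ j0 (ltW aj) (le_trans ab bS)) _.
  rewrite ler_wpM2l//; lra.
have ba : 0 <= b - a by rewrite subr_ge0.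
apply: le_trans (csn_tri _ (ofr h *: \sum_(j < d) u a) _ _) _; apply: lerD.
  rewrite -scalerBr -sumrB (csnZ_ge0 _ _ (ltW h0)).
  apply: le_trans (ler_wpM2l (ltW h0) (csn_sum_le
    (f := fun j => u ((na + j)%:R / N) - u a) uj)) _.
  rewrite mulrCA mulrA [leLHS]mulrC -mulrA expr2 ler_wpM2l//.
  by rewrite ler_wpM2l ?(addr_ge0 ba (ltW h0))//; rewrite dE in hb1; lra.
rewrite big_const_ord iter_addr_0 -scaler_nat -(rmorph_nat ofr) scalerA -rmorphM.
rewrite -scalerBl -rmorphB csnZ ler_wpM2r ?csn_ge0// ler_norml.
rewrite dE in hb1 hb2; apply/andP; split; lra.
Qed.

Variables (Omega : Type) (p : Omega -> X -> R).
Hypothesis Xp : generating_seminorms p.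
Hypothesis X_complete : tvs_complete X.

Lemma invn_small (C e : R) : 0 <= C -> 0 < e -> exists N, forall n, (N <= n)%N ->
  n.+1%:R^-1 * C < e.
Proof.
move=> C0 e0; exists (Num.bound (C / e)) => n Nn.
rewrite mulrC ltr_pdivrMr ?ltr0n// mulrC -ltr_pdivrMr//.
apply: lt_le_trans (archi_boundP _) _; first by rewrite divr_ge0// ltW.
by rewrite ler_nat (leq_trans Nn).
Qed.

(** Sums of different meshes are compared over M + 1 pieces, on each of which both are close to the
    length times the left value of [u]. The increment estimate and w(0) = 0 are the only description
    of the integral used later. *)
Lemma lipschitz_integral u : locally_lipschitz u -> exists w, w 0 = 0 /\
  forall (S : R) q, exists2 L : R, 0 <= L &
    forall a b : R, 0 <= a -> a <= b -> b <= S ->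
      q (w b - (w a + ofr (b - a) *: u a)) <= L * (b - a) ^+ 2.
Proof.
move=> uL.
have R0 n : riemann_sum u n 0 = 0.
  by rewrite /riemann_sum mulr0 truncn0 big_ord0 scaler0.
have cvg_sum (s : R) : 0 <= s -> exists l : X, (riemann_sum u ^~ s) @ \oo --> l.
  rewrite le_eqVlt => /predU1P[<-|s0].
    by exists 0; rewrite (_ : riemann_sum u ^~ 0 = fun=> 0) ?R0; [exact: cvg_cst|exact/funext].
  apply: (csn_cauchy_cvg Xp (u := riemann_sum u ^~ s) X_complete) => q e e0.
  have e2 : 0 < e / 2 by rewrite divr_gt0.
  have [L L0 HL] := uL s q.
  pose V := q (u 0) + L * s.
  have V0 : 0 <= V by rewrite addr_ge0 ?csn_ge0// mulr_ge0// ltW.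
  have uV (a : R) : 0 <= a -> a <= s -> q (u a) <= V.
    move=> a0 as_; apply: le_trans (csn_sub _ _ (u 0)) _; rewrite addrC lerD2l.
    by apply: le_trans (HL _ _ (lexx _) a0 as_) _; rewrite subr0 ler_wpM2l.
  (* With pieces of length d = s / (M + 1) and mesh below d, each of the two sums has total
     quadratic error (M + 1) L (2 d)^2 = 4 L s^2 / (M + 1). *)
  have [|M MP] := @invn_small (8 * L * s ^+ 2) (e / 2) _ e2.
    by rewrite !mulr_ge0// ltW.
  clearbody V; pose d := s / M.+1%:R.
  have M0 : 0 < M.+1%:R :> R by rewrite ltr0n.
  have d0 : 0 < d by rewrite divr_gt0.
  have Md : M.+1%:R * d = s by rewrite mulrC divfK// gt_eqF.
  have [N1 N1P] := invn_small ler01 d0.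
  have [|N2 N2P] := @invn_small (M.+1%:R * 2 * V) (e / 2) _ e2.
    by rewrite !mulr_ge0// ltW.
  exists (maxn N1 N2) => m n; rewrite !geq_max => /andP[m1 m2] /andP[n1 n2].
  have step i l : (i < M.+1)%N -> (maxn N1 N2 <= l)%N ->
      q (riemann_sum u l (i.+1%:R * d) - (riemann_sum u l (i%:R * d) + ofr d *: u (i%:R * d)))
      <= L * (2 * d) ^+ 2 + l.+1%:R^-1 * V.
    move=> iM; rewrite geq_max => /andP[l1 l2].
    have i0 : 0 <= i%:R * d by rewrite mulr_ge0// ltW.
    have iE : i.+1%:R * d - i%:R * d = d by rewrite -natr1 mulrDl mul1r addrAC subrr add0r.
    have is_ : i.+1%:R * d <= s by rewrite -Md ler_pM2r// ler_nat.
    have ii : i%:R * d <= i.+1%:R * d by rewrite ler_pM2r// ler_nat.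
    have := riemann_sum_increment l L0 HL i0 ii is_; rewrite iE => /le_trans; apply.
    have hl : l.+1%:R^-1 <= d by have := N1P l l1; rewrite mulr1 => /ltW.
    have hl0 : 0 <= l.+1%:R^-1 :> R by rewrite invr_ge0.
    apply: lerD; last by rewrite ler_wpM2l// uV// (le_trans ii).
    apply: ler_wpM2l => //; move: hl hl0; move: (l.+1%:R^-1 : R) => h hl hl0.
    by clearbody d; apply: lerXn2r; rewrite ?nnegrE; lra.
  pose B := (L * (2 * d) ^+ 2 + m.+1%:R^-1 * V) + (L * (2 * d) ^+ 2 + n.+1%:R^-1 * V).
  have diff i : (i <= M.+1)%N ->
      q (riemann_sum u m (i%:R * d) - riemann_sum u n (i%:R * d)) <=
      i%:R * B.
    elim: i => [|i IH] iM; first by rewrite !mul0r !R0 subrr csn0.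
    have h1 := step i m iM; have h2 := step i n iM; have h3 := IH (ltnW iM).
    rewrite !geq_max m1 m2 n1 n2 in h1 h2.
    have {}h1 := h1 isT; have {}h2 := h2 isT.
    apply: le_trans (csn_tri _ (riemann_sum u m (i%:R * d) + ofr d *: u (i%:R * d)) _ _) _.
    have := csn_tri q (riemann_sum u n (i%:R * d) + ofr d *: u (i%:R * d))
      (riemann_sum u m (i%:R * d) + ofr d *: u (i%:R * d))
      (riemann_sum u n (i.+1%:R * d)).
    rewrite csn_subDr [X in _ <= _ + X]csn_distC -[i.+1%:R * B]/(_ * _).
    rewrite (_ : i.+1%:R * B = i%:R * B + B); last by rewrite -natr1 mulrDl mul1r.
    move: h1 h2 h3; rewrite /B.
    move: (L * (2 * d) ^+ 2) (m.+1%:R^-1 * V) (n.+1%:R^-1 * V) => x y z; lra.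
  have := diff M.+1 (leqnn _); rewrite Md => /le_lt_trans; apply.
  have h1 := MP M (leqnn _).
  have h2 : M.+1%:R * (L * (2 * d) ^+ 2) = M.+1%:R^-1 * (8 * L * s ^+ 2) / 2.
    by rewrite /d; field; rewrite gt_eqF.
  have h3 := N2P m m2; have h4 := N2P n n2.
  have h5 l : M.+1%:R * (l.+1%:R^-1 * V) = l.+1%:R^-1 * (M.+1%:R * 2 * V) / 2.
    by field; rewrite nat1r pnatr_eq0.
  rewrite /B !mulrDr h2 !h5; move: h1 h3 h4.
  by move: (M.+1%:R^-1 * _) (m.+1%:R^-1 * _) (n.+1%:R^-1 * _) => x y z; lra.
have /choice[w wP] : forall s, exists l : X, 0 <= s -> (riemann_sum u ^~ s) @ \oo --> l.
  by move=> s; case: (leP 0 s) => [/cvg_sum[l ?]|_]; [exists l|exists 0].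
(* [X] is not assumed Hausdorff here, so a chosen limit at 0 need not be 0; the value is
   prescribed. *)
exists (fun s => if s == 0 then 0 else w s); rewrite eqxx; split=> // S q.
have {}wP (s : R) : 0 <= s -> (riemann_sum u ^~ s) @ \oo --> (if s == 0 then 0 else w s).
  case: eqP => [-> _|_]; last exact: wP.
  by rewrite (_ : riemann_sum u ^~ 0 = fun=> 0); [exact: cvg_cst|exact/funext].
have [L L0 HL] := uL S q; exists L => // a b a0 ab bS.
set wa := (if a == 0 then 0 else w a); set wb := (if b == 0 then 0 else w b).
apply/ler_addgt0Pr => e e0; have e4 : 0 < e / 4 by rewrite divr_gt0.
have /(cvg_csnP Xp)/(_ q _ e4)[N1 _ N1P] := wP a a0.
have /(cvg_csnP Xp)/(_ q _ e4)[N2 _ N2P] := wP b (le_trans a0 ab).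
have [N3 N3P] := @invn_small (q (u a)) (e / 4) (csn_ge0 _ _) e4.
have ba : 0 <= b - a by rewrite subr_ge0.
have [|N4 N4P] := @invn_small (L * (2 * (b - a) + 1)) (e / 4) _ e4.
  by rewrite mulr_ge0//; lra.
pose n := maxn (maxn N1 N2) (maxn N3 N4).
have n1 : (N1 <= n)%N by rewrite !leq_max leqnn.
have n2 : (N2 <= n)%N by rewrite !leq_max leqnn orbT.
have n3 : (N3 <= n)%N by rewrite !leq_max leqnn !orbT.
have n4 : (N4 <= n)%N by rewrite !leq_max leqnn !orbT.
have := riemann_sum_increment n L0 HL a0 ab bS.
have := N1P n n1; have := N2P n n2; have := N3P n n3; have := N4P n n4.
rewrite /= -/wa -/wb.
have := csn_tri q (riemann_sum u n b) wb (wa + ofr (b - a) *: u a).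
have := csn_tri q (riemann_sum u n a + ofr (b - a) *: u a) (riemann_sum u n b) (wa + ofr (b - a) *: u a).
rewrite csn_subDr [q (wb - riemann_sum u n b)]csn_distC.
have hn0 : 0 <= n.+1%:R^-1 :> R by rewrite invr_ge0.
have hn1 : n.+1%:R^-1 <= 1 :> R by rewrite invf_le1 ?ltr0n// ler1n.
have : L * (b - a + n.+1%:R^-1) ^+ 2 <= L * (b - a) ^+ 2 + n.+1%:R^-1 * (L * (2 * (b - a) + 1)).
  rewrite [n.+1%:R^-1 * _]mulrCA -mulrDr ler_wpM2l//.
  move: hn0 hn1; move: (n.+1%:R^-1 : R) => h ? ?; nra.
move: (n.+1%:R^-1 : R) => h; lra.
Qed.

End lipschitz_integral.

(** * Weak limits of the product iterates *)

Section subsequences.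

Lemma homo_lt_ge_id (i : nat -> nat) : {homo i : m n / (m < n)%N} ->
  forall n, (n <= i n)%N.
Proof. by move=> hi; elim=> // n IH; apply: leq_ltn_trans IH (hi _ _ _). Qed.

Lemma homo_ltP (i : nat -> nat) : (forall n, (i n < i n.+1)%N) ->
  {homo i : m n / (m < n)%N}.
Proof.
by move=> hi; apply: homo_ltn => //; exact: ltn_trans.
Qed.

(** The diagonal is a subsequence of the extraction made for [k] only from index [k] on; hence
    stability of [P] under both subsequences and changes of finitely many terms. *)
Lemma diagonal_subsequence (P : nat -> (nat -> nat) -> Prop) :
  (forall k i, {homo i : m n / (m < n)%N} ->
    exists2 j : nat -> nat, {homo j : m n / (m < n)%N} & P k (i \o j)) ->
  (forall k i j, {homo j : m n / (m < n)%N} -> P k i -> P k (i \o j)) ->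
  (forall k i i' N, (forall n, (N <= n)%N -> i n = i' n) -> P k i -> P k i') ->
  exists2 d : nat -> nat, {homo d : m n / (m < n)%N} & forall k, P k d.
Proof.
move=> Pex Psub Ptail.
pose T := {i : nat -> nat | {homo i : m n / (m < n)%N}}.
have /choice[nxt nxtP] : forall ki : nat * T, exists j : T, P ki.1 (sval ki.2 \o sval j).
  by move=> [k [i hi]]; have [j hj Pj] := Pex k i hi; exists (exist (fun i : nat -> nat => {homo i : m n / (m < n)%N}) j hj).
have compP (i j : T) : {homo (sval i \o sval j) : m n / (m < n)%N}.
  by move=> m n mn /=; apply: (svalP i); exact: (svalP j).
have idP : {homo (id : nat -> nat) : m n / (m < n)%N} by [].
pose inT i (hi : {homo i : m n / (m < n)%N}) : T :=
  exist (fun i : nat -> nat => {homo i : m n / (m < n)%N}) i hi.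
pose I := fix I k : T := if k is k'.+1
  then inT _ (compP (I k') (nxt (k', I k'))) else inT _ idP.
pose J k : nat -> nat := sval (nxt (k, I k)).
have hJ k : {homo J k : m n / (m < n)%N} by exact: (svalP (nxt (k, I k))).
have IS k n : sval (I k.+1) n = sval (I k) (J k n) by [].
have hI k : {homo sval (I k) : m n / (m < n)%N} by exact: (svalP (I k)).
pose d n := sval (I n.+1) n.
have hd : {homo d : m n / (m < n)%N}.
  apply: homo_ltP => n; rewrite /d [X in (_ < X)%N]IS; apply: hI.
  exact: homo_lt_ge_id.
exists d => // k.
(* The composite of the [r] extractions made after stage [k]. *)
pose E := fix E r n : nat := if r is r'.+1 then E r' (J (k.+1 + r')%N n) else n.
have hE r : {homo E r : m n / (m < n)%N}.
  by elim: r => //= r IH m n mn; apply: IH; exact: hJ.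
have IE r n : sval (I (k.+1 + r)%N) n = sval (I k.+1) (E r n).
  by elim: r n => [|r IH] n; [rewrite addn0|rewrite addnS IS IH].
(* Below [k] the value does not matter; the identity keeps the map strictly increasing. *)
pose e n := if (n < k)%N then n else E (n - k)%N n.
have he : {homo e : m n / (m < n)%N}.
  apply: homo_ltP => n; rewrite /e; have [nk|nk] := ltnP n k; have [nk1|nk1] := ltnP n.+1 k.
  - by [].
  - exact: (homo_lt_ge_id (hE _)).
  - by move: (leq_trans nk1 nk); rewrite ltnNge leqnSn.
  - by rewrite subSn//=; apply: hE; exact: (homo_lt_ge_id (hJ _) n.+1).
apply: (Ptail k (sval (I k.+1) \o e) d k).
  move=> n kn; have en : e n = E (n - k)%N n by rewrite /e ltnNge kn.
  by rewrite -[LHS]/(sval (I k.+1) (e n)) en -IE /d addSn subnKC.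
by apply: Psub => //; exact: nxtP (k, I k).
Qed.

End subsequences.

Lemma seq_cvg_unique (R : realType) (u : nat -> R) (a b : R) :
  u n @[n --> \oo] --> a -> u n @[n --> \oo] --> b -> a = b.
Proof. by move=> ua ub; rewrite -(cvg_lim _ ua)// -(cvg_lim _ ub). Qed.

Section weak_solutions.
Context {R : realType} {k : scalar_kind}.
Notation K := (scalar_field R k).
Local Notation ofr := (@of_real R k).
Variable X : tvsType K.
Implicit Types (q : csn X) (l : rfun X).

Definition rweak_cvg (u : nat -> X) (x : X) := forall l, l (u n) @[n --> \oo] --> l x.

Lemma rweak_cvg_subseq (u : nat -> X) x (j : nat -> nat) :
  {homo j : m n / (m < n)%N} -> rweak_cvg u x -> rweak_cvg (u \o j) x.
Proof.
move=> hj ux l; apply: (cvg_comp j (fun n => l (u n)) _ (ux l)).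
move=> A [N _ NA]; exists N => // n Nn; apply: NA => /=.
exact: leq_trans Nn (homo_lt_ge_id hj n).
Qed.

Lemma rweak_cvg_tail (u v : nat -> X) x N : (forall n, (N <= n)%N -> u n = v n) ->
  rweak_cvg u x -> rweak_cvg v x.
Proof.
move=> uv ux l; apply: cvg_trans (ux l); apply: near_eq_cvg.
by exists N => // n Nn; rewrite /= uv.
Qed.

(** Weak lower semicontinuity of [q], obtained from a functional that norms the limit. *)
Lemma csn_le_weak q (u : nat -> X) x (c : nat -> R) (C : R) :
  rweak_cvg u x -> (\forall n \near \oo, q (u n) <= c n) -> c n @[n --> \oo] --> C -> q x <= C.
Proof.
move=> ux uc cC; have [l [lq <-]] := rfun_norming q x.
apply: ler_cvg_to (ux l) cC _; apply: filterS uc => n uc.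
apply: le_trans uc; apply: le_trans (lq _); exact: ler_norm.
Qed.

Lemma rfun_bounded l (A : set X) : csn_bounded A -> exists C : R, forall x, A x -> `|l x| <= C.
Proof. by move=> /(_ (csn_rfun l))[C CP]; exists C. Qed.

Section generating.
Variables (Omega : Type) (p : Omega -> X -> R).
Hypothesis Xp : generating_seminorms p.

Lemma annihilator_closure (Z0 : set (X * X)) l1 l2 :
  (forall c d, Z0 (c, d) -> l1 c + l2 d = 0) ->
  forall c d, closure Z0 (c, d) -> l1 c + l2 d = 0.
Proof.
move=> H c d /(closure_csnP Xp) Zcd; apply/eqP; rewrite -normr_le0.
apply/ler_addgt0Pr => e e0; have e2 : 0 < e / 2 by rewrite divr_gt0.
have [c' [d' [/H Z' /= hc hd]]] := Zcd (csn_add (csn_rfun l1) (csn_rfun l2)) _ e2.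
rewrite !rfB in hc hd; rewrite add0r.
have -> : l1 c + l2 d = - (l1 c' - l1 c) - (l2 d' - l2 d) + (l1 c' + l2 d') by ring.
rewrite Z' addr0; apply: le_trans (ler_normB _ _) _; rewrite normrN.
have := normr_ge0 (l2 c' - l2 c); have := normr_ge0 (l1 d' - l1 d); lra.
Qed.

Hypothesis X_complete : tvs_complete X.
Variable F : R -> clmap X X.
Hypothesis Feq : locally_equicontinuous F.
Variable Z0 : set (X * X).
Hypothesis Z0_linear : linear_subspace Z0.
Hypothesis FZ0 : derivative_extends F Z0.
Hypothesis Z0_dense : forall x q (e : R), 0 < e ->
  exists x' y', Z0 (x', y') /\ q (x' - x) < e.

(** In real parts: [kap] is the derivative at 0 of the adjoints of F(h) applied to [lam], in the
    strong topology of the dual. *)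
Definition adjoint_derivative (lam kap : rfun X) := forall A : set X,
  csn_bounded A -> forall e : R, 0 < e -> \forall h \near 0^'+, forall x, A x ->
    `|h^-1 * (lam (F h x) - lam x) - kap x| <= e.

Hypothesis adjoint_dense : forall l, exists lam kap : nat -> rfun X,
  (forall x, lam n x @[n --> \oo] --> l x) /\
  forall n, adjoint_derivative (lam n) (kap n).

Lemma csn_bounded1 (x : X) : csn_bounded [set x].
Proof. by move=> q; exists (q x) => y ->. Qed.

(** For (x, y) in [Z0] the quotient lam((F(h) x - x) / h) tends to both lam(y) and kap(x). The
    identity says that (-kap, lam) annihilates [Z0], hence also its closure. *)
Lemma adjoint_derivative_graph lam kap : adjoint_derivative lam kap ->
  forall x y, closure Z0 (x, y) -> kap x = lam y.
Proof.
move=> lk.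
have lin : real_linear (fun x => - kap x).
  by split=> [x y|a x]; rewrite ?rfD ?rfZ; ring.
have dom : exists q, forall x, `|- kap x| <= q x.
  by exists (csn_rfun kap) => x; rewrite normrN.
have H x y : Z0 (x, y) -> Rfun lin dom x + lam y = 0.
  move=> Zxy /=; apply/eqP; rewrite -normr_le0; apply/ler_addgt0Pr => e e0.
  have e2 : 0 < e / 2 by rewrite divr_gt0.
  near (0 : R)^'+ => h.
  have h0 : 0 < h by near: h; exact: nbhs_right_gt.
  have h1 : csn_rfun lam (ofr h^-1 *: (F h x - x) - y) < e / 2.
    by near: h; exact: FZ0.
  have h2 : `|h^-1 * (lam (F h x) - lam x) - kap x| <= e / 2.
    have : forall z, [set x] z -> `|h^-1 * (lam (F h z) - lam z) - kap z| <= e / 2.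
      by near: h; apply: lk => //; exact: csn_bounded1.
    exact.
  rewrite /= rfB rfZ rfB in h1.
  have -> : - kap x + lam y = (h^-1 * (lam (F h x) - lam x) - kap x) -
     (h^-1 * (lam (F h x) - lam x) - lam y) by ring.
  rewrite add0r; apply: le_trans (ler_normB _ _) _; lra.
move=> x y /(annihilator_closure H) /=; lra.
Unshelve. all: by end_near. Qed.

(** If (0, y) lies in the closure then lam_n(y) = kap_n(0) = 0, while lam_n(y) tends to l(y) =
    q(y). *)
Lemma adjoint_closable : hausdorff_space X -> forall y, closure Z0 (0, y) -> y = 0.
Proof.
move=> hX y Zy; apply: (csn_eq0 Xp hX) => q; have [l [_ <-]] := rfun_norming q y.
have [lam [kap [laml lk]]] := adjoint_dense l.
apply: (seq_cvg_unique (laml y)).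
rewrite (_ : (fun n => lam n y) = fun=> 0); first exact: cvg_cst.
apply/funext => n; have := adjoint_derivative_graph (lk n) Zy.
by rewrite rf0.
Qed.

Variable t : R.
Hypothesis t_gt0 : 0 < t.

Let h (n : nat) : R := t / n.+1%:R.
Let m (n : nat) (s : R) : nat := Num.truncn (n.+1%:R * (s / t)).

(** In conditions (a)-(c) the parameter counts multiples of [t]. Here [s] is elapsed time, so the
    exponent is the integer part of (n + 1) s / t and the limit moves at unit speed. *)
Definition trotter_path (f : X) (n : nat) (s : R) := iter (m n s) (F (h n)) f.

Lemma step_gt0 n : 0 < h n. Proof. by rewrite divr_gt0// ltr0n. Qed.

Lemma step_count n (s : R) : 0 <= s -> (m n s)%:R * h n <= s /\ s < (m n s)%:R * h n + h n.
Proof.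
move=> s0; have st0 : 0 <= n.+1%:R * (s / t) by rewrite !mulr_ge0// invr_ge0 ltW.
have [h1 h2] := truncn_bounds st0; rewrite -/(m n s) in h1 h2.
have hs : n.+1%:R * (s / t) * h n = s.
  by rewrite /h; field; rewrite nat1r pnatr_eq0 (gt_eqF t_gt0).
split; first by rewrite -[X in _ <= X]hs ler_pM2r ?step_gt0.
by rewrite -[X in X < _]hs -[X in _ + X]mul1r -mulrDl ltr_pM2r ?step_gt0.
Qed.

Lemma step_cvg : h n @[n --> \oo] --> 0^'+.
Proof.
move=> A [e /= e0 eA]; have [N NP] := @invn_small R t e (ltW t_gt0) e0.
exists N => // n Nn; apply: eA => /=; last exact: step_gt0.
by rewrite sub0r normrN gtr0_norm ?step_gt0// /h mulrC NP.
Qed.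

Lemma step_near (P : R -> Prop) : (\forall h \near 0^'+, P h) -> \forall n \near \oo, P (h n).
Proof. exact: step_cvg. Qed.

Variables (f f' : X).
Hypothesis ff' : Z0 (f, f').

Lemma trotter_path_lipschitz (S : R) q : exists2 L : R, 0 <= L &
  \forall n \near \oo, forall a b : R, 0 <= a -> a <= b -> b <= S ->
    q (trotter_path f n b - trotter_path f n a) <= L * (b - a + h n).
Proof.
have [L L0 HL] := iter_lipschitz Feq FZ0 ff' S q; exists L => //.
have := step_near HL; apply: filterS => n {}HL a b a0 ab bS.
have [a1 a2] := step_count n a0; have [b1 b2] := step_count n (le_trans a0 ab).
have mab : (m n a <= m n b)%N.
  by rewrite le_truncn// ler_pM2l ?ltr0n// ler_pM2r ?invr_gt0.
rewrite /trotter_path -(subnKC mab).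
have mE : (m n b)%:R = (m n a)%:R + (m n b - m n a)%:R :> R by rewrite -natrD subnKC.
apply: le_trans (HL _ _ _) _; first by rewrite subnKC// (le_trans b1).
rewrite mE in b1 b2; rewrite ler_wpM2l//; lra.
Qed.

Hypothesis trotter_weak : forall s : R, 0 <= s -> exists u v : nat -> X,
  [/\ forall n, closure Z0 (u n, v n),
      rweak_cvg (fun n => trotter_path f n s - u n) 0,
      (forall i, {homo i : m n / (m < n)%N} -> exists2 j : nat -> nat,
        {homo j : m n / (m < n)%N} & exists x, rweak_cvg (u \o i \o j) x) &
      (forall i, {homo i : m n / (m < n)%N} -> exists2 j : nat -> nat,
        {homo j : m n / (m < n)%N} & exists x, rweak_cvg (v \o i \o j) x)].

Lemma rweak_cvg_sub (u v : nat -> X) x : rweak_cvg (fun n => u n - v n) 0 ->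
  rweak_cvg u x -> rweak_cvg v x.
Proof.
move=> uv ux l; rewrite -[l x]subr0 -(rf0 l).
rewrite (_ : (fun n => l (v n)) = (fun n => l (u n)) - (fun n => l (u n - v n))).
  exact: cvgB (ux l) (uv l).
by apply/funext => n; rewrite -[RHS]/(l (u n) - l (u n - v n)) rfB; ring.
Qed.

Lemma rweak_cvgB (u v : nat -> X) x y : rweak_cvg u x -> rweak_cvg v y ->
  rweak_cvg (fun n => u n - v n) (x - y).
Proof.
move=> ux vy l; rewrite rfB.
rewrite (_ : (fun n => _) = (fun n => l (u n)) - (fun n => l (v n))).
  exact: cvgB (ux l) (vy l).
by apply/funext => n; rewrite -[RHS]/(l (u n) - l (v n)) rfB.
Qed.

Lemma rweak_cvg_add (u v : nat -> X) x : rweak_cvg (fun n => u n - v n) 0 ->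
  rweak_cvg v x -> rweak_cvg u x.
Proof.
move=> uv vx l; rewrite -[l x]add0r -(rf0 l).
rewrite (_ : (fun n => l (u n)) = (fun n => l (u n - v n)) + (fun n => l (v n))).
  exact: cvgD (uv l) (vx l).
by apply/funext => n; rewrite -[RHS]/(l (u n - v n) + l (v n)) rfB; ring.
Qed.

Lemma trotter_path_precompact s i : 0 <= s -> {homo i : m n / (m < n)%N} ->
  exists2 j : nat -> nat, {homo j : m n / (m < n)%N} &
    exists x, rweak_cvg (fun n => trotter_path f (i (j n)) s) x.
Proof.
move=> s0 hi; have [u [v [_ uv up _]]] := trotter_weak s0.
have [j hj [x ux]] := up i hi; exists j => //; exists x.
apply: rweak_cvg_add ux.
apply: (rweak_cvg_subseq (u := fun n => trotter_path f n s - u n) (j := i \o j)) => //.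
by move=> a b ab /=; apply: hi; exact: hj.
Qed.

(** A diagonal subsequence converges at all nonnegative rational times, and the asymptotic Lipschitz
    bound spreads this to every [s]. Convergence at [s] holds along [d] itself; the further
    subsequence [j] only produces the limit point. *)
Lemma trotter_path_weak_limit : exists2 d : nat -> nat,
  {homo d : m n / (m < n)%N} & forall s, 0 <= s ->
    exists x, rweak_cvg (fun n => trotter_path f (d n) s) x.
Proof.
(* Enumerates the nonnegative rationals; codes that do not decode give time 0. *)
pose r (c : nat) : R := if unpickle c is Some ab then
  (ab : nat * nat).1%:R / ab.2.+1%:R else 0.
have r0 c : 0 <= r c.
  by rewrite /r; case: unpickle => // -[a b]; rewrite divr_ge0.
have [|||d hd dP] := @diagonal_subsequence (fun c i =>
  exists x, rweak_cvg (fun n => trotter_path f (i n) (r c)) x).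
- by move=> c i hi; exact: trotter_path_precompact.
- by move=> c i j hj [x ux]; exists x; exact: (rweak_cvg_subseq hj ux).
- move=> c i i' N ii' [x ux]; exists x; apply: (rweak_cvg_tail (N := N)) ux => n Nn.
  by rewrite (ii' n Nn).
exists d => // s s0.
have [j hj [x jx]] := trotter_path_precompact s0 hd; exists x => l.
apply/cvgrPdist_lt => e e0.
have [L L0 HL] := trotter_path_lipschitz (s + 1) (csn_rfun l).
have L1 : 0 < L + 1 by lra.
pose e1 := Num.min 1 (e / 8 / (L + 1)).
have e10 : 0 < e1 by rewrite lt_min ltr01/= !divr_gt0.
have Le1 : L * e1 <= e / 8.
  have : e1 <= e / 8 / (L + 1) by rewrite ge_min lexx orbT.
  rewrite ler_pdivlMr// => h1; apply: le_trans h1.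
  rewrite mulrC ler_wpM2l ?(ltW e10)//; lra.
have e11 : e1 <= 1 by rewrite ge_min lexx.
have [c cs] : exists c, s <= r c /\ r c - s <= e1.
  have [M MP] := @invn_small R 1 e1 ler01 e10.
  have sM : 0 <= s * M.+1%:R by rewrite mulr_ge0.
  have [h1 h2] := truncn_bounds sM.
  exists (pickle ((Num.truncn (s * M.+1%:R)).+1, M)); rewrite /r pickleK /=.
  have M0 : 0 < M.+1%:R :> R by rewrite ltr0n.
  set T := Num.truncn _ in h1 h2 *.
  have TE : T.+1%:R = T%:R + 1 :> R by rewrite natr1.
  split; first by rewrite ler_pdivlMr// TE ltW.
  rewrite lerBlDr TE mulrDl addrC; apply: lerD; last by rewrite ler_pdivrMr.
  by have := MP M (leqnn _); rewrite mulr1 div1r => /ltW.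
have [y yr] := dP c.
have e8 : 0 < e / 8 by rewrite divr_gt0.
have A1 : \forall n \near \oo, `|l y - l (trotter_path f (d n) (r c))| < e / 8.
  by have /cvgrPdist_lt/(_ _ e8) := yr l.
have dnear (P : nat -> Prop) : (\forall n \near \oo, P n) -> \forall n \near \oo, P (d n).
  move=> [N _ NP]; exists N => // n Nn; apply: NP => /=.
  exact: leq_trans Nn (homo_lt_ge_id hd n).
have jnear (P : nat -> Prop) : (\forall n \near \oo, P n) -> \forall n \near \oo, P (j n).
  move=> [N _ NP]; exists N => // n Nn; apply: NP => /=.
  exact: leq_trans Nn (homo_lt_ge_id hj n).
have A2 : \forall n \near \oo, `|l (trotter_path f (d n) (r c)) - l (trotter_path f (d n) s)| <= e / 4.
  have hs : \forall n \near \oo, h n < e1.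
    by apply: (step_near (P := fun x => x < e1)); exact: nbhs_right_lt.
  apply: filterS2 (dnear _ HL) (dnear _ hs) => n {}HL {}hs.
  have := HL s (r c) s0 cs.1; rewrite /= rfB => /(_ _)/le_trans; apply; first lra.
  have : L * (r c - s + h (d n)) <= L * (e1 + e1).
    by apply: ler_wpM2l => //; lra.
  lra.
have A3 : \forall n \near \oo, `|l x - l (trotter_path f (d (j n)) s)| < e / 8.
  by have /cvgrPdist_lt/(_ _ e8) := jx l.
(* A single index of the subsequence links [x] to the limit [y] at the rational time [r c]; every
   large index is then compared with it. *)
have [n0 [[B1 B2] B3]] : exists n0, (`|l y - l (trotter_path f (d (j n0)) (r c))| < e / 8 /\
   `|l (trotter_path f (d (j n0)) (r c)) - l (trotter_path f (d (j n0)) s)| <= e / 4) /\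
   `|l x - l (trotter_path f (d (j n0)) s)| < e / 8.
  have [n0] := filter_ex (filterI (jnear _ (filterI A1 A2)) A3).
  by exists n0.
apply: filterS2 A1 A2 => n C1 C2.
have -> : l x - l (trotter_path f (d n) s) =
  (l x - l (trotter_path f (d (j n0)) s)) -
  (l (trotter_path f (d (j n0)) (r c)) - l (trotter_path f (d (j n0)) s)) -
  (l y - l (trotter_path f (d (j n0)) (r c))) +
  (l y - l (trotter_path f (d n) (r c))) +
  (l (trotter_path f (d n) (r c)) - l (trotter_path f (d n) s)) by ring.
apply: le_lt_trans (ler_normD _ _) _.
have := ler_normD (l x - l (trotter_path f (d (j n0)) s) -
  (l (trotter_path f (d (j n0)) (r c)) - l (trotter_path f (d (j n0)) s)) -
  (l y - l (trotter_path f (d (j n0)) (r c)))) (l y - l (trotter_path f (d n) (r c))).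
have := ler_normB (l x - l (trotter_path f (d (j n0)) s) -
  (l (trotter_path f (d (j n0)) (r c)) - l (trotter_path f (d (j n0)) s)))
  (l y - l (trotter_path f (d (j n0)) (r c))).
have := ler_normB (l x - l (trotter_path f (d (j n0)) s))
  (l (trotter_path f (d (j n0)) (r c)) - l (trotter_path f (d (j n0)) s)).
lra.
Qed.

(** * The weak limit path and its integrated equation *)

Section limit.
Variables (d : nat -> nat) (u : R -> X).
Hypothesis d_homo : {homo d : m n / (m < n)%N}.
Hypothesis u_lim : forall s : R, 0 <= s ->
  rweak_cvg (fun n => trotter_path f (d n) s) (u s).

Lemma near_subseq (P : nat -> Prop) :
  (\forall n \near \oo, P n) -> \forall n \near \oo, P (d n).
Proof.
move=> [N _ NP]; exists N => // n Nn; apply: NP => /=.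
exact: leq_trans Nn (homo_lt_ge_id d_homo n).
Qed.

Lemma step_subseq_cvg : h (d n) @[n --> \oo] --> (0 : R).
Proof.
apply/cvgrPdist_lt => e e0.
have hs : \forall n \near \oo, h n < e.
  by apply: (step_near (P := fun x => x < e)); exact: nbhs_right_lt.
apply: filterS (near_subseq hs) => n {}hs.
by rewrite sub0r normrN gtr0_norm ?step_gt0.
Qed.

Lemma limit_lipschitz : locally_lipschitz u.
Proof.
move=> S q; have [L L0 HL] := trotter_path_lipschitz S q; exists L => // a b a0 ab bS.
have b0 := le_trans a0 ab.
apply: (@csn_le_weak q (fun n => trotter_path f (d n) b - trotter_path f (d n) a) _
   (fun n => L * (b - a + h (d n)))).
- exact: rweak_cvgB (@u_lim _ b0) (@u_lim _ a0).
- by apply: filterS (near_subseq HL) => n {}HL; exact: HL.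
- have -> : L * (b - a) = L * (b - a + 0) by rewrite addr0.
  apply: cvgM; first exact: cvg_cst.
  by apply: cvgD; [exact: cvg_cst|exact: step_subseq_cvg].
Qed.

Lemma limit0 : hausdorff_space X -> u 0 = f.
Proof.
move=> hX; apply/eqP; rewrite -subr_eq0; apply/eqP; apply: (csn_eq0 Xp hX) => q.
have [l [_ <-]] := rfun_norming q (u 0 - f).
rewrite rfB; apply/eqP; rewrite subr_eq0; apply/eqP.
apply: (seq_cvg_unique (@u_lim 0 (lexx 0) l)).
rewrite (_ : (fun n => _) = fun=> l f); first exact: cvg_cst.
by apply/funext => n; rewrite /trotter_path /m mul0r mulr0 truncn0.
Qed.

(** By (a) the elements of the graph have first components with weak limit u(s), by (c) their images
    converge weakly along a subsequence, and the closed graph is weakly closed. *)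
Lemma limit_graph (s : R) : 0 <= s -> exists z, closure Z0 (u s, z).
Proof.
move=> s0; have [v [z [Zvz uv _ pz]]] := trotter_weak s0.
have [j hj [y zy]] := pz d d_homo; exists y.
have hdj : {homo (d \o j) : m n / (m < n)%N}.
  by move=> a b ab /=; apply: d_homo; exact: hj.
apply: (closure_separation Xp Z0_linear) => l1 l2 l12.
have vu : rweak_cvg (v \o (d \o j)) (u s).
  apply: rweak_cvg_sub (rweak_cvg_subseq hj (@u_lim _ s0)).
  exact: (rweak_cvg_subseq hdj uv).
apply: (@seq_cvg_unique R (fun n => l1 (v (d (j n))) + l2 (z (d (j n))))).
  exact: cvgD (vu l1) (zy l2).
rewrite (_ : (fun n => _) = fun=> 0); first exact: cvg_cst.
by apply/funext => n; exact: (annihilator_closure l12 (Zvz _)).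
Qed.

Lemma orbit_bounded (S : R) :
  csn_bounded [set x | exists (a : R) (i : nat), [/\ 0 <= a, i%:R * a <= S & x = iter i (F a) f]].
Proof.
move=> q; have [q1 q1P] := Feq S q; exists (q1 f) => _ [a [i [a0 iS ->]]].
exact: q1P.
Qed.

(** One step changes [lam] along the orbit by h kap(F(h)^j f) + o(h), uniformly in j since the orbit
    is a bounded set. As orbits are Lipschitz, [kap] may be frozen at time a at quadratic cost, and
    the estimate survives the weak limit. *)
Lemma limit_quadratic lam kap (S : R) : adjoint_derivative lam kap ->
  quadratic_primitive S (fun r => lam (u r)) (fun r => kap (u r)).
Proof.
move=> lk.
have [L1 L10 HL1] := iter_lipschitz Feq FZ0 ff' S (csn_rfun kap).
have [L2 L20 HL2] := limit_lipschitz S (csn_rfun kap).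
exists (L1 + L2) => [|a b a0 ab bS]; first exact: addr_ge0.
have b0 := le_trans a0 ab; have ba : 0 <= b - a by rewrite subr_ge0.
have bA := orbit_bounded S; set A := (X in csn_bounded X) in bA.
split; last first.
  rewrite -rfB; apply: le_trans (HL2 _ _ a0 ab bS) _.
  by rewrite ler_wpM2r// lerDr.
suff : `|lam (u b) - (lam (u a) + (b - a) * kap (u a))| <= L1 * (b - a) ^+ 2.
  move=> /le_trans; apply; rewrite ler_wpM2r ?sqr_ge0// lerDl//.
apply/ler_addgt0Pr => e e0.
pose e1 := e / (b - a + 1).
have e10 : 0 < e1 by rewrite divr_gt0// ltr_wpDl.
have [C CP] := rfun_bounded kap bA.
pose E n := lam (trotter_path f (d n) b) - (lam (trotter_path f (d n) a) +
   (b - a) * kap (trotter_path f (d n) a)).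
have Ecvg : E n @[n --> \oo] --> lam (u b) - (lam (u a) + (b - a) * kap (u a)).
  apply: cvgB (@u_lim _ b0 lam) _; apply: cvgD (@u_lim _ a0 lam) _.
  by apply: cvgM (@u_lim _ a0 kap); exact: cvg_cst.
(* Elapsed time, up to rounding, times the error per unit of time ([e1] for the derivative, the rest
   for freezing [kap]); then the rounding of b - a times the bound [C] for [kap]. *)
pose c n := (b - a + h (d n)) * (e1 + L1 * (b - a + h (d n))) + h (d n) * C.
have ccvg : c n @[n --> \oo] --> (b - a + 0) * (e1 + L1 * (b - a + 0)) + 0 * C.
  have h1 : (b - a + h (d n)) @[n --> \oo] --> b - a + 0.
    by apply: cvgD; [exact: cvg_cst|exact: step_subseq_cvg].
  apply: cvgD; last by apply: cvgM; [exact: step_subseq_cvg|exact: cvg_cst].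
  apply: (cvgM h1); apply: cvgD; first exact: cvg_cst.
  by apply: (fun H => cvgM H h1); exact: cvg_cst.
have Ec : `|lam (u b) - (lam (u a) + (b - a) * kap (u a))| <=
    (b - a + 0) * (e1 + L1 * (b - a + 0)) + 0 * C.
  apply: ler_cvg_to (cvg_norm Ecvg) ccvg _.
  apply: filterS2 (near_subseq (step_near HL1)) (near_subseq (step_near (lk A bA e1 e10))).
  move=> n {}HL1 {}lk; rewrite /E /c /trotter_path.
  have [] := step_count (d n) a0; have [] := step_count (d n) b0.
  have mab : (m (d n) a <= m (d n) b)%N.
    by rewrite le_truncn// ler_pM2l ?ltr0n// ler_pM2r ?invr_gt0.
  move: HL1 lk mab (step_gt0 (d n)); move: (h (d n)) (m (d n) a) (m (d n) b) => dt i i'.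
  move=> HL1 lk ii h0 b1 b2 a1 a2.
  have [r i'E] : exists r, i' = (i + r)%N by exists (i' - i)%N; rewrite subnKC.
  have inA s : (i + s)%:R * dt <= S -> A (iter (i + s) (F dt) f).
    by move=> isS; exists dt, (i + s)%N; split=> //; exact: ltW.
  have iS : (i + 0)%:R * dt <= S by rewrite addn0; lra.
  have Ck : `|kap (iter i (F dt) f)| <= C by have := CP _ (inA 0%N iS); rewrite addn0.
  have claim s : (i + s)%:R * dt <= b ->
     `|lam (iter (i + s) (F dt) f) - lam (iter i (F dt) f) - s%:R * dt * kap (iter i (F dt) f)|
       <= s%:R * dt * (e1 + L1 * (b - a + dt)).
    elim: s => [|s IH] sb.
      by rewrite addn0 !mul0r subr0 subrr normr0.
    have sb' : (i + s)%:R * dt <= b.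
      by apply: le_trans sb; rewrite ler_pM2r// ler_nat leq_add2l.
    have {}IH := IH sb'.
    have h2 := HL1 i s (le_trans sb' bS); rewrite /= rfB in h2.
    have h3 := lk _ (inA s (le_trans sb' bS)).
    rewrite addnS iterS; set x := iter (i + s) (F dt) f in IH h2 h3 *.
    set y := iter i (F dt) f in IH h2 *.
    have -> : lam (F dt x) - lam y - s.+1%:R * dt * kap y =
      (lam x - lam y - s%:R * dt * kap y) + dt * ((dt^-1 * (lam (F dt x) - lam x) - kap x) + (kap x - kap y)).
      by rewrite -natr1; field; rewrite gt_eqF.
    apply: le_trans (ler_normD _ _) _.
    rewrite -natr1 !mulrDl mul1r; apply: lerD => //.
    rewrite normrM (gtr0_norm h0) ler_pM2l//.
    apply: le_trans (ler_normD _ _) _; apply: lerD => //.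
    apply: le_trans h2 _; rewrite ler_wpM2l//.
    by move: sb'; rewrite natrD; lra.
  rewrite i'E in b1 b2 *; have {}claim := claim r b1.
  rewrite natrD in b1 b2.
  set x := iter (i + r) (F dt) f in claim *; set y := iter i (F dt) f in Ck claim *.
  have -> : lam x - (lam y + (b - a) * kap y) =
    (lam x - lam y - r%:R * dt * kap y) + (r%:R * dt - (b - a)) * kap y by ring.
  apply: le_trans (ler_normD _ _) _; apply: lerD.
    apply: le_trans claim _; rewrite ler_wpM2r//; last lra.
    by rewrite addr_ge0 ?(ltW e10)// mulr_ge0//; lra.
  rewrite normrM; apply: ler_pM => //; rewrite ler_norml; apply/andP; split; lra.
apply: le_trans Ec _; rewrite !addr0 mul0r addr0 mulrDr addrC mulrCA -expr2.
rewrite lerD2l /e1 mulrA ler_pdivrMr ?ltr_wpDl// mulrC ler_pM2l//.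
by rewrite lerDl.
Qed.

(** The sequence [lam], convergent at each point, is uniformly bounded on the set of difference
    quotients of [u], and kap_n(u(r)) is the limit of lam_n on the quotients starting at r. The
    interval is extended to S + 1 to leave room to the right of S. *)
Lemma limit_adjoint_bound (S : R) (lam kap : nat -> rfun X) l :
  (forall x, lam n x @[n --> \oo] --> l x) ->
  (forall n, adjoint_derivative (lam n) (kap n)) ->
  exists M : R, forall n (r : R), 0 <= r -> r <= S -> `|kap n (u r)| <= M.
Proof.
move=> laml lk.
pose A := [set x | exists a b : R, [/\ 0 <= a, a < b, b <= S + 1 &
  x = ofr (b - a)^-1 *: (u b - u a)]].
have bA : csn_bounded A.
  move=> q; have [L L0 HL] := limit_lipschitz (S + 1) q; exists L.
  move=> _ [a [b [a0 ab bS ->]]]; have ba : 0 < b - a by rewrite subr_gt0.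
  rewrite csnZ_ge0 ?invr_ge0 ?(ltW ba)// ler_pdivrMl// mulrC.
  by apply: HL => //; exact: ltW.
have [|M MP] := banach_steinhaus Xp X_complete (l := lam) bA.
  move=> x; have [M [_ HM]] := cvg_seq_bounded (cvgP _ (laml x)).
  by exists (M + 1) => n; apply: HM => //; rewrite ltrDl.
exists M => n r r0 rS; apply/ler_addgt0Pr => e e0.
have [L L0 HL] := limit_quadratic (S + 1) (lk n).
(* The quadratic remainder divided by b - r is at most L (b - r) <= e, and b stays below S + 1. *)
pose b := r + Num.min 1 (e / (L + 1)).
have L1 : 0 < L + 1 by lra.
have m0 : 0 < Num.min 1 (e / (L + 1)) by rewrite lt_min ltr01 divr_gt0.
have m1 : Num.min 1 (e / (L + 1)) <= 1 by rewrite ge_min lexx.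
have m2 : Num.min 1 (e / (L + 1)) <= e / (L + 1) by rewrite ge_min lexx orbT.
have bE : b - r = Num.min 1 (e / (L + 1)) by rewrite /b addrAC subrr add0r.
have [|||+ _] := HL r b; rewrite /b; try lra.
rewrite -/b bE; set dl := Num.min _ _ in m0 m1 m2 bE *.
rewrite ler_pdivlMr// in m2.
have : `|lam n (ofr (b - r)^-1 *: (u b - u r))| <= M.
  by apply: MP; exists r, b; split=> //; lra.
rewrite rfZ rfB bE normrM normfV (gtr0_norm m0) ler_pdivrMl// => h1 h2.
rewrite -(ler_pM2l m0) -{1}(gtr0_norm m0) -normrM.
have -> : dl * kap n (u r) = (lam n (u b) - lam n (u r)) -
   (lam n (u b) - (lam n (u r) + dl * kap n (u r))) by ring.
apply: le_trans (ler_normB _ _) _; rewrite mulrDr; apply: lerD => //.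
apply: le_trans h2 _; rewrite expr2 mulrCA ler_pM2l//; lra.
Qed.

(** Let (l1, l2) annihilate [Z0], and let lam_n tend to l2. With (u(r), z) in the closed graph,
    kap_n(u(r)) = lam_n(z) tends to l2(z) = -l1(u(r)), so the derivative of lam_n(u) + l1(w) tends
    to 0 boundedly. Integration over [0, s] leaves l1(w(s)) + l2(u(s) - f) = 0, and separation
    concludes. *)
Lemma limit_mild (w : R -> X) : hausdorff_space X -> w 0 = 0 ->
  (forall (S : R) q, exists2 L : R, 0 <= L &
    forall a b : R, 0 <= a -> a <= b -> b <= S ->
      q (w b - (w a + ofr (b - a) *: u a)) <= L * (b - a) ^+ 2) ->
  forall s : R, 0 <= s -> closure Z0 (w s, u s - f).
Proof.
move=> hX w0 wu s; rewrite le_eqVlt => /predU1P[<-|s0].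
  by rewrite w0 limit0// subrr; apply: subset_closure; case: Z0_linear.
apply: (closure_separation Xp Z0_linear) => l1 l2 l12.
have [lam [kap [laml lk]]] := adjoint_dense l2.
have [M MP] := limit_adjoint_bound s laml lk.
have [L L0 HL] := wu s (csn_rfun l1).
have [L' L'0 HL'] := limit_lipschitz s (csn_rfun l1).
have [M' M'P] : exists M' : R, forall r : R, 0 <= r -> r <= s -> `|l1 (u r)| <= M'.
  exists (L' * s + `|l1 (u 0)|) => r r0 rs.
  apply: le_trans (csn_sub (csn_rfun l1) _ (u 0)) _; rewrite lerD2r.
  by apply: le_trans (HL' _ _ (lexx _) r0 rs) _; rewrite subr0 ler_wpM2l.
pose G n r := lam n (u r) + l1 (w r); pose g n r := kap n (u r) + l1 (u r).
have Gg n : quadratic_primitive s (G n) (g n).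
  have [K0 K00 HK] := limit_quadratic s (lk n).
  exists (K0 + L + L'); first by rewrite !addr_ge0.
  move=> a b a0 ab bs; have [k1 k2] := HK a b a0 ab bs.
  have k3 := HL a b a0 ab bs; have k4 := HL' a b a0 ab bs.
  have ba : 0 <= b - a by rewrite subr_ge0.
  rewrite /= rfB rfD rfZ in k3; rewrite /= rfB in k4.
  rewrite /G /g; split.
    have -> : lam n (u b) + l1 (w b) -
        (lam n (u a) + l1 (w a) + (b - a) * (kap n (u a) + l1 (u a))) =
      (lam n (u b) - (lam n (u a) + (b - a) * kap n (u a))) +
      (l1 (w b) - (l1 (w a) + (b - a) * l1 (u a))) by ring.
    apply: le_trans (ler_normD _ _) _; have := mulr_ge0 L'0 (sqr_ge0 (b - a)).
    by move: k1 k3; move: ((b - a) ^+ 2) => Q; lra.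
  have -> : kap n (u b) + l1 (u b) - (kap n (u a) + l1 (u a)) =
    (kap n (u b) - kap n (u a)) + (l1 (u b) - l1 (u a)) by ring.
  apply: le_trans (ler_normD _ _) _; have := mulr_ge0 L0 ba.
  by move: k2 k4; move: (b - a) => Q; lra.
have lim0 : (G n s - G n 0) @[n --> \oo] --> 0.
  apply: (@bounded_convergence_primitive R s (M + M') G g) => //.
    move=> n r r0 rs; apply: le_trans (ler_normD _ _) _.
    by apply: lerD; [exact: MP|exact: M'P].
  move=> r r0 rs; have [z Zz] := limit_graph r0.
  rewrite -(annihilator_closure l12 Zz) addrC /g.
  apply: cvgD; last exact: cvg_cst.
  under eq_fun do rewrite (adjoint_derivative_graph (lk _) Zz).
  exact: laml.
apply: (seq_cvg_unique _ lim0).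
under eq_fun do rewrite /G w0 rf0 addr0 limit0// addrAC -rfB.
rewrite addrC; apply: cvgD; [exact: laml|exact: cvg_cst].
Qed.

End limit.

Definition chernoff_path (x : X) (v : R -> X) := forall (S : R) q (e : R), 0 < e ->
  \forall h \near 0^'+, forall m : nat, m%:R * h <= S ->
    q (iter m (F h) x - v (m%:R * h)) <= e.

Tactic Notation "lra_from" hyp_list(hs) :=
  revert hs; clear -Xp X_complete Feq Z0_linear FZ0 Z0_dense adjoint_dense t_gt0 ff' trotter_weak; intros; lra.
Tactic Notation "nra_from" hyp_list(hs) :=
  revert hs; clear -Xp X_complete Feq Z0_linear FZ0 Z0_dense adjoint_dense t_gt0 ff' trotter_weak; intros; nra.

Theorem trotter_weak_strong : hausdorff_space X -> exists u w : R -> X,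
  [/\ locally_lipschitz u, chernoff_path f u, w 0 = 0,
      forall s : R, 0 <= s -> closure Z0 (w s, u s - f) &
      forall (S : R) q, exists2 L : R, 0 <= L &
        forall a b : R, 0 <= a -> a <= b -> b <= S ->
          q (w b - (w a + ofr (b - a) *: u a)) <= L * (b - a) ^+ 2].
Proof.
move=> hX; have [d hd dP] := trotter_path_weak_limit.
have /choice[u uP] : forall s : R, exists x, 0 <= s ->
    rweak_cvg (fun n => trotter_path f (d n) s) x.
  by move=> s; case: (leP 0 s) => [/dP[x ?]|_]; [exists x|exists 0].
have uL := limit_lipschitz hd uP.
have [w [w0 wu]] := lipschitz_integral Xp X_complete uL.
have wZ := limit_mild hd uP hX w0 wu.
exists u, w; split=> // S q e e0.
(* Room for one block of duration at most 1 after time S. *)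
pose S1 := `|S| + 2.
have S10 : 0 <= S1 by rewrite addr_ge0.
have SS1 : S + 1 <= S1 by rewrite /S1; have := ler_norm S; lra.
have [L1 L10 HL1] := uL S1 q; have [L2 L20 HL2] := wu S1 q.
have [L3 L30 HL3] := iter_lipschitz Feq FZ0 ff' S1 q.
(* Over a block of duration at most [dl] the orbit varies by at most L3 dl, and the increment of w
   divided by the duration differs from u by at most L2 dl; together they take half of [e]. *)
pose dl := Num.min 1 (e / 2 / (L3 + L2 + 1)).
have L321 : 0 < L3 + L2 + 1 by lra.
have dl0 : 0 < dl by rewrite lt_min ltr01 !divr_gt0.
have dl1 : dl <= 1 by rewrite ge_min lexx.
have dle : (L3 + L2) * dl <= e / 2.
  have : dl <= e / 2 / (L3 + L2 + 1) by rewrite ge_min lexx orbT.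
  rewrite ler_pdivlMr//; have := ltW dl0; nra.
(* The estimate for the sums is used at both ends of a block and divided by its duration, at least
   dl / 2: two errors e dl / 8 become at most e / 2. *)
have e10 : 0 < e * dl / 8 by rewrite !divr_gt0// mulr_gt0.
have path q' (e' : R) : 0 < e' -> exists2 eta : R, 0 < eta &
  forall a b, 0 <= a -> a <= b -> b <= S1 -> b - a <= eta ->
  [/\ q' (w b - w a) <= e', q' ((u b - f) - (u a - f)) <= e' &
      q' (w b - (w a + ofr (b - a) *: (u a - f + f))) <= e' * (b - a)].
  move=> e'0; have [K1 K10 HK1] := uL S1 q'; have [K2 K20 HK2] := wu S1 q'.
  pose V := q' (u 0) + K1 * S1.
  have V0 : 0 <= V by rewrite addr_ge0 ?csn_ge0// mulr_ge0.
  have uV (a : R) : 0 <= a -> a <= S1 -> q' (u a) <= V.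
    move=> a0 aS; apply: le_trans (csn_sub _ _ (u 0)) _; rewrite addrC lerD2l.
    by apply: le_trans (HK1 _ _ (lexx _) a0 aS) _; rewrite subr0 ler_wpM2l.
  clearbody V.
  pose D := K1 + K2 + V + 1; have D0 : 0 < D by rewrite /D; lra.
  exists (Num.min 1 (e' / D)); first by rewrite lt_min ltr01 divr_gt0.
  move=> a b a0 ab bS; rewrite le_min ler_pdivlMr// => /andP[ba1 baD].
  have ba : 0 <= b - a by rewrite subr_ge0.
  have k1 := HK1 a b a0 ab bS; have k2 := HK2 a b a0 ab bS.
  have kV := uV a a0 (le_trans ab bS).
  have k3 : K2 * (b - a) ^+ 2 <= K2 * (b - a).
    by rewrite ler_wpM2l// expr2 ler_piMr.
  split.
  - apply: le_trans (csn_tri _ (w a + ofr (b - a) *: u a) _ _) _.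
    rewrite (addrAC (w a)) subrr add0r csnZ_ge0//.
    have := ler_wpM2l ba kV; move: baD; rewrite /D; nra_from k2 k3 ba K10.
  - by rewrite csn_subDr; move: baD; rewrite /D; nra_from k1 ba K20 V0.
  - rewrite subrK; apply: le_trans k2 _; rewrite expr2 mulrA ler_wpM2r//.
    by move: baD; rewrite /D; nra_from ba K10 V0.
have := inhomogeneous_chernoff Xp Feq FZ0 Z0_dense S10 (w := w) (z := fun r => u r - f) (g := f)
  (fun r r0 rS => wZ r r0) path q e10.
move=> HC; near=> h0 => i iS.
near_at HL3 h0 HL3h; near_at HC h0 HCh.
have h00 : 0 < h0 by near: h0; exact: nbhs_right_gt.
have hdl : h0 <= dl / 2 by near: h0; apply: nbhs_right_le; rewrite divr_gt0.
pose r := Num.truncn (dl / h0).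
have [r1 r2] := @truncn_bounds R (dl / h0) (divr_ge0 (ltW dl0) (ltW h00)).
rewrite -/r in r1 r2; rewrite ler_pdivlMr// in r1; rewrite ltr_pdivrMr// mulrDl mul1r in r2.
have irS : (i + r)%:R * h0 <= S1 by rewrite natrD mulrDl; lra_from r1 iS dl1 SS1.
have iS1 : i%:R * h0 <= S1 by lra_from iS SS1.
have c1 := HCh i iS1; have c2 := HCh (i + r)%N irS.
rewrite w0 !iter0_clmap !add0r in c1 c2.
have i0 : 0 <= i%:R * h0 by rewrite mulr_ge0// ltW.
set W1 := ofr h0 *: (\sum_(j < i) iter j (F h0) f) in c1.
have W2E : ofr h0 *: (\sum_(j < i + r) iter j (F h0) f) = W1 + ofr h0 *: (\sum_(j < r) iter (i + j) (F h0) f).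
  by rewrite big_split_ord /= scalerDr.
rewrite W2E in c2; set W2 := ofr h0 *: (\sum_(j < r) _) in c2 W2E.
have rE : (i + r)%:R * h0 - i%:R * h0 = r%:R * h0 by rewrite natrD mulrDl addrAC subrr add0r.
have ir : i%:R * h0 <= (i + r)%:R * h0 by rewrite ler_pM2r// ler_nat leq_addr.
have c3 := HL2 _ _ i0 ir irS; rewrite rE in c3.
have rh0 : 0 < r%:R * h0 by move: (dl0); lra_from r2 hdl.
have c4 : q (ofr (r%:R * h0) *: iter i (F h0) f - W2) <= r%:R * h0 * (L3 * dl).
  rewrite mulrC rmorphM -scalerA rmorph_nat scaler_nat -iter_addr_0 -big_const_ord.
  rewrite /W2 -scalerBr -sumrB csnZ_ge0 ?(ltW h00)// -mulrA ler_pM2l//.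
  apply: (csn_sum_le (f := fun j => iter i (F h0) f - iter (i + j) (F h0) f)) => j jr.
  rewrite csn_distC; apply: le_trans (HL3h _ _ _) _.
    by apply: le_trans irS; rewrite ler_pM2r// ler_nat leq_add2l ltnW.
  rewrite ler_wpM2l//; apply: le_trans r1; by rewrite ler_pM2r// ler_nat ltnW.
have main : r%:R * h0 * q (iter i (F h0) f - u (i%:R * h0)) <=
    r%:R * h0 * (L3 * dl) + L2 * (r%:R * h0) ^+ 2 + e * dl / 4.
  rewrite -csnZ_ge0 ?(ltW rh0)// scalerBr.
  apply: le_trans (csn_tri _ W2 _ _) _.
  rewrite -[leRHS]addrA; apply: lerD => //.
  rewrite -(csn_subDl q W1).
  apply: le_trans (csn_tri _ (w ((i + r)%:R * h0)) _ _) _.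
  have := csn_tri q (w (i%:R * h0) + ofr (r%:R * h0) *: u (i%:R * h0)) (w ((i + r)%:R * h0)) (W1 + ofr (r%:R * h0) *: u (i%:R * h0)).
  by rewrite csn_subDr [q (w (i%:R * h0) - W1)]csn_distC; lra_from c1 c2 c3.
rewrite -(ler_pM2l rh0); apply: le_trans main _.
have k1 : dl / 2 <= r%:R * h0 by lra_from r2 hdl.
move: (rh0) (r1) (k1) (dle) (L20) (L30) (dl0) (e0).
move: (r%:R * h0) => y y0 y1 y2 y3 y4 y5 y6 y7.
have y8 : L2 * y ^+ 2 <= y * (L2 * dl) by rewrite expr2 mulrCA ler_pM2l// ler_wpM2l.
have y9 : e * dl / 4 <= y * (e / 2).
  have -> : e * dl / 4 = dl / 2 * (e / 2) by field.
  by rewrite ler_pM2r// divr_gt0.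
have y10 : y * ((L3 + L2) * dl) <= y * (e / 2) by rewrite ler_pM2l.
rewrite mulrDl mulrDr in y10.
have -> : y * e = y * (e / 2) + y * (e / 2) by field.
lra_from y8 y9 y10.
Unshelve. all: by end_near. Qed.

End generating.
End weak_solutions.

Lemma tvs_scaler_continuous (K : numFieldType) (X : tvsType K) (a : K) :
  continuous (fun x : X => a *: x).
Proof.
move=> x; apply: (@continuous_comp X (K^o * X)%type X (fun x => (a, x))
  (fun x => x.1 *: x.2)); last exact: scale_continuous.
by apply: (@cvg_pair _ _ _ _ (nbhs (a : K^o))); [exact: cvg_cst|exact: cvg_id].
Qed.

(** * From paths to semigroups *)

Section semigroup.
Context {R : realType} {k : scalar_kind}.
Notation K := (scalar_field R k).
Local Notation ofr := (@of_real R k).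
Variable X : tvsType K.
Implicit Types (q : csn X) (x y z : X).

Lemma near_right_ex (P : R -> Prop) : (\forall h \near 0^'+, P h) ->
  exists2 eta : R, 0 < eta & forall h, 0 < h -> h < eta -> P h.
Proof.
move=> [e /= e0 eP]; exists e => // h h0 he; apply: eP => //=.
by rewrite sub0r normrN gtr0_norm.
Qed.

Lemma clmapB (G : clmap X X) x y : G (x - y) = G x - G y.
Proof. exact: (iterB_clmap G 1). Qed.

Lemma clmapD (G : clmap X X) x y : G (x + y) = G x + G y.
Proof. exact: (iterD_clmap G 1). Qed.

Lemma clmapZ (G : clmap X X) (a : K) x : G (a *: x) = a *: G x.
Proof. exact: (iterZ_clmap G 1). Qed.

Variables (Omega : Type) (p : Omega -> X -> R).
Hypothesis Xp : generating_seminorms p.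

Lemma class_E_equicontinuous (F : R -> clmap X X) : class_E p F ->
  locally_equicontinuous F.
Proof.
move=> [F0 FE] S q; have [q1 q1P] := equicontinuous_csn Xp (FE `|S| (normr_ge0 _)) q.
(* [power_set] has no empty iterate; the identity enters as F(0). *)
exists q1 => h [|m] x h0 mhS.
  have := q1P (iter 1 (F (0 / 1%:R))); rewrite /= mul0r => H.
  have := H _ x; rewrite F0; apply.
  exists 1%N, 1%N, 0; split=> //; first by rewrite mulr0 mul0r.
  by rewrite /= mul0r.
apply: q1P; exists 1%N, m.+1, h; split=> //; last by rewrite divr1.
by rewrite divr1; apply: le_trans mhS _; exact: ler_norm.
Qed.

(** * Elementary properties of an lC0-semigroup *)

Section lC0.
Variable T : R -> clmap X X.
Hypothesis TC0 : lC0_semigroup p T.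

Lemma semigroup_equicontinuous (S : R) q : exists q' : csn X,
  forall s x, 0 <= s -> s <= S -> q (T s x) <= q' x.
Proof.
have [q' q'P] := class_E_equicontinuous (lC0_class_E TC0) S q.
by exists q' => s x s0 sS; apply: (q'P s 1%N x s0); rewrite mul1r.
Qed.

Lemma semigroup_cvg x : T s x @[s --> 0^'+] --> x.
Proof.
have /subspace_continuousP/(_ 0) := lC0_continuous TC0.
rewrite /= in_itv /= lexx => /(_ isT)/pointwise_cvgP/(_ x).
move=> H; have {}H : T s x @[s --> within `[0, +oo[ (nbhs (0 : R))] --> T 0 x := H.
rewrite (lC0_0 TC0) in H; apply: cvg_trans H => A; rewrite /= !nbhs_filterE.
rewrite /within /=; apply: filterS => s H s0; apply: H.
by rewrite in_itv/= andbT ltW.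
Qed.

Lemma semigroup_near q x (e : R) : 0 < e -> \forall s \near 0^'+, q (T s x - x) < e.
Proof. by move=> e0; have /(cvg_csnP Xp) := @semigroup_cvg x; apply. Qed.

Lemma semigroup_unif q x (S e : R) : 0 < e -> exists2 eta : R, 0 < eta &
  forall a b, 0 <= a -> a <= b -> b <= S -> b - a <= eta -> q (T b x - T a x) <= e.
Proof.
move=> e0; have [q1 q1P] := semigroup_equicontinuous S q.
have [eta eta0 etaP] := near_right_ex (semigroup_near q1 x e0).
exists (eta / 2); first by rewrite divr_gt0.
move=> a b a0 ab bS ba.
have [->|anb] := eqVneq a b; first by rewrite subrr csn0 ltW.
have ba0 : 0 < b - a by rewrite subr_gt0 lt_neqAle anb.
have -> : T b x = T a (T (b - a) x).
  by rewrite -(lC0_add TC0)// ?(ltW ba0)// addrC subrK.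
rewrite -clmapB; apply: le_trans (q1P _ _ a0 (le_trans ab bS)) _.
by apply/ltW/etaP => //; lra.
Qed.

Lemma generatorP x y : generator T (x, y) <->
  forall q (e : R), 0 < e -> \forall h \near 0^'+, q (ofr h^-1 *: (T h x - x) - y) < e.
Proof.
rewrite /generator /strong_derivative0 /= (lC0_0 TC0).
have -> : (fun h => (ofr h)^-1 *: (T h x - x)) = (fun h => ofr h^-1 *: (T h x - x)).
  by apply/funext => h; rewrite fmorphV.
exact: (cvg_csnP Xp).
Qed.

Lemma generator_invariant x y (r : R) : 0 <= r ->
  generator T (x, y) -> generator T (T r x, T r y).
Proof.
move=> r0 /generatorP H; apply/generatorP => q e e0.
have [q1 q1P] := semigroup_equicontinuous r q.
have := H q1 e e0; apply: filterS2 (nbhs_right_gt 0) => h h0.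
apply: le_lt_trans; apply: le_trans (q1P _ _ r0 (lexx r)).
rewrite clmapB clmapZ clmapB -!(lC0_add TC0) ?(ltW h0)//.
by rewrite (addrC h r).
Qed.

Lemma generator_linear : linear_subspace (generator T).
Proof.
split.
  apply/generatorP => q e e0; apply: nearW => h.
  by have := clmapB (T h) 0 0; rewrite !subrr => ->; rewrite subrr scaler0 subrr csn0.
move=> a [x x'] [y y'] /generatorP H1 /generatorP H2.
(* The scalar [a] need not be real, so q(a x) is taken as a seminorm of x. *)
have la : linear (fun x : X => a *: x) by move=> b u v; rewrite scalerDr !scalerA mulrC.
have ca : continuous (fun x : X => a *: x) by exact: tvs_scaler_continuous.
apply/generatorP => q e e0; have e2 : 0 < e / 2 by rewrite divr_gt0.
apply: filterS2 (H1 (csn_comp q la ca) _ e2) (H2 q _ e2) => h h1 h2.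
rewrite (splitr e); apply: le_lt_trans (ltrD h1 h2) => /=.
apply: le_trans (csnD _ _ _); rewrite le_eqVlt; apply/orP; left; apply/eqP; congr (q _).
rewrite clmapD clmapZ !scalerBr !scalerDr !scalerA (mulrC a) !opprD.
by rewrite [in RHS]addrACA [X in X + _ = _]addrACA.
Qed.

End lC0.

(** * Chernoff's theorem and the limit semigroup *)

Section semigroup_limit.
Variable F : R -> clmap X X.
Hypothesis Feq : locally_equicontinuous F.
Variable Z0 : set (X * X).
Hypothesis Z0_linear : linear_subspace Z0.
Hypothesis FZ0 : derivative_extends F Z0.
Hypothesis Z0_dense : forall x q (e : R), 0 < e ->
  exists x' y', Z0 (x', y') /\ q (x' - x) < e.

Lemma chernoff_dense (V : R -> X -> X) (A : set X) :
  (forall (S : R) q, exists q' : csn X, forall s x y, 0 <= s -> s <= S ->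
     q (V s x - V s y) <= q' (x - y)) ->
  (forall x q (e : R), 0 < e -> exists2 f, A f & q (f - x) < e) ->
  (forall f, A f -> chernoff_path F f (V ^~ f)) ->
  forall x, chernoff_path F x (V ^~ x).
Proof.
move=> VL dA HA x S q e e0; have [q1 q1P] := Feq S q; have [q2 q2P] := VL S q.
have e3 : 0 < e / 3 by rewrite divr_gt0.
have [f Af fx] := dA x (csn_add q1 q2) _ e3.
have := HA f Af S q _ e3; apply: filterS2 (nbhs_right_gt 0) => h h0 H m mS.
have mh0 : 0 <= m%:R * h by rewrite mulr_ge0// ltW.
have H1 : q (iter m (F h) x - iter m (F h) f) <= q1 (f - x).
  by rewrite -iterB_clmap csn_distC; apply: q1P => //; exact: ltW.
have H2 := q2P _ f x mh0 mS; have H3 := H m mS.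
have := csn_tri q (iter m (F h) f) (iter m (F h) x) (V (m%:R * h) x).
have := csn_tri q (V (m%:R * h) f) (iter m (F h) f) (V (m%:R * h) x).
by move: fx => /=; lra.
Qed.

Lemma chernoff_path_cvg x (v : R -> X) (s : R) : chernoff_path F x v -> 0 < s ->
  iter n.+1 (F (s / n.+1%:R)) x @[n --> \oo] --> v s.
Proof.
move=> cv s0; apply/(cvg_csnP Xp) => q e e0.
have e2 : 0 < e / 2 by rewrite divr_gt0.
have := step_near s0 (cv s q _ e2); apply: filterS => n H.
have sE : n.+1%:R * (s / n.+1%:R) = s by rewrite mulrC divfK// pnatr_eq0.
have := H n.+1; rewrite sE => /(_ (lexx _)) => H1.
by apply: le_lt_trans H1 _; lra.
Qed.

Lemma domain_dense x q (e : R) : 0 < e -> exists2 f, op_dom Z0 f & q (f - x) < e.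
Proof. by move=> /(Z0_dense x q)[x' [y' [Z' qx]]]; exists x' => //; exists y'. Qed.

(** For f in the domain of [Z0] the pair (T(r) f, T(r) f') stays in the closed graph and solves w' =
    z, so the inhomogeneous estimate applies with source 0; density extends the result to all x. *)
Theorem semigroup_chernoff (T : R -> clmap X X) : lC0_semigroup p T ->
  generator T = closure Z0 -> forall x, chernoff_path F x (fun s => T s x).
Proof.
move=> TC0 gT; apply: (chernoff_dense (A := op_dom Z0) (V := fun s x => T s x)).
- move=> S q; have [q' q'P] := semigroup_equicontinuous TC0 S q.
  by exists q' => s x y s0 sS; rewrite -clmapB; exact: q'P.
- exact: domain_dense.
move=> f [f' ff'] S q e e0.
have gff' : generator T (f, f') by rewrite gT; exact: subset_closure.
have := @inhomogeneous_chernoff _ _ _ _ _ Xp F Feq Z0 FZ0 Z0_dense `|S|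
  (fun r => T r f) (fun r => T r f') 0 (normr_ge0 _).
have graph (r : R) : 0 <= r -> r <= `|S| -> closure Z0 (T r f, T r f').
  by move=> r0 _; rewrite -gT; exact: generator_invariant.
move=> /(_ graph) H.
have {}H : \forall h \near 0^'+, forall m, m%:R * h <= `|S| ->
    q (iter m (F h) (T 0 f) + ofr h *: (\sum_(j < m) iter j (F h) 0) - T (m%:R * h) f) <= e.
  apply: H e0 => q' e' e'0.
  have [q1 q1P] := semigroup_equicontinuous TC0 `|S| q'.
  have [eta1 eta10 H1] := semigroup_unif TC0 q' f `|S| e'0.
  have [eta2 eta20 H2] := semigroup_unif TC0 q' f' `|S| e'0.
  have [eta3 eta30 H3] := near_right_ex (iffLR (generatorP TC0 f f') gff' q1 _ e'0).
  exists (Num.min (Num.min eta1 eta2) (eta3 / 2)).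
    by rewrite !lt_min eta10 eta20 divr_gt0.
  move=> a b a0 ab bS; rewrite !le_min => /andP[/andP[h1 h2] h3].
  split; [exact: H1|exact: H2|].
  have [->|anb] := eqVneq a b.
    by rewrite subrr rmorph0 scale0r addr0 subrr csn0 mulr0.
  have ba0 : 0 < b - a by rewrite subr_gt0 lt_neqAle anb.
  have -> : T b f = T a (T (b - a) f).
    by rewrite -(lC0_add TC0)// ?(ltW ba0)// addrC subrK.
  rewrite addr0 -clmapZ -clmapD -clmapB.
  apply: le_trans (q1P _ _ a0 (le_trans ab bS)) _.
  have -> : T (b - a) f - (f + ofr (b - a) *: f') =
      ofr (b - a) *: (ofr (b - a)^-1 *: (T (b - a) f - f) - f').
    by rewrite scalerBr scalerA -rmorphM divff ?gt_eqF// rmorph1 scale1r opprD addrA.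
  rewrite csnZ_ge0 ?(ltW ba0)// mulrC ler_pM2r//; apply/ltW/H3 => //; lra.
apply: filterS H => h H m mS; have := H m (le_trans mS (ler_norm _)).
rewrite (lC0_0 TC0) big1 ?scaler0 ?addr0// => j _; exact: iter0_clmap.
Qed.

Lemma iter_increment q x y (h C : R) m : 0 < h ->
  (forall j, (j < m)%N -> q (iter j (F h) (ofr h^-1 *: (F h x - x)) - y) <= C) ->
  q (iter m (F h) x - (x + ofr (m%:R * h) *: y)) <= m%:R * h * C.
Proof.
move=> h0 H; rewrite opprD addrA.
have := iter_telescope (F h) 0 m x; rewrite /= add0n => ->.
have -> : \sum_(j < m) iter (0 + j) (F h) (F h x - x) =
    ofr h *: \sum_(j < m) iter j (F h) (ofr h^-1 *: (F h x - x)).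
  rewrite scaler_sumr; apply: eq_bigr => j _.
  by rewrite iterZ_clmap scalerA -rmorphM divff ?gt_eqF// rmorph1 scale1r.
rewrite [_%:R * h]mulrC rmorphM -scalerA rmorph_nat scaler_nat -iter_addr_0 -big_const_ord.
rewrite -scalerBr -sumrB csnZ_ge0 ?(ltW h0)// -mulrA ler_pM2l//.
exact: (csn_sum_le (f := fun j => iter j (F h) (ofr h^-1 *: (F h x - x)) - y)).
Qed.

(** [w] is known through its increments only. On N + 1 equal pieces of [0, s] their quadratic errors
    add up to at most |L| s^2 / (N + 1), so w(s) / s is controlled like a mean of the values of
    [u]. *)
Lemma path_mean q (u w : R -> X) x (s C L : R) : 0 <= s -> w 0 = 0 ->
  (forall a b : R, 0 <= a -> a <= b -> b <= s ->
     q (w b - (w a + ofr (b - a) *: u a)) <= L * (b - a) ^+ 2) ->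
  (forall r : R, 0 <= r -> r <= s -> q (u r - x) <= C) ->
  q (w s - ofr s *: x) <= s * C.
Proof.
move=> s0 w0 wu ux; apply/ler_addgt0Pr => e e0.
have [N NP] := @invn_small R (`|L| * s ^+ 2) e (mulr_ge0 (normr_ge0 L) (sqr_ge0 s)) e0.
pose dl := s / N.+1%:R.
have N0 : 0 < N.+1%:R :> R by rewrite ltr0n.
have dl0 : 0 <= dl by rewrite divr_ge0.
have Nd : N.+1%:R * dl = s by rewrite mulrC divfK// gt_eqF.
have H i : (i <= N.+1)%N ->
    q (w (i%:R * dl) - ofr (i%:R * dl) *: x) <= i%:R * (dl * C + `|L| * dl ^+ 2).
  elim: i => [|i IH] iN; first by rewrite !mul0r w0 rmorph0 scale0r subrr csn0.
  have {}IH := IH (ltnW iN).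
  have i0 : 0 <= i%:R * dl by rewrite mulr_ge0.
  have iE : i.+1%:R * dl = i%:R * dl + dl by rewrite -natr1 mulrDl mul1r.
  have ii : i%:R * dl <= i.+1%:R * dl by rewrite iE lerDl.
  have is_ : i.+1%:R * dl <= s by rewrite -Nd ler_wpM2r// ler_nat.
  have h1 := wu _ _ i0 ii is_; have h2 := ux _ i0 (le_trans ii is_).
  rewrite iE (addrAC (i%:R * dl)) subrr add0r in h1; rewrite iE.
  apply: le_trans (csn_tri _ (w (i%:R * dl) + ofr dl *: u (i%:R * dl)) _ _) _.
  rewrite rmorphD scalerDl.
  have := csn_tri q (ofr (i%:R * dl) *: x + ofr dl *: u (i%:R * dl))
    (w (i%:R * dl) + ofr dl *: u (i%:R * dl)) (ofr (i%:R * dl) *: x + ofr dl *: x).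
  rewrite csn_subDr csn_subDl -scalerBr csnZ_ge0//.
  have h3 := ler_wpM2l dl0 h2.
  have h4 : L * dl ^+ 2 <= `|L| * dl ^+ 2 by rewrite ler_wpM2r ?sqr_ge0// ler_norm.
  rewrite -natr1 mulrDl mul1r; move: h1 h3 h4 IH.
  by move: (dl ^+ 2) => Q; lra.
have := H N.+1 (leqnn _); rewrite Nd => /le_trans; apply.
rewrite mulrDr mulrA Nd lerD2l; apply/ltW.
have -> : N.+1%:R * (`|L| * dl ^+ 2) = N.+1%:R^-1 * (`|L| * s ^+ 2).
  by rewrite /dl; field; rewrite nat1r pnatr_eq0.
exact: NP.
Qed.

Hypothesis X_complete : tvs_complete X.
Hypothesis X_hausdorff : hausdorff_space X.
Variable A : set X.
Hypothesis A_dense : forall x q (e : R), 0 < e -> exists2 f, A f & q (f - x) < e.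
Hypothesis A_path : forall f, A f -> exists u w : R -> X,
  [/\ locally_lipschitz u, chernoff_path F f u, w 0 = 0,
      forall s : R, 0 <= s -> closure Z0 (w s, u s - f) &
      forall (S : R) q, exists2 L : R, 0 <= L &
        forall a b : R, 0 <= a -> a <= b -> b <= S ->
          q (w b - (w a + ofr (b - a) *: u a)) <= L * (b - a) ^+ 2].

Tactic Notation "lra_from" hyp_list(hs) :=
  revert hs; clear -Xp Feq Z0_linear FZ0 Z0_dense X_complete X_hausdorff A_dense A_path; intros; lra.

Lemma csn_lim_unique (u : nat -> X) x y : u @ \oo --> x -> u @ \oo --> y -> x = y.
Proof.
move=> ux uy; apply/eqP; rewrite -subr_eq0; apply/eqP.
apply: (csn_eq0 Xp X_hausdorff) => q; apply/eqP; rewrite -normr_le0 ger0_norm ?csn_ge0//.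
apply/ler_addgt0Pr => e e0; have e2 : 0 < e / 2 by rewrite divr_gt0.
move/(cvg_csnP Xp)/(_ q _ e2) : ux => ux; move/(cvg_csnP Xp)/(_ q _ e2) : uy => uy.
have [n [h1 h2]] := filter_ex (filterI ux uy).
have := csn_tri q (u n) x y; rewrite (csn_distC q x (u n)); move: h1 h2 => /=; lra.
Qed.

Lemma csn_linear_continuous (G : X -> X) : linear G ->
  (forall q, exists q' : csn X, forall x, q (G x) <= q' x) -> continuous G.
Proof.
move=> lG GC x; apply/(cvg_csnP Xp) => q e e0; have [q' q'P] := GC q.
apply: filterS (nbhs_csn q' x e0) => y /=; apply: le_lt_trans.
have -> : G y - G x = G (y - x).
  by rewrite -scaleN1r addrC -lG scaleN1r addrC.
exact: q'P.
Qed.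

Theorem semigroup_of_paths : exists T : R -> clmap X X,
  lC0_semigroup p T /\ generator T = closure Z0.
Proof.
(* For s > 0 the limit exists on [A] and, by equicontinuity and completeness, on [X]. The value x
   for s <= 0 gives T(0) = I and keeps V(s) linear and continuous for every real s. *)
have VE (sx : R * X) : exists l : X,
    (0 < sx.1 -> iter n.+1 (F (sx.1 / n.+1%:R)) sx.2 @[n --> \oo] --> l) /\
    (sx.1 <= 0 -> l = sx.2).
  case: sx => s x /=; case: (leP s 0) => s0; first by exists x.
  have [|l xl] := csn_cauchy_cvg Xp (u := fun n => iter n.+1 (F (s / n.+1%:R)) x) X_complete;
    last by exists l.
  move=> q e e0; have [q1 q1P] := Feq s q.
  have e8 : 0 < e / 8 by rewrite divr_gt0.
  have [f Af fx] := A_dense x q1 e8.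
  have [u [w [_ cu _ _ _]]] := A_path Af.
  have /(cvg_csnP Xp)/(_ q _ e8)[N _ NP] := chernoff_path_cvg cu s0.
  exists N => m n Nm Nn.
  have H i : (N <= i)%N -> q (iter i.+1 (F (s / i.+1%:R)) x - u s) <= e / 4.
    move=> /NP H1; have {}H1 : q (iter i.+1 (F (s / i.+1%:R)) f - u s) < e / 8 := H1.
    apply: le_trans (csn_tri _ (iter i.+1 (F (s / i.+1%:R)) f) _ _) _.
    rewrite -iterB_clmap; have : q (iter i.+1 (F (s / i.+1%:R)) (x - f)) <= e / 8.
      apply: le_trans (q1P _ _ _ _ _) _; first by rewrite divr_ge0// ltW.
        by rewrite mulrC divfK// pnatr_eq0.
      by rewrite csn_distC ltW.
    lra.
  have := H m Nm; have := H n Nn; rewrite csn_distC => h1 h2.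
  apply: le_lt_trans (csn_tri _ (u s) _ _) _; lra.
have /choice[V0 V0P] := VE; pose V s x := V0 (s, x).
have Vcvg s x : 0 < s -> iter n.+1 (F (s / n.+1%:R)) x @[n --> \oo] --> V s x.
  by have [] := V0P (s, x).
have Vle0 s x : s <= 0 -> V s x = x by have [] := V0P (s, x).
have VL (S : R) q : exists q' : csn X, forall s x y, 0 <= s -> s <= S ->
    q (V s x - V s y) <= q' (x - y).
  have [q1 q1P] := Feq S q; exists q1 => s x y; rewrite le_eqVlt => /predU1P[<-|s0] sS.
    by rewrite !Vle0//; apply: (q1P 0 0%N); rewrite ?mul0r.
  apply/ler_addgt0Pr => e e0; have e2 : 0 < e / 2 by rewrite divr_gt0.
  have /(cvg_csnP Xp)/(_ q _ e2) h1 := Vcvg s x s0.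
  have /(cvg_csnP Xp)/(_ q _ e2) h2 := Vcvg s y s0.
  have [n [{}h1 {}h2]] := filter_ex (filterI h1 h2).
  have {}h1 : q (iter n.+1 (F (s / n.+1%:R)) x - V s x) < e / 2 := h1.
  have {}h2 : q (iter n.+1 (F (s / n.+1%:R)) y - V s y) < e / 2 := h2.
  have : q (iter n.+1 (F (s / n.+1%:R)) x - iter n.+1 (F (s / n.+1%:R)) y) <= q1 (x - y).
    rewrite -iterB_clmap; apply: q1P; first by rewrite divr_ge0// ltW.
    by rewrite mulrC divfK// pnatr_eq0.
  move: h1 h2; set Ix := iter _ _ x; set Iy := iter _ _ y => h1 h2 h3.
  have := csn_tri q Ix (V s x) (V s y); have := csn_tri q Iy Ix (V s y).
  rewrite (csn_distC q (V s x) Ix); lra.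
have Vlin s : linear (V s).
  move=> a x y; have [s0|s0] := leP s 0; first by rewrite !Vle0.
  apply/eqP; rewrite -subr_eq0; apply/eqP.
  apply: (csn_eq0 Xp X_hausdorff) => q; apply/eqP; rewrite -normr_le0 ger0_norm ?csn_ge0//.
  apply/ler_addgt0Pr => e e0; have e3 : 0 < e / 3 by rewrite divr_gt0.
  have la : linear (fun x : X => a *: x) by move=> b u v; rewrite scalerDr !scalerA mulrC.
  have /(cvg_csnP Xp)/(_ (csn_comp q la (@tvs_scaler_continuous _ _ a)) _ e3) h1 := Vcvg s x s0.
  have /(cvg_csnP Xp)/(_ q _ e3) h2 := Vcvg s y s0.
  have /(cvg_csnP Xp)/(_ q _ e3) h3 := Vcvg s (a *: x + y) s0.
  have [n [{}h1 [{}h2 {}h3]]] := filter_ex (filterI h1 (filterI h2 h3)).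
  have {}h1 : q (a *: (iter n.+1 (F (s / n.+1%:R)) x - V s x)) < e / 3 := h1.
  have {}h2 : q (iter n.+1 (F (s / n.+1%:R)) y - V s y) < e / 3 := h2.
  have {}h3 : q (iter n.+1 (F (s / n.+1%:R)) (a *: x + y) - V s (a *: x + y)) < e / 3 := h3.
  move: h1 h2 h3; rewrite iter_linear.
  set Ix := iter _ _ x; set Iy := iter _ _ y => h1 h2 h3.
  have E : a *: (Ix - V s x) + (Iy - V s y) = a *: Ix + Iy - (a *: V s x + V s y).
    by rewrite scalerBr addrACA -opprD.
  have := csn_tri q (a *: Ix + Iy) (V s (a *: x + y)) (a *: V s x + V s y).
  have := csnD q (a *: (Ix - V s x)) (Iy - V s y).
  rewrite E (csn_distC q (V s _) (a *: Ix + Iy)); lra.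
have V0r x : V 0 x = x by exact: Vle0.
have Vbound (S : R) q : exists q' : csn X, forall s x, 0 <= s -> s <= S -> q (V s x) <= q' x.
  have [q' q'P] := VL S q; exists q' => s x s0 sS.
  have Vs0 : V s 0 = 0 by have := Vlin s (-1) 0 0; rewrite scaler0 addr0 scaleN1r addNr.
  by have := q'P s x 0 s0 sS; rewrite Vs0 !subr0.
have Vcont s : continuous (V s).
  apply: csn_linear_continuous (Vlin s) _ => q; have [s0|s0] := leP s 0.
    by exists q => x; rewrite Vle0.
  by have [q' q'P] := Vbound s q; exists q' => x; apply: q'P => //; exact: ltW.
pose T s : clmap X X := CLMap (asboolT (conj (Vlin s) (Vcont s)) : V s \in @is_continuous_linear _ X X).
have TV s x : T s x = V s x by [].
have VA f : A f -> exists u w : R -> X,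
  [/\ locally_lipschitz u, chernoff_path F f u, w 0 = 0,
      forall s : R, 0 <= s -> closure Z0 (w s, u s - f) &
      forall (S : R) q, exists2 L : R, 0 <= L &
        forall a b : R, 0 <= a -> a <= b -> b <= S ->
          q (w b - (w a + ofr (b - a) *: u a)) <= L * (b - a) ^+ 2] /\
  forall s : R, 0 <= s -> V s f = u s.
  move=> Af; have [u [w uw]] := A_path Af; exists u, w; split=> // s.
  have [_ cu _ _ _] := uw; rewrite le_eqVlt => /predU1P[<-|s0].
    rewrite V0r; apply/eqP; rewrite -subr_eq0; apply/eqP.
    apply: (csn_eq0 Xp X_hausdorff) => q; apply/eqP; rewrite -normr_le0 ger0_norm ?csn_ge0//.
    apply/ler_addgt0Pr => e e0; have [h H] := filter_ex (cu 0 q e e0).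
    by have := H 0%N; rewrite mul0r add0r; apply.
  exact: csn_lim_unique (Vcvg s f s0) (chernoff_path_cvg cu s0).
have Vchernoff x : chernoff_path F x (V ^~ x).
  apply: (chernoff_dense VL A_dense) => f Af.
  have [u [w [[_ cu _ _ _] Vu]]] := VA f Af => S q e e0.
  apply: filterS2 (nbhs_right_gt 0) (cu S q e e0) => h h0 H m mS.
  by rewrite Vu ?mulr_ge0 ?(ltW h0)//; exact: H.
have Vunif x (S : R) q (e : R) : 0 < e -> exists2 eta : R, 0 < eta &
    forall a b, 0 <= a -> a <= b -> b <= S -> b - a <= eta -> q (V b x - V a x) <= e.
  move=> e0; have [q' q'P] := VL S q; have e3 : 0 < e / 3 by rewrite divr_gt0.
  have [f Af fx] := A_dense x q' e3; have [u [w [[uL _ _ _ _] Vu]]] := VA f Af.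
  have [L L0 HL] := uL S q; have L1 : 0 < L + 1 by lra.
  exists (e / 3 / (L + 1)); first by rewrite divr_gt0.
  move=> a b a0 ab bS; rewrite ler_pdivlMr// => baL.
  have b0 := le_trans a0 ab; have aS := le_trans ab bS.
  have h1 := q'P b f x b0 bS; have h2 := q'P a f x a0 aS.
  have h3 := HL a b a0 ab bS; rewrite -!Vu// in h3.
  have ba : 0 <= b - a by rewrite subr_ge0.
  have h4 : L * (b - a) <= e / 3 by nra.
  have := csn_tri q (V b f) (V b x) (V a x); have := csn_tri q (V a f) (V b f) (V a x).
  rewrite (csn_distC q (V b x) (V b f)); lra.
(* Both sides are compared with iterates of one common step h. Rounding a and b separately costs
   less than 2 h in a + b, hence the bound eta1 / 2 on h. *)
have Vadd a b x : 0 <= a -> 0 <= b -> V (a + b) x = V a (V b x).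
  move=> a0 b0; apply/eqP; rewrite -subr_eq0; apply/eqP.
  apply: (csn_eq0 Xp X_hausdorff) => q; apply/eqP; rewrite -normr_le0 ger0_norm ?csn_ge0//.
  apply/ler_addgt0Pr => e e0; rewrite add0r; have e6 : 0 < e / 6 by rewrite divr_gt0.
  have [q1 q1P] := Feq a q.
  have [eta1 eta10 H1] := Vunif x (a + b) (csn_add q q1) _ e6.
  have [eta2 eta20 H2] := Vunif (V b x) a q _ e6.
  have C1 := Vchernoff x (a + b) (csn_add q q1) _ e6.
  have C2 := Vchernoff (V b x) a q _ e6.
  have near1 : \forall h \near (0 : R)^'+, 0 < h < Num.min (eta1 / 2) eta2.
    near=> h; apply/andP; split; near: h; first exact: nbhs_right_gt.
    by apply: nbhs_right_lt; rewrite lt_min divr_gt0.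
  have [h [/andP[h0 +] [{}C1 {}C2]]] := filter_ex (filterI near1 (filterI C1 C2)).
  rewrite lt_min => /andP[he1 he2].
  pose m := Num.truncn (a / h); pose m' := Num.truncn (b / h).
  have [m1 m2] := @truncn_bounds R (a / h) (divr_ge0 a0 (ltW h0)).
  have [m1' m2'] := @truncn_bounds R (b / h) (divr_ge0 b0 (ltW h0)).
  rewrite -/m -/m' ler_pdivlMr// in m1 m2 m1' m2'.
  rewrite ltr_pdivrMr// mulrDl mul1r in m2; rewrite ler_pdivlMr// in m1'.
  rewrite ltr_pdivrMr// mulrDl mul1r in m2'.
  have mh0 : 0 <= m%:R * h by rewrite mulr_ge0// ltW.
  have mh0' : 0 <= m'%:R * h by rewrite mulr_ge0// ltW.
  have mm : (m + m')%:R * h = m%:R * h + m'%:R * h by rewrite natrD mulrDl.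
  have s1 : q (V (a + b) x - V ((m + m')%:R * h) x) <= e / 6.
    apply: le_trans (H1 ((m + m')%:R * h) (a + b) _ _ _ _); rewrite ?mm; try by lra_from mh0 mh0' m1 m1' m2 m2' he1.
    by rewrite /= lerDl csn_ge0.
  have s2 : q (V ((m + m')%:R * h) x - iter (m + m') (F h) x) <= e / 6.
    rewrite csn_distC; apply: le_trans (C1 (m + m')%N _); last by rewrite mm; lra_from m1 m1'.
    by rewrite /= lerDl csn_ge0.
  have s3 : q (iter (m + m') (F h) x - iter m (F h) (V b x)) <= e / 3.
    rewrite iterD -iterB_clmap; apply: le_trans (q1P _ _ _ (ltW h0) m1) _.
    apply: le_trans (csn_tri _ (V (m'%:R * h) x) _ _) _.
    have h3 : q1 (iter m' (F h) x - V (m'%:R * h) x) <= e / 6.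
      apply: le_trans (C1 m' _); last by lra_from m1' a0.
      by rewrite /= lerDr csn_ge0.
    have h4 : q1 (V (m'%:R * h) x - V b x) <= e / 6.
      rewrite csn_distC; apply: le_trans (H1 (m'%:R * h) b _ _ _ _); try by lra_from mh0' m1' m2' he1 a0 h0.
      by rewrite /= lerDr csn_ge0.
    lra_from h3 h4.
  have s4 : q (iter m (F h) (V b x) - V (m%:R * h) (V b x)) <= e / 6 by exact: C2.
  have s5 : q (V (m%:R * h) (V b x) - V a (V b x)) <= e / 6.
    by rewrite csn_distC; apply: H2; lra_from mh0 m1 m2 he2.
  have := csn_tri q (V ((m + m')%:R * h) x) (V (a + b) x) (V a (V b x)).
  have := csn_tri q (iter (m + m') (F h) x) (V ((m + m')%:R * h) x) (V a (V b x)).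
  have := csn_tri q (iter m (F h) (V b x)) (iter (m + m') (F h) x) (V a (V b x)).
  have := csn_tri q (V (m%:R * h) (V b x)) (iter m (F h) (V b x)) (V a (V b x)).
  lra_from s1 s2 s3 s4 s5.
have Titer m s x : 0 <= s -> iter m (T s) x = T (m%:R * s) x.
  move=> s0; elim: m => [|m IH]; first by rewrite mul0r TV V0r.
  by rewrite iterS IH !TV -Vadd ?mulr_ge0// -natr1 mulrDl mul1r addrC.
have TC0 : lC0_semigroup p T.
  split.
  - apply/subspace_continuousP => s; rewrite /= in_itv/= andbT => s0.
    apply/pointwise_cvgP => x; apply/(cvg_csnP Xp) => q e e0.
    have e2 : 0 < e / 2 by rewrite divr_gt0.
    have [eta eta0 H] := Vunif x (s + 1) q _ e2.
    have m0 : 0 < Num.min 1 eta by rewrite lt_min ltr01.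
    exists (Num.min 1 eta) => //= r; rewrite /ball_/= lt_min => /andP[r1 r2].
    rewrite in_itv/= andbT => r0.
    have ee : e / 2 < e by lra.
    apply: le_lt_trans ee; move: r1 r2; rewrite !ltr_norml => /andP[r1 r1'] /andP[r2 r2'].
    case: (leP r s) => rs; first by rewrite csn_distC; apply: H => //; lra_from r1' r2' rs.
    by apply: H => //; lra_from r1 r2 rs s0.
  - by move=> x; rewrite TV V0r.
  - by move=> a b a0 b0 x; rewrite !TV Vadd.
  - split=> [x|S S0]; first by rewrite TV V0r.
    apply: (csn_equicontinuous Xp) => q; have [q' q'P] := Vbound S q.
    exists q' => _ [n [m [s [n0 m0 s0 sS ->]]]] x.
    have sn : 0 <= s / n%:R by rewrite divr_ge0.
    by rewrite Titer// TV; apply: q'P; [rewrite mulr_ge0|rewrite mulrA].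
exists T; split=> //; apply/seteqP; split=> -[x y].
  (* Generator within the closed graph: for f in [A] near x, the pair (w(s) / s, (u(s) - f) / s)
     lies in the closed graph. Its first component is a mean of u over [0, s], its second is close
     to (T(s) x - x) / s. *)
  move=> /(generatorP TC0) gxy; apply/(closure_csnP Xp) => q e e0.
  have e6 : 0 < e / 6 by rewrite divr_gt0.
  have [q2 q2P] := VL 1 q.
  have [eta eta0 H] := Vunif x 1 q _ e6.
  have near1 : \forall h \near (0 : R)^'+, 0 < h < Num.min 1 eta.
    near=> h; apply/andP; split; near: h; first exact: nbhs_right_gt.
    by apply: nbhs_right_lt; rewrite lt_min ltr01.
  have [s [/andP[s0 +] Hs]] := filter_ex (filterI near1 (gxy q _ e6)).
  rewrite lt_min => /andP[s1 seta].
  (* Division by s amplifies the distance from f to x, so f is chosen after s and proportionally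
     close. *)
  have es : 0 < e / 6 * Num.min 1 s by rewrite mulr_gt0// lt_min ltr01.
  have [f Af fx] := A_dense x (csn_add q q2) es.
  have m1 : Num.min 1 s <= s by rewrite ge_min lexx orbT.
  have m1' : Num.min 1 s <= 1 by rewrite ge_min lexx.
  have [u [w [[uL cu w0 wZ wu] Vu]]] := VA f Af.
  have [L L0 HL] := wu s q.
  have mean : q (w s - ofr s *: x) <= s * (e / 3).
    apply: (path_mean (ltW s0) w0 HL) => r r0 rs; rewrite -Vu//.
    apply: le_trans (csn_tri _ (V r x) _ _) _.
    have k1 := q2P r f x r0 (le_trans rs (ltW s1)).
    have k2 : q (V r x - x) <= e / 6.
      by rewrite -[X in _ - X]V0r; apply: H => //; lra_from rs s1 seta.
    have k3 : q2 (f - x) <= e / 6.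
      apply: ltW; apply: le_lt_trans (_ : q2 (f - x) <= csn_add q q2 (f - x)) _.
        by rewrite /= lerDr csn_ge0.
      by apply: lt_le_trans fx _; rewrite ler_piMr// ltW.
    lra_from k1 k2 k3.
  have sV : 0 < s^-1 by rewrite invr_gt0.
  have Zs : closure Z0 (ofr s^-1 *: w s, ofr s^-1 *: (u s - f)).
    apply/(closure_csnP Xp) => q' e' e'0.
    have es' : 0 < e' * s by rewrite mulr_gt0.
    have /(closure_csnP Xp)/(_ q' _ es')[c [d [Zcd qc qd]]] := wZ s (ltW s0).
    exists (ofr s^-1 *: c), (ofr s^-1 *: d); split.
    - by have [Z00 ZD] := Z0_linear; have := ZD (ofr s^-1) _ _ Zcd Z00; rewrite addr0.
    - by rewrite -scalerBr csnZ_ge0 ?(ltW sV)// ltr_pdivrMl// mulrC.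
    - by rewrite -scalerBr csnZ_ge0 ?(ltW sV)// ltr_pdivrMl// mulrC.
  have /(closure_csnP Xp)/(_ q _ e6)[c [d [Zcd qc qd]]] := Zs.
  exists c, d; split=> //.
    apply: le_lt_trans (csn_tri _ (ofr s^-1 *: w s) _ _) _.
    have : q (ofr s^-1 *: w s - x) <= e / 3.
      have -> : ofr s^-1 *: w s - x = ofr s^-1 *: (w s - ofr s *: x).
        by rewrite scalerBr scalerA -rmorphM mulVf ?gt_eqF// rmorph1 scale1r.
      by rewrite csnZ_ge0 ?(ltW sV)// ler_pdivrMl.
    lra_from qc e0.
  apply: le_lt_trans (csn_tri _ (ofr s^-1 *: (u s - f)) _ _) _.
  have k1 : q (ofr s^-1 *: (u s - f) - ofr s^-1 *: (V s x - x)) <= e / 6.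
    rewrite -scalerBr csnZ_ge0 ?(ltW sV)// ler_pdivrMl//.
    rewrite -Vu ?(ltW s0)// opprD addrACA -opprD.
    apply: le_trans (csnB _ _ _) _.
    have := q2P s f x (ltW s0) (ltW s1); move: fx => /=.
    have : e / 6 * Num.min 1 s <= s * (e / 6) by rewrite mulrC ler_pM2r.
    lra_from e0.
  have := csn_tri q (ofr s^-1 *: (V s x - x)) (ofr s^-1 *: (u s - f)) y.
  have {}Hs : q (ofr s^-1 *: (V s x - x) - y) < e / 6 := Hs.
  lra_from k1 Hs qd e0.
(* Conversely, for (x', y') in [Z0] near (x, y), the iterates satisfy F(s/n)^n x' = x' + s y' up to
   s O(e), and this survives n -> oo. *)
move=> Zxy; apply/(generatorP TC0) => q e e0.
have e7 : 0 < e / 7 by rewrite divr_gt0.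
have [q1 q1P] := Feq 1 q; have [q2 q2P] := VL 1 q.
have [eta eta0 Heta] := iter_small_time Feq FZ0 Z0_dense y q e7.
have near1 : \forall h \near (0 : R)^'+, 0 < h < Num.min 1 eta.
  near=> h; apply/andP; split; near: h; first exact: nbhs_right_gt.
  by apply: nbhs_right_lt; rewrite lt_min ltr01.
apply: filterS near1 => s /andP[s0]; rewrite lt_min => /andP[s1 seta].
(* Errors in y are multiplied by s and may be of size e; errors in x are not, so they are absorbed
   in [dl], which is arbitrarily small for fixed s. *)
have claim : q (V s x - (x + ofr s *: y)) <= s * (6 * (e / 7)).
  apply/ler_addgt0Pr => dl dl0; have dl4 : 0 < dl / 4 by rewrite divr_gt0.
  have m0 : 0 < Num.min (dl / 4) (e / 7) by rewrite lt_min dl4.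
  have /(closure_csnP Xp)/(_ (csn_add q (csn_add q1 q2)) _ m0)[x' [y' [Zxy' qx qy]]] := Zxy.
  rewrite /= !lt_min in qx qy; have [qx1 _] := andP qx; have [_ qy1] := andP qy.
  have := csn_ge0 q (x' - x); have := csn_ge0 q1 (x' - x); have := csn_ge0 q2 (x' - x).
  have := csn_ge0 q (y' - y); have := csn_ge0 q1 (y' - y); have := csn_ge0 q2 (y' - y).
  move=> p1 p2 p3 p4 p5 p6.
  have A1 := step_near s0 (FZ0 Zxy' q1 e7); have A2 := step_near s0 Heta.
  have /(cvg_csnP Xp)/(_ q _ dl4) A3 := Vcvg s x' s0.
  have [n [{}A1 [{}A2 {}A3]]] := filter_ex (filterI A1 (filterI A2 A3)).
  have {}A3 : q (iter n.+1 (F (s / n.+1%:R)) x' - V s x') < dl / 4 := A3.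
  have h0 : 0 < s / n.+1%:R by rewrite divr_gt0.
  have sE : n.+1%:R * (s / n.+1%:R) = s by rewrite mulrC divfK// pnatr_eq0.
  move: A1 A2 A3 h0 sE; move: (s / n.+1%:R) => h A1 A2 A3 h0 sE.
  have inc : q (iter n.+1 (F h) x' - (x' + ofr s *: y')) <= s * (4 * (e / 7)).
    rewrite -{1 2}sE; apply: iter_increment => // j jn.
    have js : j%:R * h <= s by rewrite -sE ler_pM2r// ler_nat ltnW.
    have k1 : q (iter j (F h) (ofr h^-1 *: (F h x' - x')) - iter j (F h) y') <= e / 7.
      rewrite -iterB_clmap; apply: le_trans (q1P _ _ _ (ltW h0) _) (ltW A1).
      by apply: le_trans js (ltW s1).
    have k2 : q (iter j (F h) y' - iter j (F h) y) <= e / 7.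
      rewrite -iterB_clmap; apply: le_trans (q1P _ _ _ (ltW h0) (le_trans js (ltW s1))) _.
      lra_from qy1 p1 p2 p3.
    have k3 : q (iter j (F h) y - y) <= e / 7 by apply: A2; lra_from js seta.
    have := csn_tri q (iter j (F h) y') (iter j (F h) (ofr h^-1 *: (F h x' - x'))) y'.
    have := csn_tri q (iter j (F h) y) (iter j (F h) y') y'.
    have := csn_tri q y (iter j (F h) y) y'.
    rewrite (csn_distC q y y'); lra_from k1 k2 k3 qy1 p1 p2 p3.
  have k1 := q2P s x x' (ltW s0) (ltW s1); rewrite csn_distC in k1.
  rewrite (csn_distC q2) in k1.
  have k2 : q (x' + ofr s *: y' - (x + ofr s *: y)) <= dl / 4 + s * (e / 7).
    rewrite opprD addrACA -scalerBr; apply: le_trans (csnD _ _ _) _.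
    rewrite csnZ_ge0 ?(ltW s0)//; apply: lerD; first by lra_from qx1 p4 p5 p6.
    by rewrite ler_pM2l//; lra_from qy1 p1 p2 p3.
  have := csn_tri q (V s x') (V s x) (x + ofr s *: y).
  have := csn_tri q (iter n.+1 (F h) x') (V s x') (x + ofr s *: y).
  have := csn_tri q (x' + ofr s *: y') (iter n.+1 (F h) x') (x + ofr s *: y).
  rewrite (csn_distC q (V s x') (iter n.+1 (F h) x')) (csn_distC q (V s x) (V s x')) => B1 B2 B3.
  have : 0 <= s * (e / 7) by rewrite mulr_ge0// ltW.
  move: inc k2; rewrite !(mulrCA s); move: (s * (e / 7)) => z; lra_from A3 k1 B1 B2 B3 qx1 p4 p5 p6.
have sV : 0 < s^-1 by rewrite invr_gt0.
have -> : ofr s^-1 *: (T s x - x) - y = ofr s^-1 *: (V s x - (x + ofr s *: y)).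
  by rewrite opprD addrA [in RHS]scalerBr scalerA -rmorphM mulVf ?gt_eqF// rmorph1 scale1r.
rewrite csnZ_ge0 ?(ltW sV)// ltr_pdivrMl//; apply: le_lt_trans claim _.
by rewrite ltr_pM2l//; lra.
Unshelve. all: by end_near. Qed.

End semigroup_limit.
End semigroup.

(** * Products of two semigroups *)

Section product_semigroups.
Context {R : realType} {k : scalar_kind}.
Notation K := (scalar_field R k).
Local Notation ofr := (@of_real R k).
Variable X : tvsType K.
Implicit Types (q : csn X) (x y z : X) (phi : dual X).
Variables (Omega : Type) (p : Omega -> X -> R).
Hypothesis Xp : generating_seminorms p.

Lemma dense_csn (A : set X) : dense A -> forall x q (e : R), 0 < e ->
  exists2 f, A f & q (f - x) < e.
Proof.
move=> dA x q e e0; have := nbhs_csn q x e0.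
rewrite nbhsE => -[U [oU Ux] Uq].
have [f [Uf Af]] := dA U (ex_intro _ x Ux) oU.
by exists f => //; exact: Uq.
Qed.

Lemma closure_linear (G : set (X * X)) : linear_subspace G -> linear_subspace (closure G).
Proof.
move=> [G0 GD]; split; first exact: subset_closure.
move=> a [x x'] [y y'] /(closure_csnP Xp) Gx /(closure_csnP Xp) Gy.
apply/(closure_csnP Xp) => q e e0; have e2 : 0 < e / 2 by rewrite divr_gt0.
have la : linear (fun x : X => a *: x) by move=> b u v; rewrite scalerDr !scalerA mulrC.
have [c [c' [Gc qc qc']]] := Gx (csn_comp q la (@tvs_scaler_continuous _ _ a)) _ e2.
have [d [d' [Gd qd qd']]] := Gy q _ e2.
exists (a *: c + d), (a *: c' + d'); split; first exact: (GD a _ _ Gc Gd).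
  rewrite opprD addrACA -scalerBr; apply: le_lt_trans (csnD _ _ _) _.
  by rewrite (splitr e); exact: ltrD.
rewrite opprD addrACA -scalerBr; apply: le_lt_trans (csnD _ _ _) _.
by rewrite (splitr e); exact: ltrD.
Qed.

Variables expC expD : R -> clmap X X.
Hypothesis expC_lC0 : lC0_semigroup p expC.
Hypothesis expD_lC0 : lC0_semigroup p expD.
Let C := generator expC.
Let D := generator expD.
Let F s := clmap_comp (expC s) (expD s).

Lemma op_add_linear : linear_subspace (op_add C D).
Proof.
have [C0 CD] := generator_linear Xp expC_lC0; have [D0 DD] := generator_linear Xp expD_lC0.
split; first by exists 0, 0; split => //=; rewrite addr0.
move=> a [x x'] [y y'] [/= u [v [Cu Dv ->]]] [/= u' [v' [Cu' Dv' ->]]].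
exists (a *: u + u'), (a *: v + v'); split => /=; first exact: (CD a _ _ Cu Cu').
  exact: (DD a _ _ Dv Dv').
by rewrite scalerDr addrACA.
Qed.

(** Product rule: F(h) x - x = exp(hC)(exp(hD) x - x) + (exp(hC) x - x), the outer factor being
    controlled by equicontinuity for h <= 1. *)
Lemma product_derivative_extends : derivative_extends F (op_add C D).
Proof.
move=> x y [/= u [v [Cu Dv ->]]] q e e0.
have e4 : 0 < e / 4 by rewrite divr_gt0.
have [q1 q1P] := semigroup_equicontinuous Xp expC_lC0 1 q.
have A1 := iffLR (generatorP Xp expC_lC0 x u) Cu q _ e4.
have A2 := iffLR (generatorP Xp expD_lC0 x v) Dv q1 _ e4.
have A3 := semigroup_near Xp expC_lC0 q v e4.
near=> h.
have h0 : 0 < h by near: h; exact: nbhs_right_gt.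
have h1 : h <= 1 by near: h; exact: nbhs_right_le.
near_at A1 h B1; near_at A2 h B2; near_at A3 h B3.
have -> : ofr h^-1 *: (F h x - x) - (u + v) =
    (expC h (ofr h^-1 *: (expD h x - x) - v)) + (expC h v - v) +
    (ofr h^-1 *: (expC h x - x) - u).
  rewrite clmapB clmapZ clmapB -[F h x]/(expC h (expD h x)) (addrC u).
  by rewrite [in RHS]subrKA [in RHS]addrACA -[in RHS]scalerDr [in RHS]subrKA -opprD.
apply: le_lt_trans (csnD _ _ _) _.
have := csnD q (expC h (ofr h^-1 *: (expD h x - x) - v)) (expC h v - v).
have := q1P h (ofr h^-1 *: (expD h x - x) - v) (ltW h0) h1.
by move: B1 B2 B3 => /=; lra.
Unshelve. all: by end_near. Qed.

Lemma adjoint_near (T : R -> clmap X X) phi chi : (forall x, T 0 x = x) ->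
  dual_derivative T (phi, chi) -> forall A : set X, csn_bounded A ->
  forall e : R, 0 < e -> \forall h \near 0^'+, forall x, A x ->
    `|h^-1 * (rfun_dual phi (T h x) - rfun_dual phi x) - rfun_dual chi x| < e.
Proof.
move=> T0 Tpc A /(csn_bounded_tvs Xp) bA e e0.
have N : \forall h \near 0^'+, forall x, A x -> `|chi x -
    ((of_real k h)^-1 *: (adjoint (T h) phi - adjoint (T 0) phi) : dual X) x| < ofr e.
  exact: dual_cvg_bounded Tpc _ bA _ e0.
apply: filterS N => h N x Ax; have := N x Ax; rewrite distrC => H.
rewrite -(ltr_of_real (k := k)); apply: le_lt_trans H.
apply: le_trans (re_part_norm _); rewrite ler_of_real.
rewrite le_eqVlt; apply/orP; left; apply/eqP; congr `|_|.
have reB (a b : K) : re_part (a - b) = re_part a - re_part b.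
  by have := re_partZ (-1) b; rewrite rmorphN1 !mulN1r re_partD => ->.
have -> : ((of_real k h)^-1 *: (adjoint (T h) phi - adjoint (T 0) phi)) x =
  ofr h^-1 * (phi (T h x) - phi x).
  by rewrite -[LHS]/((ofr h)^-1 * (phi (T h x) - phi (T 0 x))) T0 fmorphV.
by rewrite reB re_partZ reB.
Qed.

Variable B : set (dual X).
Hypothesis B_dom : B `<=` op_dom (dual_derivative expC) `&` op_dom (dual_derivative expD).
Hypothesis expD_cont : forall x : dual X, op_image (dual_derivative expC) B x ->
  adjoint (expD s) x @[s --> within `[0, +oo[ (nbhs (0 : R))] --> adjoint (expD 0) x.

(** In the quotient for exp(hC) the base point exp(hD) x moves with h but stays in the bounded set
    [A'], on which the derivative is uniform. Replacing C° phi at exp(hD) x by its value at x,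
    uniformly on [A], is condition (iv). *)
Lemma product_adjoint_derivative phi : B phi ->
  exists chi : dual X, adjoint_derivative F (rfun_dual phi) (rfun_dual chi).
Proof.
move=> Bphi; have [[chiC HC] [chiD HD]] := B_dom Bphi.
pose chi : dual X := chiC + chiD; exists chi => A bA e e0; have e4 : 0 < e / 4 by rewrite divr_gt0.
pose A' := [set y | exists h x, [/\ 0 <= h, h <= 1, A x & y = expD h x]].
have bA' : csn_bounded A'.
  move=> q; have [q1 q1P] := semigroup_equicontinuous Xp expD_lC0 1 q.
  have [M MP] := bA q1; exists M => _ [h [x [h0 h1 Ax ->]]].
  exact: le_trans (q1P _ _ h0 h1) (MP _ Ax).
have N1 := adjoint_near (lC0_0 expC_lC0) HC bA' e4.
have N2 := adjoint_near (lC0_0 expD_lC0) HD bA e4.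
have sub (P : set R) : within `[0, +oo[ (nbhs (0 : R)) P -> 0^'+ P.
  move=> H; have {}H : nbhs (0 : R) (fun s => s \in `[0, +oo[ -> P s) := H.
  suff : nbhs (0 : R) (fun s => 0 < s -> P s) by [].
  by apply: filterS H => s Ps s0; apply: Ps; rewrite in_itv/= andbT ltW.
have N3 : \forall h \near 0^'+, forall x, A x -> `|chiC x - chiC (expD h x)| < ofr (e / 4).
  apply: sub; have H : within `[0, +oo[ (nbhs (0 : R)) (fun h => forall x, A x ->
      `|adjoint (expD 0) chiC x - adjoint (expD h) chiC x| < ofr (e / 4)).
    exact: dual_cvg_bounded _ (expD_cont (ex_intro2 _ _ phi Bphi HC)) _
      (csn_bounded_tvs Xp bA) _ e4.
  apply: filterS H => h H x Ax; have := H x Ax.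
  by rewrite -[X in `|X - _|]/(chiC (expD 0 x)) (lC0_0 expD_lC0).
near=> h => x Ax.
have h0 : 0 < h by near: h; exact: nbhs_right_gt.
have h1 : h <= 1 by near: h; exact: nbhs_right_le.
near_at N1 h M1; near_at N2 h M2; near_at N3 h M3.
have {}M1 : `|h^-1 * (rfun_dual phi (expC h (expD h x)) - rfun_dual phi (expD h x)) -
    rfun_dual chiC (expD h x)| < e / 4.
  by apply: M1; exists h, x; split=> //; exact: ltW.
have {}M2 := M2 x Ax; have {}M3 := M3 x Ax.
have M4 : `|rfun_dual chiC x - rfun_dual chiC (expD h x)| < e / 4.
  rewrite -(ltr_of_real (k := k)); apply: le_lt_trans M3.
  apply: le_trans (re_part_norm _); rewrite ler_of_real.
  rewrite le_eqVlt; apply/orP; left; apply/eqP; congr `|_|.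
  have := re_partZ (-1) (chiC (expD h x)); rewrite rmorphN1 !mulN1r => /= <-.
  by rewrite -re_partD.
have -> : rfun_dual chi x = rfun_dual chiC x + rfun_dual chiD x.
  by rewrite -[RHS]re_partD.
rewrite -[F h x]/(expC h (expD h x)).
move: M1 M2 M4; move: (rfun_dual phi (expC h (expD h x))) (rfun_dual phi (expD h x))
  (rfun_dual phi x) (rfun_dual chiC (expD h x)) (rfun_dual chiC x) (rfun_dual chiD x).
move=> a b c d' f g M1 M2 M4.
have -> : h^-1 * (a - c) - (f + g) = (h^-1 * (a - b) - d') - (f - d') + (h^-1 * (b - c) - g) by ring.
apply: le_trans (ler_normD _ _) _.
have := ler_normB (h^-1 * (a - b) - d') (f - d').
lra.
Unshelve. all: by end_near. Qed.

Lemma product_adjoint_dense : star_dense B -> forall l : rfun X,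
  exists lam kap : nat -> rfun X, (forall x, lam n x @[n --> \oo] --> l x) /\
    forall n, adjoint_derivative F (lam n) (kap n).
Proof.
move=> dB l; have [phi Bphi phil] := star_dense_rfun dB l.
have /choice[chi chiP] := fun n => product_adjoint_derivative (Bphi n).
by exists (fun n => rfun_dual (phi n)), (fun n => rfun_dual (chi n)).
Qed.

End product_semigroups.

(** * The equivalence and the product formula *)

Lemma weakly_seq_precompactP (R : realType) (k : scalar_kind)
    (X : tvsType (scalar_field R k)) (u : nat -> X) : weakly_seq_precompact u ->
  forall i, {homo i : m n / (m < n)%N} -> exists2 j : nat -> nat,
    {homo j : m n / (m < n)%N} & exists x, rweak_cvg (u \o i \o j) x.
Proof.
move=> up i hi; have [j [hj [x ux]]] := up i hi.
by exists j => //; exists x; exact: weak_cvg_rfun.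
Qed.

Theorem corollary8p2 (R : realType) (k : scalar_kind)
    (X : tvsType (scalar_field R k)) (Omega : Type) (p : Omega -> X -> R)
    (Xp : generating_seminorms p) (X_hausdorff : hausdorff_space X)
    (X_complete : tvs_complete X)
    (expC expD : R -> clmap X X)
    (expC_lC0 : lC0_semigroup p expC) (expD_lC0 : lC0_semigroup p expD)
    (C D : set (X * X)) (C_gen : C = generator expC) (D_gen : D = generator expD)
    (t : R) (t_gt0 : 0 < t)
    (B : set (dual X))
    (B_dom : B `<=` op_dom (dual_derivative expC) `&`
                    op_dom (dual_derivative expD))
    (dom_dense : dense (op_dom C `&` op_dom D))
    (B_dense : star_dense B)
    (CD_class_E : class_E p (fun s => clmap_comp (expC s) (expD s)))
    (expD_cont : forall x : dual X, op_image (dual_derivative expC) B x ->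
      adjoint (expD s) x @[s --> within `[0, +oo[ (nbhs (0 : R))]
        --> adjoint (expD 0) x) :
  ((closable (op_add C D) /\
    exists T : R -> clmap X X,
      lC0_semigroup p T /\ generator T = closure (op_add C D)) <->
   (exists A : set X, trotter_subspace expC expD t C D A)) /\
  (forall A : set X, trotter_subspace expC expD t C D A ->
   forall T : R -> clmap X X,
     lC0_semigroup p T -> generator T = closure (op_add C D) ->
   forall (f : X) (s : R), 0 <= s ->
     iter n (clmap_comp (expC (s / n%:R)) (expD (s / n%:R))) f @[n --> \oo]
       --> T s f).
Proof.
subst C D; set C := generator expC; set D := generator expD.
pose F s := clmap_comp (expC s) (expD s).
have Feq : locally_equicontinuous F := class_E_equicontinuous Xp CD_class_E.
have Zlin : linear_subspace (op_add C D) := op_add_linear Xp expC_lC0 expD_lC0.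
have FZ : derivative_extends F (op_add C D) := product_derivative_extends Xp expC_lC0 expD_lC0.
have domE x : op_dom (op_add C D) x <-> (op_dom C `&` op_dom D) x.
  split=> [[y [/= u [v [Cu Dv _]]]]|[[u Cu] [v Dv]]]; first by split; [exists u|exists v].
  by exists (u + v), u, v.
have Zdense (x : X) (q : csn X) (e : R) : 0 < e ->
    exists x' y', op_add C D (x', y') /\ q (x' - x) < e.
  move=> e0; have [x' /domE[y' Zx'] qx] := dense_csn dom_dense x q e0.
  by exists x', y'.
have adj := product_adjoint_dense Xp expC_lC0 expD_lC0 B_dom expD_cont B_dense.
have chernoff (T : R -> clmap X X) : lC0_semigroup p T -> generator T = closure (op_add C D) ->
    forall x, chernoff_path F x (fun s => T s x).
  exact: semigroup_chernoff.
split; last first.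
  move=> _ _ T TC0 gT f s; rewrite le_eqVlt => /predU1P[<-|s0].
    rewrite (lC0_0 TC0); have -> : (fun n : nat => iter n (F (0 / n%:R)) f) = fun=> f.
      by apply/funext => n; rewrite mul0r; elim: n => //= n ->; rewrite (lC0_0 expD_lC0) (lC0_0 expC_lC0).
    exact: cvg_cst.
  apply/(cvg_csnP Xp) => q e e0.
  have /(cvg_csnP Xp)/(_ q e e0)[N _ NP] := chernoff_path_cvg Xp (chernoff T TC0 gT f) s0.
  (* The known limit is indexed from 1, so index 0, with its step s / 0, is skipped. *)
  by exists N.+1 => // -[//|n] Nn; exact: NP.
split=> [[_ [T [TC0 gT]]]|[A [_ dA Adom Atrotter]]].
  (* On the intersection of the domains T(t s) f stays in the domain of the closure, so constant
     sequences satisfy (b) and (c) and only (a) needs Chernoff's theorem. *)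
  exists (op_dom C `&` op_dom D); split=> //.
    have [Z0 ZD] := Zlin; split; first by apply/domE; exists 0.
    move=> a x y /domE[x' Zx] /domE[y' Zy]; apply/domE; exists (a *: x' + y').
    exact: (ZD a _ _ Zx Zy).
  move=> f s /domE[f' Zf] s0.
  have ts0 : 0 <= t * s by rewrite mulr_ge0// ltW.
  have tsE : t * s / t = s by rewrite mulrAC divff ?mul1r// gt_eqF.
  have cst_precompact (x : X) : weakly_seq_precompact (fun=> x).
    by move=> i hi; exists id; split=> //; exists x; apply: cvg_cst.
  exists (fun=> T (t * s) f), (fun=> T (t * s) f'); split=> //.
    move=> n; rewrite -gT; apply: (generator_invariant Xp TC0) => //.
    by rewrite gT; exact: subset_closure.
  apply/cvg_weak_cvg/(cvg_csnP Xp) => q e e0.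
  have e3 : 0 < e / 3 by rewrite divr_gt0.
  have [eta eta0 H] := semigroup_unif Xp TC0 q f (t * s) e3.
  have N1 := step_near t_gt0 (chernoff T TC0 gT f (t * s) q _ e3).
  have N2 := step_near t_gt0 (nbhs_right_lt eta0).
  apply: filterS2 N1 N2 => n N1 N2; rewrite subr0.
  have [m1 m2] := step_count t_gt0 n ts0; rewrite tsE in m1 m2.
  have h0 := step_gt0 t_gt0 n.
  have H1 := N1 _ m1.
  have H2 : q (T (t * s) f - T ((Num.truncn (n.+1%:R * s))%:R * (t / n.+1%:R)) f) <= e / 3.
    apply: H => //; first by rewrite mulr_ge0// ltW.
    by rewrite lerBlDr; apply: le_trans (ltW m2) _; rewrite addrC lerD2r ltW.
  apply: le_lt_trans (csn_tri _ (T ((Num.truncn (n.+1%:R * s))%:R * (t / n.+1%:R)) f) _ _) _.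
  rewrite csn_distC in H2; move: H1; rewrite -/F; lra.
have Zclos y : closure (op_add C D) (0, y) -> y = 0.
  exact: (adjoint_closable Xp FZ adj).
split.
  split; first exact: (closure_linear Xp Zlin).
  move=> x y z Zxy Zxz; apply/eqP; rewrite -subr_eq0; apply/eqP; apply: Zclos.
  have [_ ZD] := closure_linear Xp Zlin; have := ZD (-1) _ _ Zxz Zxy.
  rewrite (_ : -1 *: (x, z) + (x, y) = (0, y - z))//.
  by congr pair; rewrite /= scaleN1r addrC ?subrr.
apply: (semigroup_of_paths Xp Feq Zlin FZ Zdense X_complete X_hausdorff (dense_csn dA)).
move=> f Af; have [f' Zf] : op_dom (op_add C D) f by apply/domE; exact: Adom.
apply: (trotter_weak_strong Xp X_complete Feq Zlin FZ Zdense adj t_gt0 Zf) => // s s0.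
(* The path is parametrised by elapsed time, the conditions by multiples of [t]. *)
have st0 : 0 <= s / t by rewrite divr_ge0// ltW.
have [u [v [Zuv uv up vp]]] := Atrotter f (s / t) Af st0.
exists u, v; split=> //; first exact: (weak_cvg_rfun uv).
  exact: weakly_seq_precompactP.
exact: weakly_seq_precompactP.
Qed.
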